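(* Let $n\ge2$ and consider an $n$-dimensional linear Hopf manifold equipped with a metric $g(\alpha_0,\beta_0)$ ($\alpha_0>0$, $\beta_0>-\alpha_0$). Let $a,b,c,d$ be real numbers with $$(n-2)a-2b+(n-1)^2c-(n-1)d\le n\frac{\gamma_n}{\gamma_n+1},$$ where $\gamma_2=0$ and $\gamma_n=-\frac12$ for $n\ge3$. If the metric $g(\alpha_0,\beta_0)$ is Bismut-Griffiths-non-negative, then the Hermitian curvature flow with coefficients $(a,b,c,d)$ starting at $g(\alpha_0,\beta_0)$ preserves the Bismut-Griffiths-non-negativity.
   Context: A linear Hopf manifold of complex dimension $n$ is $M^n=(\mathbb C^n\setminus\{0\})/\!\sim$, where $(z_1,\dots,z_n)\sim(a_1z_1,\dots,a_nz_n)$ for fixed $(a_1,\dots,a_n)\in\mathbb C^n\setminus\{0\}$ with $|a_1|=\dots=|a_n|\ne1$, with its natural complex structure. For real $\alpha>0$, $\beta>-\alpha$, $g(\alpha,\beta)$ is the Hermitian metric $g(\alpha,\beta)_{i\bar j}=\alpha\frac{\delta_{ij}}{|z|^2}+\beta\frac{\bar z_iz_j}{|z|^4}$. The Bismut connection $\nabla^+$ of a Hermitian manifold is the unique Hermitian connection ($\nabla^+g=0$, $\nabla^+J=0$) with totally skew-symmetric torsion; its curvature tensor is $\Omega^B(X,Y,Z,W)=g(R^+(X,Y)Z,W)$, $R^+(X,Y)=[\nabla^+_X,\nabla^+_Y]-\nabla^+_{[X,Y]}$, extended complex-multilinearly. The metric is Bismut-Griffiths-non-negative if $\Omega^B\in\wedge^{1,1}M\otimes\wedge^{1,1}M$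 and $\Omega^B(\xi,\bar\xi,\nu,\bar\nu)\ge0$ for all nonzero $\xi,\nu\in T^{1,0}M$. The Hermitian curvature flow (HCF) with coefficients $(a,b,c,d)$ is $\frac{\partial}{\partial t}g=-S+aQ^1+bQ^2+cQ^3+dQ^4$, where, with $\Omega^{Ch}$ and $T=T^{Ch}$ the curvature and torsion of the Chern connection (torsion indices lowered by $g$, $T_{ik\bar n}=T_{ik}^pg_{p\bar n}$, $T_{\bar j\bar l m}=\overline{T_{jl\bar m}}$), $S_{i\bar j}=g^{k\bar l}\Omega^{Ch}_{k\bar li\bar j}$, and $Q^1_{i\bar j}=g^{k\bar l}g^{m\bar n}T_{ik\bar n}T_{\bar j\bar lm}$, $Q^2_{i\bar j}=g^{k\bar l}g^{m\bar n}T_{km\bar j}T_{\bar l\bar ni}$, $Q^3_{i\bar j}=g^{k\bar l}g^{m\bar n}T_{ik\bar l}T_{\bar j\bar nm}$, $Q^4_{i\bar j}=\frac12g^{k\bar l}g^{m\bar n}(T_{mk\bar l}T_{\bar n\bar ji}+T_{mi\bar j}T_{\bar n\bar lk})$. The flow starting at a metric preserves the property if the evolved metrics have it for as long as the flow exists. *)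

(* Defs.v *)
(* MathComp-Analysis.  A point of C^n is a row vector z : 'rV[R[i]]_n.  The Hopf
   manifold M = (C^n \ {0}) / <z ~ (lam_1 z_1, ..., lam_n z_n)> is handled
   through its holomorphic covering C^n \ {0} -> M: a tensor field on M is a
   tensor field on C^n \ {0} (functions of z, only their values at z != 0 matter)
   invariant under the deck transformation, and local notions (connections,
   torsion, curvature, the flow equation) are computed in the coordinates z. *)
From HB Require Import structures.
From mathcomp Require Import all_boot all_order all_algebra.
From mathcomp Require Import complex.
From mathcomp Require Import all_classical all_reals all_analysis.

Set Implicit Arguments.
Unset Strict Implicit.
Unset Printing Implicit Defensive.

Import Order.TTheory GRing.Theory Num.Theory.
Import numFieldNormedType.Exports.

Local Open Scope classical_set_scope.
Local Open Scope ring_scope.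

Section SmoothFunctions.
Variables (R : realType) (V : normedModType R).

(* All iterated directional derivatives exist and are continuous on the (open)
   set A. *)
Definition smooth_on (A : set V) (f : V -> R) : Prop :=
  forall (vs : seq V) (p : V), A p ->
    let D := foldr (fun v h => (fun q => 'D_v h q)) f vs in
    {for p, continuous D} /\ forall v, derivable D p v.

End SmoothFunctions.

Section HopfGeometry.
Variables (R : realType) (n : nat).
Notation C := R[i].
Notation pt := 'rV[C]_n.
Notation rpt := ('rV[R]_n * 'rV[R]_n)%type.

(* The identification R^n x R^n = C^n, (x, y) |-> x + i y, and its inverse. *)
Definition of_real (p : rpt) : pt := \row_k Complex (p.1 0 k) (p.2 0 k).
Definition to_real (z : pt) : rpt :=
  (\row_k complex.Re (z 0 k), \row_k complex.Im (z 0 k)).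

Definition real_deriv (v : rpt) (f : pt -> C) (z : pt) : C :=
  Complex ('D_v (fun p => complex.Re (f (of_real p))) (to_real z))
          ('D_v (fun p => complex.Im (f (of_real p))) (to_real z)).

Definition dz (k : 'I_n) (f : pt -> C) (z : pt) : C :=
  (real_deriv (delta_mx 0 k, 0) f z
     - 'i%C * real_deriv (0, delta_mx 0 k) f z) / 2.
Definition dzbar (k : 'I_n) (f : pt -> C) (z : pt) : C :=
  (real_deriv (delta_mx 0 k, 0) f z
     + 'i%C * real_deriv (0, delta_mx 0 k) f z) / 2.

Definition time_deriv (f : R -> C) (t : R) : C :=
  Complex (derive1 (fun s => complex.Re (f s)) t)
          (derive1 (fun s => complex.Im (f s)) t).

(* Indices of the frame (d/dz_1, ..., d/dz_n, d/dzbar_1, ..., d/dzbar_n) of the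
   complexified tangent bundle: inl k stands for d/dz_k, inr k for d/dzbar_k. *)
Definition idx := ('I_n + 'I_n)%type.

Definition bar (A : idx) : idx :=
  match A with inl k => inr k | inr k => inl k end.

Definition same_type (A B : idx) : bool :=
  match A, B with inl _, inl _ | inr _, inr _ => true | _, _ => false end.

Definition dfr (A : idx) : (pt -> C) -> pt -> C :=
  match A with inl k => dz k | inr k => dzbar k end.

(* J Z_A = Jeig A * Z_A for the complex structure J. *)
Definition Jeig (A : idx) : C := match A with inl _ => 'i%C | inr _ => - 'i%C end.

(* A metric is given by the matrix g z i j = g(d/dz_i, d/dzbar_j) at z. *)
Definition metric := pt -> 'M[C]_n.

Definition gC (G : 'M[C]_n) (A B : idx) : C :=
  match A, B with
  | inl i, inr j => G i j
  | inr i, inl j => G j i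
  | _, _ => 0
  end.

Definition deck (lam z : pt) : pt := \row_k (lam 0 k * z 0 k).

(* Pointwise Hermitian positive definite and equal to its pullback under the
   deck transformation; smoothness is imposed separately. *)
Definition hermitian_on_hopf (lam : pt) (g : metric) : Prop :=
  forall z : pt, z != 0 ->
    [/\ forall i j, g z j i = (g z i j)^*,
        forall v : pt, v != 0 ->
          0 < \sum_i \sum_j v 0 i * (v 0 j)^* * g z i j
      & forall i j, g z i j = lam 0 i * (lam 0 j)^* * g (deck lam z) i j].

Definition sqnorm (z : pt) : C := \sum_k z 0 k * (z 0 k)^*.

Definition hopf_metric (alpha beta : R) : metric := fun z =>
  \matrix_(i, j) (alpha%:C%C * (i == j)%:R / sqnorm z
                  + beta%:C%C * ((z 0 i)^* * z 0 j) / sqnorm z ^+ 2).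

(* Connections on the complexified tangent bundle:
   nabla_{Z_A} Z_B = sum_D Gam z A B D Z_D. *)
Definition connection := pt -> idx -> idx -> idx -> C.

Definition torsion (Gam : connection) (z : pt) (A B D : idx) : C :=
  Gam z A B D - Gam z B A D.

(* g(T(Z_A, Z_B), Z_D) *)
Definition torsion_low (g : metric) (Gam : connection) z (A B D : idx) : C :=
  \sum_E torsion Gam z A B E * gC (g z) E D.

(* R(Z_A, Z_B) Z_P = sum_D (curv Gam z A B P D) Z_D; the Z_A commute. *)
Definition curv (Gam : connection) (z : pt) (A B P D : idx) : C :=
  dfr A (fun w => Gam w B P D) z - dfr B (fun w => Gam w A P D) z
  + \sum_E (Gam z B P E * Gam z A E D - Gam z A P E * Gam z B E D).

(* g(R(Z_A, Z_B) Z_P, Z_Q) *)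
Definition Omega (g : metric) (Gam : connection) z (A B P Q : idx) : C :=
  \sum_D curv Gam z A B P D * gC (g z) D Q.

(* Complexification of a real connection (first clause) with nabla g = 0 and
   nabla J = 0. *)
Definition hermitian_connection (g : metric) (Gam : connection) : Prop :=
  forall z : pt, z != 0 ->
    [/\ forall A B D, Gam z (bar A) (bar B) (bar D) = (Gam z A B D)^*,
        forall A B D, dfr A (fun w => gC (g w) B D) z =
          \sum_E (Gam z A B E * gC (g z) E D + Gam z A D E * gC (g z) B E)
      & forall A B D, Gam z A B D * Jeig B = Jeig D * Gam z A B D].

Definition is_bismut (g : metric) (Gam : connection) : Prop :=
  hermitian_connection g Gam /\
  forall z : pt, z != 0 -> forall A B D,
    torsion_low g Gam z A B D = - torsion_low g Gam z B A D /\
    torsion_low g Gam z A B D = - torsion_low g Gam z A D B.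

(* Chern connection: the Hermitian connection whose torsion has no (1,1)-part. *)
Definition is_chern (g : metric) (Gam : connection) : Prop :=
  hermitian_connection g Gam /\
  forall z : pt, z != 0 -> forall i j D, torsion Gam z (inl i) (inr j) D = 0.

(* Skew-symmetry of Omega in each pair of arguments holds for every metric
   connection, so membership in /\^{1,1} (x) /\^{1,1} is the vanishing on pairs
   of equal type. *)
Definition bismut_griffiths_nonneg (g : metric) : Prop :=
  exists2 Gam : connection, is_bismut g Gam &
    forall z : pt, z != 0 ->
      (forall A B P Q, same_type A B || same_type P Q ->
         Omega g Gam z A B P Q = 0) /\
      (forall xi nu : pt, xi != 0 -> nu != 0 ->
         0 <= \sum_i \sum_j \sum_k \sum_l
                xi 0 i * (xi 0 j)^* * nu 0 k * (nu 0 l)^*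
                * Omega g Gam z (inl i) (inr j) (inl k) (inr l)).

Section HermitianCurvatureFlow.
Variables (g : metric) (Gam : connection) (z : pt).

(* g^{k lbar}, with sum_l g^{k lbar} g_{m lbar} = delta_{km} *)
Definition ginv (k l : 'I_n) : C := invmx (g z) l k.

Definition Tlow (i k m : 'I_n) : C :=
  torsion_low g Gam z (inl i) (inl k) (inr m).
Definition Tlowbar (j l m : 'I_n) : C := (Tlow j l m)^*.

Definition Scurv (i j : 'I_n) : C :=
  \sum_k \sum_l ginv k l * Omega g Gam z (inl k) (inr l) (inl i) (inr j).

Definition Q1 (i j : 'I_n) : C :=
  \sum_k \sum_l \sum_m \sum_p
    ginv k l * ginv m p * Tlow i k p * Tlowbar j l m.

Definition Q2 (i j : 'I_n) : C :=
  \sum_k \sum_l \sum_m \sum_p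
    ginv k l * ginv m p * Tlow k m j * Tlowbar l p i.

Definition Q3 (i j : 'I_n) : C :=
  \sum_k \sum_l \sum_m \sum_p
    ginv k l * ginv m p * Tlow i k l * Tlowbar j p m.

Definition Q4 (i j : 'I_n) : C :=
  2^-1 * \sum_k \sum_l \sum_m \sum_p
    ginv k l * ginv m p
    * (Tlow m k l * Tlowbar p j i + Tlow m i j * Tlowbar p l k).

End HermitianCurvatureFlow.

(* Smoothness on [0, T[ x (C^n \ {0}), understood at t = 0 as the existence of a
   smooth extension to slightly negative times. *)
Definition smooth_family (T : R) (g : R -> metric) : Prop :=
  exists2 t0 : R, t0 < 0 &
    forall i j,
      let A := [set p : R * rpt | t0 < p.1 < T /\ of_real p.2 != 0] in
      smooth_on A (fun p => complex.Re (g p.1 (of_real p.2) i j)) /\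
      smooth_on A (fun p => complex.Im (g p.1 (of_real p.2) i j)).

(* Solutions on [0, T[ of the Hermitian curvature flow with coefficients
   (a, b, c, d) on the Hopf manifold defined by lam. *)
Definition HCF_solution (lam : pt) (a b c d T : R) (g : R -> metric) : Prop :=
  smooth_family T g /\
  forall t : R, 0 <= t < T ->
    hermitian_on_hopf lam (g t) /\
    exists2 Gam : connection, is_chern (g t) Gam &
      forall z : pt, z != 0 -> forall i j,
        time_deriv (fun s => g s z i j) t =
          - Scurv (g t) Gam z i j
          + a%:C%C * Q1 (g t) Gam z i j + b%:C%C * Q2 (g t) Gam z i j
          + c%:C%C * Q3 (g t) Gam z i j + d%:C%C * Q4 (g t) Gam z i j.

End HopfGeometry.

(* Only meant for n >= 2. *)
Definition gamma (R : realType) (n : nat) : R := if n == 2%N then 0 else - 2^-1.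

(* Main.v *)
Require Import Defs.
From HB Require Import structures.
From mathcomp Require Import all_boot all_order all_algebra.
From mathcomp Require Import complex ring lra zify.
From mathcomp Require Import all_classical all_reals all_analysis.
Set Implicit Arguments.
Unset Strict Implicit.
Unset Printing Implicit Defensive.
Import Order.TTheory GRing.Theory Num.Theory.
Import numFieldNormedType.Exports.
Local Open Scope classical_set_scope.
Local Open Scope ring_scope.

(** The Hopf metrics form a two-parameter family, best described by the scale
    [al = alpha] and the anisotropy [y = (alpha + beta) / alpha], the ratio of
    the radial to the transverse squared lengths.  Two computations and one uniqueness
    argument give the theorem.

    Bismut curvature.  Skew-symmetry of the torsion determines the lowered Bismut
    symbols as combinations of first derivatives of the metric
    ([bismut_low_same], [bismut_low_mixed]).  For a Hopf metric this gives
    [Omega (i jbar k lbar) = al / |z|^4 * (P_kj P_il + (1 - 2 y) P_ij P_kl)], with [P]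
    the orthogonal projection onto the complement of the radial direction
    ([Omega_hopf]).  On vectors with projections [xi'], [nu'] the curvature form is
    [|<xi', nu'>|^2 + (1 - 2 y) |xi'|^2 |nu'|^2]; the projections fill a space of
    dimension [n - 1], so Cauchy-Schwarz is an equality for [n = 2] and the first
    term can vanish for [n >= 3].  Hence the criterion [y <= 1 + gamma]
    ([griffiths_suff], [griffiths_nec]).

    Reduction to scalar equations.  The right-hand side of the flow at a Hopf metric
    is [|z|^-2 ((- n + B y) P + A y^2 E)], with [E] the radial projection and [A], [B]
    affine in the coefficients of the flow ([hopf_rhs]).  In the time [tau] with
    [d tau / dt = 1 / al], the inverse anisotropy [v = 1 / y] satisfies the linear
    equation [dv / d tau = (B - A) - n v], and [B - A] is [n] minus the left-hand side
    of the hypothesis on the coefficients.  That hypothesis says exactly that the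
    equilibrium [(B - A) / n] is at least [1 / (1 + gamma)], a bound which [v] thus
    keeps if it has it at the start ([hopf_ode]).

    Uniqueness.  It remains to see that an arbitrary solution [g] stays in the
    family.  It is compared with Hopf metrics [G] built from the scalar equations run
    at the rate [1 / Re g_pp(e0)] read off [g] itself at a point [e0] where Hopf
    metrics have the entry [al]; so [G] exists as long as [g] does, and it solves the
    flow up to a factor that differs from [1] by a multiple of [|g - G|(e0)].  The
    principal part of the flow is [sum_kl g^{k lbar} d_k d_lbar g_ij], so [h = g - G]
    satisfies a linear parabolic system, with coefficients bounded on a fundamental
    annulus, up to this nonlocal term.  The function [|z|^4 |h|^2] is invariant under
    the deck transformation, hence attains its maximum over space.  There the second
    derivative test controls the second order terms and leaves a negative multiple
    of the energy of the first derivatives, which absorbs the lower order terms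
    ([operator_max], [spatial_bound]); the weight [|z|^4] makes the value of [h] at
    [e0] comparable with its value at the maximum.  Damping by [exp (- L t)] with [L]
    large then excludes a positive maximum over space and time ([flow_is_hopf]). *)

(** * Functions with iterated directional derivatives on an open set *)

Section DirectionalCk.
Context {R : realType} {V : normedModType R}.
Variable A : set V.
Implicit Types (f g : V -> R) (p u v : V) (k : nat).

(** Everything below needs only finitely many derivatives on an open set, and this
    notion is closed under algebraic operations by a direct induction on [k]. *)
Fixpoint Ck k f : Prop :=
  (forall p, A p -> {for p, continuous f}) /\
  (forall p v, A p -> derivable f p v) /\
  (if k is k'.+1 then forall v, Ck k' ('D_v f) else True).

Lemma Ck_continuous k f p : Ck k f -> A p -> {for p, continuous f}.
Proof. by case: k => [|k] [h _] Ap; exact: h. Qed.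

Lemma Ck_derivable k f p v : Ck k f -> A p -> derivable f p v.
Proof. by case: k => [|k] [_ [h _]] Ap; exact: h. Qed.

Lemma Ck_derive k f v : Ck k.+1 f -> Ck k ('D_v f).
Proof. by case=> _ [_ h]; exact: h. Qed.

Lemma CkW k f : Ck k.+1 f -> Ck k f.
Proof.
elim: k f => [|k IH] f [h1 [h2 h3]] /=; split=> //; split=> // v.
exact/IH/h3.
Qed.

Hypothesis Aopen : open A.

Let near_A p : A p -> \forall q \near p, A q.
Proof. by move=> Ap; apply: open_nbhs_nbhs. Qed.

(** Values off the open set are irrelevant to derivatives at its points; the
    invariance under change of such values is used throughout, because metrics are
    only meaningful away from the origin. *)
Lemma eq_on_near f g p : {in A, f =1 g} -> A p -> {near p, f =1 g}.
Proof.
move=> fg /near_A; apply: filterS => q Aq; apply: fg; exact/mem_set.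
Qed.

Lemma eq_on_derive f g v : {in A, f =1 g} -> {in A, 'D_v f =1 'D_v g}.
Proof.
by move=> fg p /set_mem Ap; apply: near_eq_derive; apply: eq_on_near.
Qed.

Lemma eq_on_continuous f g p : {in A, f =1 g} -> A p ->
  {for p, continuous f} -> {for p, continuous g}.
Proof.
move=> fg Ap fc; have fgp : f p = g p by apply: fg; exact/mem_set.
rewrite /prop_for /continuous_at -fgp; apply: cvg_trans fc.
by apply: near_eq_cvg; apply: filterS (eq_on_near fg Ap) => q ->.
Qed.

Lemma eq_Ck k f g : {in A, f =1 g} -> Ck k f -> Ck k g.
Proof.
elim: k f g => [|k IH] f g fg [h1 [h2 h3]].
  split; first by move=> p Ap; apply: eq_on_continuous (h1 p Ap).
  split=> // p v Ap; apply: near_eq_derivable (h2 p v Ap); exact: eq_on_near.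
split; first by move=> p Ap; apply: eq_on_continuous (h1 p Ap).
split=> [p v Ap|v]; last by apply: IH (h3 v); exact: eq_on_derive.
apply: near_eq_derivable (h2 p v Ap); exact: eq_on_near.
Qed.

Lemma Ck_cst k (c : R) : Ck k (cst c).
Proof.
have cc (d : R) p : A p -> {for p, continuous (cst d)}.
  by move=> _; apply: cvg_cst.
elim: k c => [|k IH] c; split; [exact: cc| |exact: cc|].
  by split=> // p v _; exact: derivable_cst.
split=> [p v _|v]; first exact: derivable_cst.
by apply: eq_Ck (IH 0) => p _; rewrite derive_cst.
Qed.

Lemma CkD k f g : Ck k f -> Ck k g -> Ck k (f \+ g).
Proof.
elim: k f g => [|k IH] f g [f1 [f2 f3]] [g1 [g2 g3]]; split.
- by move=> p Ap; apply: continuousD; [exact: f1|exact: g1].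
- by split=> // p v Ap; apply: derivableD; [exact: f2|exact: g2].
- by move=> p Ap; apply: continuousD; [exact: f1|exact: g1].
split=> [p v Ap|v]; first by apply: derivableD; [exact: f2|exact: g2].
apply: eq_Ck (IH _ _ (f3 v) (g3 v)) => p /set_mem Ap.
by rewrite /= -deriveD//; [exact: f2|exact: g2].
Qed.

Lemma CkM k f g : Ck k f -> Ck k g -> Ck k (f \* g).
Proof.
elim: k f g => [|k IH] f g Hf Hg;
    move: (Hf) (Hg) => [f1 [f2 f3]] [g1 [g2 g3]]; split.
- by move=> p Ap; apply: continuousM; [exact: f1|exact: g1].
- by split=> // p v Ap; apply: derivableM; [exact: f2|exact: g2].
- by move=> p Ap; apply: continuousM; [exact: f1|exact: g1].
split=> [p v Ap|v]; first by apply: derivableM; [exact: f2|exact: g2].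
apply: eq_Ck (CkD (IH _ _ (CkW Hf) (g3 v)) (IH _ _ (CkW Hg) (f3 v))).
move=> p /set_mem Ap.
by rewrite /= -deriveM//; [exact: f2|exact: g2].
Qed.

Lemma CkN k f : Ck k f -> Ck k (\- f).
Proof.
move=> Hf; apply: eq_Ck (CkM (Ck_cst k (-1)) Hf) => p _ /=.
by rewrite mulN1r.
Qed.

Lemma CkB k f g : Ck k f -> Ck k g -> Ck k (f \- g).
Proof. by move=> Hf Hg; apply: CkD Hf (CkN Hg). Qed.

Lemma CkV k f : (forall p, A p -> f p != 0) -> Ck k f -> Ck k (fun p => (f p)^-1).
Proof.
move=> f0; elim: k => [|k IH] Hf; move: (Hf) => [f1 [f2 f3]]; split.
- by move=> p Ap; apply: continuousV; [exact: f0|exact: f1].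
- by split=> // p v Ap; apply: derivableV; [exact: f0|exact: f2].
- by move=> p Ap; apply: continuousV; [exact: f0|exact: f1].
split=> [p v Ap|v]; first by apply: derivableV; [exact: f0|exact: f2].
have IHf := IH (CkW Hf).
apply: eq_Ck (CkN (CkM (CkM IHf IHf) (f3 v))) => p /set_mem Ap /=.
rewrite deriveV//; [|exact: f0|exact: f2].
by rewrite /GRing.scale /= mulNr expr2 invfM.
Qed.

Lemma Ck_sum k (I : Type) (s : seq I) (P : pred I) (F : I -> V -> R) :
  (forall i, P i -> Ck k (F i)) -> Ck k (fun p => \sum_(i <- s | P i) F i p).
Proof.
move=> HF; elim: s => [|i s IH].
  by apply: eq_Ck (Ck_cst k 0) => p _; rewrite big_nil.
case: (boolP (P i)) => Pi.
  by apply: eq_Ck (CkD (HF _ Pi) IH) => p _; rewrite big_cons Pi.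
by apply: eq_Ck IH => p _; rewrite big_cons (negbTE Pi).
Qed.

End DirectionalCk.

Section DirectionalLinear.
Context {R : realType} {V : normedModType R}.
Implicit Types (f g : V -> R) (p u v : V).

Lemma derivable_lineP f p v (s : R) : derivable f (s *: v + p) v ->
  is_derive s 1 (fun s => f (s *: v + p)) ('D_v f (s *: v + p)).
Proof.
move=> df.
have E : (fun h : R => h^-1 *: (((fun s => f (s *: v + p)) \o shift s) (h *: 1) -
      f (s *: v + p))) =
    (fun h : R => h^-1 *: ((f \o shift (s *: v + p)) (h *: v) - f (s *: v + p))).
  apply/funext => h /=; congr (_ *: (f _ - _)).
  by rewrite [h%:A]mulr1 scalerDl addrA.
by split; rewrite ?/derivable ?/derive E.
Qed.

(** A continuous linear form has a constant derivative in every direction. *)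
Lemma linear_Ck (A : set V) k (f : V -> R) : open A ->
  continuous f -> (forall (c : R) x y, f (c *: x + y) = c * f x + f y) ->
  Ck A k f.
Proof.
move=> Ao cf lf.
have df p v : is_derive p v f (f v).
  suff H : (fun h : R => h^-1 *: ((f \o shift p) (h *: v) - f p)) @ 0^' --> f v.
    by split; [apply/cvg_ex; exists (f v)|exact: cvg_lim H].
  apply: (cvg_trans _ (@cvg_cst _ (f v) R (dnbhs (0 : R)) _)); apply: near_eq_cvg.
  near=> h.
  have h0 : h != 0 by near: h; exact: nbhs_dnbhs_neq.
  by rewrite /= lf addrK /GRing.scale /= mulKf.
case: k => [|k]; split; [by move=> p _; exact: cf| |by move=> p _; exact: cf|].
  by split=> // p v _; exact: (@ex_derive _ _ _ _ _ _ _ (df p v)).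
split=> [p v _|v]; first exact: (@ex_derive _ _ _ _ _ _ _ (df p v)).
apply: eq_Ck (Ck_cst Ao k (f v)) => // p _.
by rewrite (@derive_val _ _ _ _ _ _ _ (df p v)).
Unshelve. all: by end_near. Qed.

Lemma linear_derive (f : V -> R) p v :
  (forall (c : R) x y, f (c *: x + y) = c * f x + f y) -> 'D_v f p = f v.
Proof.
move=> lf; apply: cvg_lim => //.
apply: (cvg_trans _ (@cvg_cst _ (f v) R (dnbhs (0 : R)) _)); apply: near_eq_cvg.
near=> h.
have h0 : h != 0 by near: h; exact: nbhs_dnbhs_neq.
by rewrite /= lf addrK /GRing.scale /= mulKf.
Unshelve. all: by end_near. Qed.

Lemma derive_dirZ (c : R) f p v : derivable f p v ->
  'D_(c *: v) f p = c * 'D_v f p.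
Proof.
move=> df; have [->|c0] := eqVneq c 0; first by rewrite scale0r derive0 mul0r.
apply: cvg_lim => //.
have E : (fun h : R => h^-1 *: ((f \o shift p) (h *: (c *: v)) - f p)) =
    (fun h => c * ((fun h : R => h^-1 *: ((f \o shift p) (h *: v) - f p)) (c * h))).
  apply/funext => h /=.
  by rewrite scalerA [h * c]mulrC [RHS]mulrA invfM mulrA mulfV// mul1r.
rewrite E; apply: cvgMr.
have H : (fun h : R => c * h) @ 0^' --> 0^'.
  move=> P /= [e /= e0 HP]; exists (e / `|c|) => /=.
    by rewrite divr_gt0// normr_gt0.
  move=> h /=; rewrite sub0r normrN => he h0; apply: HP.
    by rewrite /= sub0r normrN normrM mulrC -ltr_pdivlMr// normr_gt0.
  by rewrite mulf_neq0.
exact: cvg_comp H df.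
Qed.

End DirectionalLinear.

(** * Linearity in the direction and the derivative tests *)

Section DirectionAdditive.
Context {R : realType} {V : normedModType R}.
Variable A : set V.
Hypothesis Aopen : open A.
Implicit Types (f g : V -> R) (p u v : V).

(** The mean value theorem on a segment, applied to the restriction of [f]. *)
Lemma MVT_direction f p v :
  (forall r : R, 0 <= r <= 1 -> A (r *: v + p)) -> Ck A 0 f ->
  exists2 r : R, 0 < r < 1 & f (v + p) - f p = 'D_v f (r *: v + p).
Proof.
move=> Ap Cf.
have d (r : R) : 0 <= r <= 1 ->
    is_derive r 1 (fun s => f (s *: v + p)) ('D_v f (r *: v + p)).
  by move=> r01; apply: derivable_lineP; apply: Ck_derivable Cf (Ap r r01).
have d' (r : R) : r \in `]0, 1[ ->
    is_derive r 1 (fun s => f (s *: v + p)) ('D_v f (r *: v + p)).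
  by rewrite in_itv/= => /andP[x0 x1]; apply: d; rewrite !ltW.
have cw : {within `[0, 1], continuous (fun s : R => f (s *: v + p))}.
  apply: derivable_within_continuous => x; rewrite in_itv/= => x01.
  by have [] := d x x01.
have [c c01] := MVT ltr01 d' cw.
rewrite scale1r scale0r add0r subr0 mulr1 => E; exists c; last exact: E.
by move: c01; rewrite in_itv.
Qed.

(** Moving first along [u] and then along [v], the second increment is by the mean
    value theorem a derivative along [v] at a nearby point; continuity of that
    derivative gives additivity in the direction. *)
Lemma derive_dirD f p u v : Ck A 1 f -> A p ->
  'D_(u + v) f p = 'D_u f p + 'D_v f p.
Proof.
move=> Cf Ap; apply: cvg_lim => //.
have E : (fun h : R => h^-1 *: ((f \o shift p) (h *: (u + v)) - f p)) =
   (fun h : R => h^-1 *: ((f \o shift p) (h *: u) - f p)) \+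
   (fun h : R => h^-1 *: (f (h *: v + (h *: u + p)) - f (h *: u + p))).
  apply/funext => h /=; rewrite -scalerDr; congr (_ *: _).
  have -> : h *: (u + v) + p = h *: v + (h *: u + p).
    by rewrite scalerDr [_ + h *: v]addrC addrA.
  by rewrite [RHS]addrC [RHS]addrA subrK.
rewrite E; apply: cvgD; first exact: Ck_derivable Cf Ap.
apply/cvgrPdist_le => e e0.
have cD : {for p, continuous ('D_v f)} := Ck_continuous (Ck_derive v Cf) Ap.
have /cvgrPdist_le/(_ e e0) nD := cD.
have nA : \forall q \near p, A q by apply: open_nbhs_nbhs.
have /nbhs_ballP[d /= d0 Hd] : nbhs p [set q | A q /\ `|'D_v f p - 'D_v f q| <= e].
  exact: filterI nA nD.
have K0 : 0 < `|u| + `|v| + 1 by rewrite ltr_wpDl// addr_ge0.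
near=> h.
have h0 : h != 0 by near: h; exact: nbhs_dnbhs_neq.
have gap : `|h| * (`|u| + `|v| + 1) < d.
  rewrite -ltr_pdivlMr//; near: h; apply: dnbhs0_lt; exact: divr_gt0.
have inb (r : R) : 0 <= r <= 1 -> ball p d (r *: (h *: v) + (h *: u + p)).
  move=> /andP[r0 r1]; rewrite -ball_normE /= distrC addrA addrK.
  apply: le_lt_trans gap; apply: le_trans (ler_normD _ _) _.
  rewrite !normrZ (ger0_norm r0) mulrCA -mulrDr ler_wpM2l//.
  rewrite addrC -addrA lerD2l (le_trans (ler_piMl _ r1))// lerDl//.
have Ainb (r : R) : 0 <= r <= 1 -> A (r *: (h *: v) + (h *: u + p)).
  by move=> /inb/Hd [].
have [r /andP[r0 r1] Er] := MVT_direction Ainb (CkW Cf).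
have /inb/Hd[Ar er] : 0 <= r <= 1 by rewrite !ltW.
rewrite Er derive_dirZ; last first.
  exact: Ck_derivable Cf Ar.
by rewrite /GRing.scale /= mulKf.
Unshelve. all: by end_near. Qed.

Lemma derive_dir_sum f p (I : Type) (s : seq I) (F : I -> V) : Ck A 1 f -> A p ->
  'D_(\sum_(i <- s) F i) f p = \sum_(i <- s) 'D_(F i) f p.
Proof.
move=> Cf Ap; elim: s => [|i s IH]; first by rewrite !big_nil derive0.
by rewrite !big_cons derive_dirD// IH.
Qed.

End DirectionAdditive.

Section SecondDerivativeTest.
Context {R : realType} {V : normedModType R}.
Variable A : set V.
Hypothesis Aopen : open A.
Implicit Types (f g : V -> R) (p u v : V).

Lemma open_line p v : A p ->
  exists2 e : R, 0 < e & forall r : R, `|r| < e -> A (r *: v + p).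
Proof.
move=> Ap; have /nbhs_ballP[d /= d0 Hd] : nbhs p A by exact: open_nbhs_nbhs.
have v0 : 0 < `|v| + 1 by rewrite ltr_wpDl.
exists (d / (`|v| + 1)); first exact: divr_gt0.
move=> r re; apply: Hd; rewrite -ball_normE /= distrC addrK normrZ.
apply: le_lt_trans (_ : `|r| * (`|v| + 1) < d); last by rewrite -ltr_pdivlMr.
by rewrite ler_wpM2l// lerDl.
Qed.

(** Fermat's rule on the line through [p] in the direction [v]. *)
Lemma derive_max_direction f p v : Ck A 0 f -> A p ->
  (forall q, A q -> f q <= f p) -> 'D_v f p = 0.
Proof.
move=> Cf Ap fmax.
have [e e0 He] := open_line v Ap.
have d (r : R) : r \in `]-e, e[ ->
    is_derive r 1 (fun s => f (s *: v + p)) ('D_v f (r *: v + p)).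
  rewrite in_itv /= -ltr_norml => re.
  by apply: derivable_lineP; apply: Ck_derivable Cf _; exact: He.
have ee : - e <= e by rewrite (@le_trans _ _ 0)// ?oppr_le0 ltW.
have e0' : (0 : R) \in `]-e, e[ by rewrite in_itv/= oppr_lt0 e0.
have [||_ <-] := @derive1_at_max R (fun s => f (s *: v + p)) (-e) e 0 ee _ e0'.
- by move=> t /d [].
- move=> t; rewrite in_itv /= -ltr_norml scale0r add0r => te.
  by apply: fmax; exact: He.
by have [_ ->] := d 0 e0'; rewrite scale0r add0r.
Qed.

(** If the second derivative along [v] were positive, the first one, zero at the
    maximum, would be positive just after it, and [f] would increase there. *)
Lemma derive2_max_direction f p v : Ck A 1 f -> A p ->
  (forall q, A q -> f q <= f p) -> 'D_v ('D_v f) p <= 0.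
Proof.
move=> Cf Ap fmax; rewrite leNgt; apply/negP => D2pos.
have D0 := derive_max_direction v (CkW Cf) Ap fmax.
have Cf1 := Ck_derive v Cf.
have dD : derivable ('D_v f) p v by exact: Ck_derivable Cf1 Ap.
have cD : (fun h : R => h^-1 *: (('D_v f \o shift p) (h *: v) - 'D_v f p)) @ 0^'
    --> 'D_v ('D_v f) p := dD.
have /cvgrPdist_lt/(_ _ D2pos)[e1 /= e10 He1] := cD.
have [e2 e20 He2] := open_line v Ap.
(* a step on which both the sign of the derivative and membership in [A] are known *)
pose s := Num.min e1 e2 / 2.
have s0 : 0 < s by rewrite divr_gt0// lt_min e10.
have ss (r : R) : 0 <= r <= s -> `|r| < e1 /\ `|r| < e2.
  move=> /andP[r0 rs]; have : r < Num.min e1 e2.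
    by apply: le_lt_trans rs _; rewrite /s; move: s0; rewrite /s; lra.
  by rewrite lt_min ger0_norm// => /andP[].
have As (r : R) : 0 <= r <= 1 -> A (r *: (s *: v) + p).
  move=> /andP[r0 r1]; rewrite scalerA; apply: He2.
  by apply: (ss _ _).2; rewrite (mulr_ge0 r0 (ltW s0)) ler_piMl// ltW.
have [r /andP[r0 r1] Er] := MVT_direction As (CkW Cf).
have rs : `|r * s| < e1.
  by apply: (ss _ _).1; rewrite (mulr_ge0 (ltW r0) (ltW s0)) ler_piMl// ltW.
have rs0 : 0 < r * s by rewrite mulr_gt0.
have : 0 < 'D_v f ((r * s) *: v + p).
  have := He1 (r * s); rewrite /= sub0r normrN D0 subr0 => /(_ rs).
  rewrite gt_eqF// => /(_ isT); rewrite ltr_distlC subrr => /andP[+ _].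
  by rewrite /GRing.scale /= pmulr_rgt0 ?invr_gt0.
have Ap1 : A (r *: (s *: v) + p) by apply: As; rewrite !ltW.
rewrite -scalerA; apply/negP; rewrite -leNgt.
rewrite -(pmulr_rle0 _ s0) -derive_dirZ; last exact: Ck_derivable Cf Ap1.
by rewrite -Er subr_le0; apply: fmax; rewrite -[s *: v]scale1r; apply: As; rewrite ler01 lexx.
Qed.
End SecondDerivativeTest.

(** * Complex functions on the punctured space *)

Section ComplexCk.
Context {R : realType} {n : nat}.
Notation C := R[i].
Notation pt := 'rV[C]_n.
Notation rpt := ('rV[R]_n * 'rV[R]_n)%type.
Implicit Types (f g : pt -> C) (z w : pt) (p v : rpt) (k : nat).

Lemma conjCE (x : C) : x^* = Complex (complex.Re x) (- complex.Im x).
Proof. by case: x. Qed.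
Lemma cReM (x y : C) : complex.Re (x * y) =
  complex.Re x * complex.Re y - complex.Im x * complex.Im y.
Proof. by case: x; case: y. Qed.
Lemma cImM (x y : C) : complex.Im (x * y) =
  complex.Re x * complex.Im y + complex.Im x * complex.Re y.
Proof. by case: x; case: y. Qed.
Lemma cReD (x y : C) : complex.Re (x + y) = complex.Re x + complex.Re y.
Proof. by case: x; case: y. Qed.
Lemma cImD (x y : C) : complex.Im (x + y) = complex.Im x + complex.Im y.
Proof. by case: x; case: y. Qed.
Lemma complex_eq (x y : C) :
  complex.Re x = complex.Re y -> complex.Im x = complex.Im y -> x = y.
Proof. by case: x => a b; case: y => c d /= -> ->. Qed.

Lemma to_realK z : of_real (to_real z) = z.
Proof. by apply/rowP => k; rewrite !mxE /=; case: (z 0 k). Qed.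
Lemma of_realK p : to_real (of_real p) = p.
Proof.
by case: p => x y; congr (_, _); apply/rowP => k; rewrite !mxE.
Qed.
Lemma of_real_eq0 p : (of_real p == 0) = (p == 0).
Proof.
apply/eqP/eqP => [H|->]; last by apply/rowP => k; rewrite !mxE.
by rewrite -(of_realK p) H; congr (_, _); apply/rowP => k; rewrite !mxE.
Qed.

Definition punctured : set rpt := [set p | of_real p != 0].

Lemma punctured_open : open punctured.
Proof.
have -> : punctured = ~` [set 0].
  by apply/seteqP; split => p /=; rewrite /punctured /= of_real_eq0 => /eqP.
apply: closed_openC; apply: accessible_closed_set1.
exact: hausdorff_accessible.
Qed.

(** Regularity of a complex function of [z != 0], through its real and imaginary
    parts in real coordinates. *)
Definition CkC k f : Prop :=
  Ck punctured k (fun p => complex.Re (f (of_real p))) /\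
  Ck punctured k (fun p => complex.Im (f (of_real p))).

Let eqp f g (h : C -> R) : (forall z, z != 0 -> f z = g z) ->
  {in punctured, (fun p => h (f (of_real p))) =1 (fun p => h (g (of_real p)))}.
Proof. by move=> fg p /set_mem /= p0; rewrite fg. Qed.

Lemma eq_CkC k f g : (forall z, z != 0 -> f z = g z) -> CkC k f -> CkC k g.
Proof.
by move=> fg [f1 f2]; split; [apply: eq_Ck f1|apply: eq_Ck f2];
  try exact: punctured_open; exact: eqp.
Qed.

Lemma CkCW k f : CkC k.+1 f -> CkC k f.
Proof. by move=> [/CkW ? /CkW]. Qed.

Lemma CkC_cst k (c : C) : CkC k (fun=> c).
Proof. split; exact/Ck_cst/punctured_open. Qed.

Lemma CkCD k f g : CkC k f -> CkC k g -> CkC k (fun z => f z + g z).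
Proof.
move=> [f1 f2] [g1 g2]; split.
  by apply: eq_Ck (CkD _ f1 g1) => [|p _ /=|]; rewrite ?cReD//; exact: punctured_open.
by apply: eq_Ck (CkD _ f2 g2) => [|p _ /=|]; rewrite ?cImD//; exact: punctured_open.
Qed.

Lemma CkCM k f g : CkC k f -> CkC k g -> CkC k (fun z => f z * g z).
Proof.
have po := punctured_open; move=> [f1 f2] [g1 g2]; split.
  by apply: eq_Ck (CkB po (CkM po f1 g1) (CkM po f2 g2)) => // p _; rewrite cReM.
by apply: eq_Ck (CkD po (CkM po f1 g2) (CkM po f2 g1)) => // p _; rewrite cImM.
Qed.

Lemma CkC_conj k f : CkC k f -> CkC k (fun z => (f z)^*).
Proof.
have po := punctured_open; move=> [f1 f2]; split.
  by apply: eq_Ck f1 => // p _; rewrite conjCE.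
by apply: eq_Ck (CkN po f2) => // p _; rewrite conjCE.
Qed.

Lemma CkCN k f : CkC k f -> CkC k (fun z => - f z).
Proof.
move=> Hf; apply: eq_CkC (CkCM (CkC_cst k (-1)) Hf) => z _ /=.
by rewrite mulN1r.
Qed.

Lemma CkCB k f g : CkC k f -> CkC k g -> CkC k (fun z => f z - g z).
Proof. by move=> Hf Hg; apply: CkCD Hf (CkCN Hg). Qed.

Lemma CkC_sum k (I : Type) (s : seq I) (P : pred I) (F : I -> pt -> C) :
  (forall i, CkC k (F i)) -> CkC k (fun z => \sum_(i <- s | P i) F i z).
Proof.
move=> HF; elim: s => [|i s IH].
  by apply: eq_CkC (CkC_cst k 0) => p _; rewrite big_nil.
case: (boolP (P i)) => Pi.
  by apply: eq_CkC (CkCD (HF i) IH) => p _; rewrite big_cons Pi.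
by apply: eq_CkC IH => p _; rewrite big_cons (negbTE Pi).
Qed.

Lemma CkC_prod k (I : Type) (s : seq I) (P : pred I) (F : I -> pt -> C) :
  (forall i, CkC k (F i)) -> CkC k (fun z => \prod_(i <- s | P i) F i z).
Proof.
move=> HF; elim: s => [|i s IH].
  by apply: eq_CkC (CkC_cst k 1) => p _; rewrite big_nil.
case: (boolP (P i)) => Pi.
  by apply: eq_CkC (CkCM (HF i) IH) => p _; rewrite big_cons Pi.
by apply: eq_CkC IH => p _; rewrite big_cons (negbTE Pi).
Qed.

Lemma CkCV k f : (forall z, z != 0 -> f z != 0) -> CkC k f ->
  CkC k (fun z => (f z)^-1).
Proof.
move=> f0 Hf; have po := punctured_open.
have [N1 _] := CkCM Hf (CkC_conj Hf).
have N0 p : punctured p -> complex.Re (f (of_real p) * (f (of_real p))^*) != 0.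
  move=> /= /f0; apply: contraNneq; rewrite conjCE cReM /= mulrN opprK.
  move=> /eqP; rewrite -!expr2 paddr_eq0 ?sqr_ge0// !sqrf_eq0 => /andP[/eqP a /eqP b].
  by apply/eqP/complex_eq; rewrite /= ?a ?b.
have NV := CkV po N0 N1.
have NC : CkC k (fun z => (complex.Re (f z * (f z)^*))^-1%:C%C).
  by split; [exact: NV|exact: Ck_cst].
apply: eq_CkC (CkCM (CkC_conj Hf) NC) => z z0.
apply: (mulfI (f0 z z0)); rewrite mulfV ?f0// mulrA.
have -> : f z * (f z)^* = (complex.Re (f z * (f z)^*))%:C%C.
  by apply: complex_eq => //=; rewrite conjCE cImM /=; ring.
rewrite -[LHS]rmorphM /= mulfV //; have := N0 (to_real z).
by rewrite /punctured /= to_realK; exact.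
Qed.

Lemma CkC_coord k (j : 'I_n) : CkC k (fun z => z 0 j).
Proof.
have po := punctured_open; split; apply: linear_Ck => //.
- move=> p; rewrite (_ : (fun p : rpt => _) = (fun M : 'rV[R]_n => M 0 j) \o fst).
    by apply: continuous_comp; [exact: cvg_fst|exact: coord_continuous].
  by apply/funext => q; rewrite /= mxE.
- by move=> c x y; rewrite !mxE.
- move=> p; rewrite (_ : (fun p : rpt => _) = (fun M : 'rV[R]_n => M 0 j) \o snd).
    by apply: continuous_comp; [exact: cvg_snd|exact: coord_continuous].
  by apply/funext => q; rewrite /= mxE.
- by move=> c x y; rewrite !mxE.
Qed.

Lemma CkC_real_deriv k v f : CkC k.+1 f -> CkC k (real_deriv v f).
Proof.
have po := punctured_open; move=> [/(Ck_derive v) f1 /(Ck_derive v) f2].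
split; [apply: eq_Ck f1|apply: eq_Ck f2] => // p _ /=;
  by rewrite of_realK.
Qed.

End ComplexCk.

(** * Rules of calculus for the complex frame *)

Section PointwiseRules.
Context {R : realType} {V : normedModType R}.
Implicit Types (f g h k : V -> R) (u x : V).

Lemma derive_ext f g u x : f =1 g -> 'D_u f x = 'D_u g x.
Proof. by move=> /funext ->. Qed.

Lemma derive_add f g h u x : derivable f x u -> derivable g x u ->
  (forall y, h y = f y + g y) -> 'D_u h x = 'D_u f x + 'D_u g x.
Proof. by move=> df dg hE; rewrite -deriveD//; apply: derive_ext. Qed.

Lemma derive_opp f h u x : derivable f x u ->
  (forall y, h y = - f y) -> 'D_u h x = - 'D_u f x.
Proof. by move=> df hE; rewrite -deriveN//; apply: derive_ext. Qed.

Lemma derive_mul f g h u x : derivable f x u -> derivable g x u ->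
  (forall y, h y = f y * g y) -> 'D_u h x = f x * 'D_u g x + g x * 'D_u f x.
Proof.
move=> df dg hE; transitivity ('D_u (f * g) x); first exact: derive_ext.
by rewrite (deriveM df dg).
Qed.

(** The shape taken by the real part of a product of complex functions. *)
Lemma derive_mulB f g h k l u x :
  derivable f x u -> derivable g x u -> derivable h x u -> derivable k x u ->
  (forall y, l y = f y * g y - h y * k y) ->
  'D_u l x = f x * 'D_u g x + g x * 'D_u f x - (h x * 'D_u k x + k x * 'D_u h x).
Proof.
move=> df dg dh dk lE; rewrite -(derive_mul (h := f * g) df dg)//.
rewrite -(derive_mul (h := h * k) dh dk)//.
have dfg := derivableM df dg; have dhk := derivableM dh dk.
rewrite -(deriveB dfg dhk); exact: derive_ext.
Qed.

(** The shape taken by the imaginary part of a product of complex functions. *)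
Lemma derive_mulD f g h k l u x :
  derivable f x u -> derivable g x u -> derivable h x u -> derivable k x u ->
  (forall y, l y = f y * g y + h y * k y) ->
  'D_u l x = f x * 'D_u g x + g x * 'D_u f x + (h x * 'D_u k x + k x * 'D_u h x).
Proof.
move=> df dg dh dk lE; rewrite -(derive_mul (h := f * g) df dg)//.
rewrite -(derive_mul (h := h * k) dh dk)//.
have dfg := derivableM df dg; have dhk := derivableM dh dk.
rewrite -(deriveD dfg dhk); exact: derive_ext.
Qed.

End PointwiseRules.

Section ComplexDerivatives.
Context {R : realType} {n : nat}.
Notation C := R[i].
Notation pt := 'rV[C]_n.
Notation rpt := ('rV[R]_n * 'rV[R]_n)%type.
Implicit Types (f g : pt -> C) (z w : pt) (p v : rpt) (k : nat) (A : idx n).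

Let to_real_punctured z : z != 0 -> punctured (to_real z).
Proof. by rewrite /punctured /= to_realK. Qed.

Lemma eq_real_deriv v f g z : (forall w, w != 0 -> f w = g w) -> z != 0 ->
  real_deriv v f z = real_deriv v g z.
Proof.
move=> fg z0; have po := @punctured_open R n; congr Complex.
  apply: (eq_on_derive po) (mem_set (to_real_punctured z0)).
  by move=> p /set_mem /= p0; rewrite fg.
apply: (eq_on_derive po) (mem_set (to_real_punctured z0)).
by move=> p /set_mem /= p0; rewrite fg.
Qed.

Lemma real_derivD v f g z : CkC 0 f -> CkC 0 g -> z != 0 ->
  real_deriv v (fun w => f w + g w) z = real_deriv v f z + real_deriv v g z.
Proof.
move=> [f1 f2] [g1 g2] /to_real_punctured z0.
apply: complex_eq; rewrite ?cReD ?cImD /=.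
  apply: (derive_add (Ck_derivable f1 z0) (Ck_derivable g1 z0)) => p.
  by rewrite cReD.
apply: (derive_add (Ck_derivable f2 z0) (Ck_derivable g2 z0)) => p.
by rewrite cImD.
Qed.

Lemma real_derivM v f g z : CkC 0 f -> CkC 0 g -> z != 0 ->
  real_deriv v (fun w => f w * g w) z = real_deriv v f z * g z + f z * real_deriv v g z.
Proof.
move=> [f1 f2] [g1 g2] /to_real_punctured z0.
have d1 := Ck_derivable (v := v) f1 z0; have d2 := Ck_derivable (v := v) f2 z0.
have e1 := Ck_derivable (v := v) g1 z0; have e2 := Ck_derivable (v := v) g2 z0.
apply: complex_eq; rewrite ?cReD ?cImD ?cReM ?cImM /=.
  rewrite (derive_mulB d1 e1 d2 e2) ?to_realK; first by ring.
  by move=> p; rewrite cReM.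
rewrite (derive_mulD d1 e2 d2 e1) ?to_realK; first by ring.
by move=> p; rewrite cImM.
Qed.

Lemma real_deriv_conj v f z : CkC 0 f -> z != 0 ->
  real_deriv v (fun w => (f w)^*) z = (real_deriv v f z)^*.
Proof.
move=> [f1 f2] /to_real_punctured z0; rewrite conjCE; apply: complex_eq => /=.
  by apply: derive_ext => p; rewrite conjCE.
apply: (derive_opp (Ck_derivable f2 z0)) => p.
by rewrite conjCE.
Qed.

Lemma real_deriv_cst v (c : C) z : real_deriv v (fun=> c) z = 0.
Proof. by apply: complex_eq; rewrite /= derive_cst. Qed.

Lemma real_deriv_coord v (j : 'I_n) z :
  real_deriv v (fun w => w 0 j) z = Complex (v.1 0 j) (v.2 0 j).
Proof.
by congr Complex; rewrite linear_derive ?mxE//= => c x y; rewrite !mxE.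
Qed.

(** The frame fields as combinations of two real directional derivatives. *)
Definition fdir A : rpt * rpt :=
  match A with inl k | inr k => ((delta_mx 0 k, 0), (0, delta_mx 0 k)) end.
Definition fcoef A : C := match A with inl k => - 'i%C | inr k => 'i%C end.

Lemma dfrE A f z : dfr A f z =
  (real_deriv (fdir A).1 f z + fcoef A * real_deriv (fdir A).2 f z) / 2.
Proof. by case: A => k //=; rewrite /dz mulNr. Qed.

Lemma fcoef_bar A : fcoef (bar A) = (fcoef A)^*.
Proof. by case: A => k; apply: complex_eq => /=; rewrite ?oppr0 ?opprK. Qed.

Lemma eq_dfr A f g z : (forall w, w != 0 -> f w = g w) -> z != 0 ->
  dfr A f z = dfr A g z.
Proof. by move=> fg z0; rewrite !dfrE !(eq_real_deriv _ fg). Qed.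

Lemma dfrD A f g z : CkC 0 f -> CkC 0 g -> z != 0 ->
  dfr A (fun w => f w + g w) z = dfr A f z + dfr A g z.
Proof.
move=> Hf Hg z0; rewrite !dfrE !(real_derivD _ Hf Hg z0).
move: (real_deriv (fdir A).1 f z) (real_deriv (fdir A).2 f z) => a b.
by move: (real_deriv (fdir A).1 g z) (real_deriv (fdir A).2 g z) => c d; ring. Qed.

Lemma dfrM A f g z : CkC 0 f -> CkC 0 g -> z != 0 ->
  dfr A (fun w => f w * g w) z = dfr A f z * g z + f z * dfr A g z.
Proof.
move=> Hf Hg z0; rewrite !dfrE !(real_derivM _ Hf Hg z0).
move: (real_deriv (fdir A).1 f z) (real_deriv (fdir A).2 f z) => a b.
by move: (real_deriv (fdir A).1 g z) (real_deriv (fdir A).2 g z) => c d; ring. Qed.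

Lemma dfr_cst A (c : C) z : dfr A (fun=> c) z = 0.
Proof. by rewrite dfrE !real_deriv_cst mulr0 addr0 mul0r. Qed.

Lemma dfrZ A (c : C) f z : CkC 0 f -> z != 0 ->
  dfr A (fun w => c * f w) z = c * dfr A f z.
Proof.
by move=> Hf z0; rewrite (dfrM A (CkC_cst 0 c) Hf z0) dfr_cst mul0r add0r.
Qed.

Lemma dfrN A f z : CkC 0 f -> z != 0 -> dfr A (fun w => - f w) z = - dfr A f z.
Proof.
move=> Hf z0; rewrite -mulN1r -(dfrZ A (-1) Hf z0); apply: (eq_dfr A _ z0) => w _.
by rewrite mulN1r.
Qed.

Lemma dfrB A f g z : CkC 0 f -> CkC 0 g -> z != 0 ->
  dfr A (fun w => f w - g w) z = dfr A f z - dfr A g z.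
Proof.
by move=> Hf Hg z0; rewrite (dfrD A Hf (CkCN Hg) z0) (dfrN A Hg z0).
Qed.

Lemma dfr_sum A (I : Type) (s : seq I) (P : pred I) (F : I -> pt -> C) z :
  (forall i, CkC 0 (F i)) -> z != 0 ->
  dfr A (fun w => \sum_(i <- s | P i) F i w) z = \sum_(i <- s | P i) dfr A (F i) z.
Proof.
move=> HF z0; elim: s => [|i s IH].
  rewrite big_nil -[RHS](dfr_cst A 0 z); apply: (eq_dfr A _ z0) => w _.
  by rewrite big_nil.
rewrite big_cons -IH; case: (boolP (P i)) => Pi.
  rewrite -(dfrD A (HF i) (CkC_sum _ _ HF) z0).
  by apply: (eq_dfr A _ z0) => w _; rewrite big_cons Pi.
by apply: (eq_dfr A _ z0) => w _; rewrite big_cons (negbTE Pi).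
Qed.

Lemma dfr_conj A f z : CkC 0 f -> z != 0 ->
  dfr A (fun w => (f w)^*) z = (dfr (bar A) f z)^*.
Proof.
move=> Hf z0; rewrite !dfrE !(real_deriv_conj _ Hf z0) fcoef_bar.
rewrite rmorphM rmorphD rmorphM /= conjCK fmorphV /= conjC_nat.
by case: A.
Qed.

Lemma dfrV A f z : (forall w, w != 0 -> f w != 0) -> CkC 0 f -> z != 0 ->
  dfr A (fun w => (f w)^-1) z = - dfr A f z / f z ^+ 2.
Proof.
move=> f0 Hf z0; have f0z := f0 z z0.
have := dfrM A Hf (CkCV f0 Hf) z0.
rewrite (@eq_dfr A _ (fun=> 1) z _ z0) ?dfr_cst; last by move=> w /f0 w0; rewrite mulfV.
move=> /eqP; rewrite eq_sym addr_eq0 => /eqP E.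
by apply: (mulfI f0z); rewrite -[LHS]opprK -E; field.
Qed.

Lemma dfr_coord A (j : 'I_n) z : dfr A (fun w => w 0 j) z =
  match A with inl k => (k == j)%:R | inr _ => 0 end.
Proof.
rewrite dfrE !real_deriv_coord; case: A => k /=; rewrite !mxE /= (eq_sym j).
  have -> : - 'i%C * Complex 0 (k == j)%:R = Complex (k == j)%:R 0 :> C.
    by apply: complex_eq; rewrite ?cReM ?cImM /=; ring.
  have -> : Complex (k == j)%:R 0 = (k == j)%:R :> C.
    by case: eqP.
  by field.
have -> : 'i%C * Complex 0 (k == j)%:R = - Complex (k == j)%:R 0 :> C.
  by apply: complex_eq; rewrite ?cReM ?cImM /=; ring.
by rewrite subrr mul0r.
Qed.

Lemma cRe_comb (a b : R) (x y : C) : complex.Re (a%:C%C * x + b%:C%C * y) =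
  a * complex.Re x + b * complex.Re y.
Proof. by case: x; case: y => *; rewrite /=; ring. Qed.
Lemma cIm_comb (a b : R) (x y : C) : complex.Im (a%:C%C * x + b%:C%C * y) =
  a * complex.Im x + b * complex.Im y.
Proof. by case: x; case: y => *; rewrite /=; ring. Qed.

Lemma CkC_dfr k A f : CkC k.+1 f -> CkC k (dfr A f).
Proof.
move=> Hf; apply: eq_CkC (CkCM (CkCD (CkC_real_deriv (fdir A).1 Hf)
  (CkCM (CkC_cst k (fcoef A)) (CkC_real_deriv (fdir A).2 Hf))) (CkC_cst k 2^-1)).
by move=> z z0; rewrite dfrE.
Qed.

(** A real vector with complex components [V] is
    [sum_k V_k d/dz_k + conj V_k d/dzbar_k]; the additivity of derivatives in the
    direction transfers this decomposition to functions. *)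
Lemma real_deriv_dfr (V : pt) f z : CkC 1 f -> z != 0 ->
  real_deriv (to_real V) f z =
  \sum_k (V 0 k * dz k f z + (V 0 k)^* * dzbar k f z).
Proof.
move=> [f1 f2] /to_real_punctured z0; have po := @punctured_open R n.
have lin (h : rpt -> R) : Ck punctured 1 h -> 'D_(to_real V) h (to_real z) =
    \sum_k (complex.Re (V 0 k) * 'D_(delta_mx 0 k, 0) h (to_real z)
          + complex.Im (V 0 k) * 'D_(0, delta_mx 0 k) h (to_real z)).
  move=> hC; have -> : to_real V = \sum_k (complex.Re (V 0 k) *: (delta_mx 0 k, 0)
       + complex.Im (V 0 k) *: (0, delta_mx 0 k) : rpt).
    rewrite /to_real [RHS]surjective_pairing; congr (_, _).
      rewrite (raddf_sum fst) /= [LHS]row_sum_delta; apply: eq_bigr => k _.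
      by rewrite scaler0 addr0 mxE.
    rewrite (raddf_sum snd) /= [LHS]row_sum_delta; apply: eq_bigr => k _.
    by rewrite scaler0 add0r mxE.
  rewrite (derive_dir_sum po)//; apply: eq_bigr => k _.
  by rewrite (derive_dirD po)// !derive_dirZ//; exact: Ck_derivable hC _.
transitivity (\sum_k ((complex.Re (V 0 k))%:C%C * real_deriv (delta_mx 0 k, 0) f z
   + (complex.Im (V 0 k))%:C%C * real_deriv (0, delta_mx 0 k) f z)).
  apply: complex_eq; rewrite /= lin//.
    rewrite (big_morph _ (@cReD R) (erefl : complex.Re 0 = 0)).
    by apply: eq_bigr => k _; rewrite cRe_comb; reflexivity.
  rewrite (big_morph _ (@cImD R) (erefl : complex.Im 0 = 0)).
  by apply: eq_bigr => k _; rewrite cIm_comb; reflexivity.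
apply: eq_bigr => k _; rewrite /dz /dzbar.
case: (V 0 k) => a b; rewrite conjCE /=.
have -> : Complex a b = a%:C%C + 'i%C * b%:C%C by apply: complex_eq; simpc.
have -> : Complex a (- b) = a%:C%C - 'i%C * b%:C%C by apply: complex_eq; simpc.
set x := real_deriv _ _ _; set y := real_deriv _ _ _.
have ii : 'i%C ^+ 2 = -1 :> C := sqr_i R.
by field: ii.
Qed.

End ComplexDerivatives.

(** * First derivatives of the Hopf metrics *)

Section FrameDerivatives.
Context {R : realType} {n : nat}.
Notation C := R[i].
Notation pt := 'rV[C]_n.
Implicit Types (f g : pt -> C) (A : idx n).

Lemma sqnorm_gt0 (z : pt) : z != 0 -> 0 < sqnorm z.
Proof.
move=> z0; have [k zk] : exists k, z 0 k != 0.
  apply/existsP; apply: contraNT z0; rewrite negb_exists => /forallP H.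
  by apply/eqP/rowP => k; rewrite mxE; apply/eqP; rewrite -[_ == _]negbK.
rewrite /sqnorm (bigD1 k)//= ltr_pwDl//; first by rewrite -normCK exprn_gt0// normr_gt0.
by apply: sumr_ge0 => j _; rewrite -normCK exprn_ge0.
Qed.

Lemma sqnorm_neq0 (z : pt) : z != 0 -> sqnorm z != 0.
Proof. by move=> /sqnorm_gt0; rewrite lt0r => /andP[]. Qed.

Lemma sqnorm_ge0 (z : pt) : 0 <= sqnorm z.
Proof. by apply: sumr_ge0 => j _; rewrite -normCK exprn_ge0. Qed.

Lemma conj_sqnorm (z : pt) : (sqnorm z)^* = sqnorm z.
Proof.
by rewrite /sqnorm rmorph_sum /=; apply: eq_bigr => k _; rewrite rmorphM /= conjCK mulrC.
Qed.

Lemma CkC_sqnorm k : CkC k (@sqnorm R n).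
Proof.
apply: CkC_sum => j; apply: CkCM; first exact: CkC_coord.
exact/CkC_conj/CkC_coord.
Qed.

Lemma CkC_isqnorm k : CkC k (fun z : pt => (sqnorm z)^-1).
Proof. by apply: CkCV; [exact: sqnorm_neq0|exact: CkC_sqnorm]. Qed.

Section AtPoint.
Variable z : pt.
Hypothesis z0 : z != 0.

(** Pairing a derivative with the regularity needed to go on differentiating lets
    the rules be composed as terms. *)
Definition is_dfr A f (d : C) : Prop := CkC 0 f /\ dfr A f z = d.

Lemma is_dfr_val A f d : is_dfr A f d -> dfr A f z = d.
Proof. by case. Qed.

Lemma is_dfr_eq A f d d' : is_dfr A f d -> d = d' -> is_dfr A f d'.
Proof. by move=> H <-. Qed.

Lemma is_dfr_cst A (c : C) : is_dfr A (fun=> c) 0.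
Proof. by split; [exact: CkC_cst|exact: dfr_cst]. Qed.

Lemma is_dfrD A f g d e : is_dfr A f d -> is_dfr A g e ->
  is_dfr A (fun w => f w + g w) (d + e).
Proof.
move=> [f0 <-] [g0 <-]; split; first exact: CkCD.
exact: dfrD.
Qed.

Lemma is_dfrM A f g d e : is_dfr A f d -> is_dfr A g e ->
  is_dfr A (fun w => f w * g w) (d * g z + f z * e).
Proof.
move=> [f0 <-] [g0 <-]; split; first exact: CkCM.
exact: dfrM.
Qed.

Lemma is_dfrZ A (c : C) f d : is_dfr A f d -> is_dfr A (fun w => c * f w) (c * d).
Proof.
move=> [f0 <-]; split; first by apply: CkCM f0; exact: CkC_cst.
exact: dfrZ.
Qed.

Lemma is_dfrN A f d : is_dfr A f d -> is_dfr A (fun w => - f w) (- d).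
Proof.
move=> [f0 <-]; split; first exact: CkCN.
exact: dfrN.
Qed.

Lemma is_dfr_conj A f d : is_dfr (bar A) f d -> is_dfr A (fun w => (f w)^*) d^*.
Proof.
move=> [f0 <-]; split; first exact: CkC_conj.
exact: dfr_conj.
Qed.

(** The derivatives of the coordinates, of their conjugates and of the
    inverse of the squared norm. *)
Definition dcoord A (j : 'I_n) : C := match A with inl k => (k == j)%:R | inr _ => 0 end.
Definition dccoord A (j : 'I_n) : C := match A with inl _ => 0 | inr k => (k == j)%:R end.
Definition dsqnorm A : C := match A with inl k => (z 0 k)^* | inr k => z 0 k end.

Lemma is_dfr_coord A j : is_dfr A (fun w => w 0 j) (dcoord A j).
Proof. by split; [exact: CkC_coord|exact: dfr_coord]. Qed.

Lemma is_dfr_ccoord A j : is_dfr A (fun w => (w 0 j)^*) (dccoord A j).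
Proof.
apply: is_dfr_eq (is_dfr_conj (is_dfr_coord (bar A) j)) _.
by case: A => k /=; rewrite ?rmorph0 ?conjC_nat.
Qed.

Lemma sum_delta (k : 'I_n) (F : 'I_n -> C) : \sum_j (k == j)%:R * F j = F k.
Proof.
rewrite (bigD1 k)//= eqxx mul1r big1 ?addr0// => j jk.
by rewrite eq_sym (negbTE jk) mul0r.
Qed.

Lemma is_dfr_sqnorm A : is_dfr A (@sqnorm R n) (dsqnorm A).
Proof.
split; first exact: CkC_sqnorm.
rewrite dfr_sum//; last first.
  by move=> j; apply: CkCM; [exact: CkC_coord|exact/CkC_conj/CkC_coord].
rewrite (eq_bigr _ (fun j _ => is_dfr_val (is_dfrM (is_dfr_coord A j) (is_dfr_ccoord A j)))).
case: A => k /=.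
  by under eq_bigr do rewrite mulr0 addr0; rewrite sum_delta.
under eq_bigr do rewrite mul0r add0r mulrC; exact: sum_delta.
Qed.

Lemma is_dfr_isqnorm A : is_dfr A (fun w => (sqnorm w)^-1)
  (- dsqnorm A * ((sqnorm z)^-1 * (sqnorm z)^-1)).
Proof.
split; first exact: CkC_isqnorm.
rewrite dfrV//; [|exact: sqnorm_neq0|exact: CkC_sqnorm].
by rewrite (is_dfr_val (is_dfr_sqnorm A)) expr2 invfM.
Qed.

End AtPoint.
End FrameDerivatives.

Section HopfDerivatives.
Context {R : realType} {n : nat}.
Notation C := R[i].
Notation pt := 'rV[C]_n.
Implicit Types (A : idx n).

(** The Kronecker symbol under a name, so that it can be generalized before [ring]. *)
Definition kron (i j : 'I_n) : C := (i == j)%:R.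

Lemma hopf_metricE (al be : R) (z : pt) i j : hopf_metric al be z i j =
  al%:C%C * (kron i j * (sqnorm z)^-1) +
  be%:C%C * ((z 0 i)^* * z 0 j * ((sqnorm z)^-1 * (sqnorm z)^-1)).
Proof. by rewrite mxE /kron !mulrA expr2 invfM !mulrA. Qed.

Variable z : pt.
Hypothesis z0 : z != 0.
Notation r := ((sqnorm z)^-1).

(** The product rule applied to [hopf_metricE]. *)
Lemma is_dfr_hopf A al be i j :
  is_dfr z A (fun w => hopf_metric al be w i j)
   (al%:C%C * (kron i j * (- dsqnorm z A * (r * r)))
   + be%:C%C * ((dccoord A i * z 0 j + (z 0 i)^* * dcoord A j) * (r * r)
       + (z 0 i)^* * z 0 j * (- dsqnorm z A * (r * r) * r + r * (- dsqnorm z A * (r * r))))).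
Proof.
have -> : (fun w : pt => hopf_metric al be w i j) = (fun w =>
  al%:C%C * (kron i j * (sqnorm w)^-1) +
  be%:C%C * ((w 0 i)^* * w 0 j * ((sqnorm w)^-1 * (sqnorm w)^-1))).
  by apply/funext => w; exact: hopf_metricE.
have dr := is_dfr_isqnorm z0 A.
apply: (is_dfrD z0); first exact/(is_dfrZ z0)/(is_dfrZ z0).
apply/(is_dfrZ z0)/(is_dfrM z0)/(is_dfrM z0 dr dr).
exact: (is_dfrM z0 (is_dfr_ccoord z0 A i) (is_dfr_coord z A j)).
Qed.

Lemma CkC_hopf k al be i j : CkC k (fun w : pt => hopf_metric al be w i j).
Proof.
apply: (@eq_CkC _ _ _ (fun w =>
  al%:C%C * (kron i j * (sqnorm w)^-1) +
  be%:C%C * ((w 0 i)^* * w 0 j * ((sqnorm w)^-1 * (sqnorm w)^-1)))).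
  by move=> w _; rewrite hopf_metricE.
have c := @CkC_cst R n k; have r0 := @CkC_isqnorm R n k.
apply: CkCD; apply: (CkCM (c _)); first exact: CkCM (c _) r0.
apply: CkCM (CkCM r0 r0); apply: CkCM; last exact: CkC_coord.
exact/CkC_conj/CkC_coord.
Qed.

End HopfDerivatives.

(** * The Bismut connection in the holomorphic frame *)

Section BismutGeneral.
Context {R : realType} {n : nat}.
Notation C := R[i].
Notation pt := 'rV[C]_n.
Implicit Types (g : metric R n) (Gam : connection R n) (A B D : idx n) (z : pt).

Lemma sum_idx (F : idx n -> C) : \sum_E F E = \sum_l F (inl l) + \sum_l F (inr l).
Proof. exact: big_sumType. Qed.

(** A connection commuting with [J] preserves its two eigenspaces. *)
Lemma hermitian_connection_type g Gam z A B D : hermitian_connection g Gam ->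
  z != 0 -> ~~ same_type B D -> Gam z A B D = 0.
Proof.
move=> /(_ z) H z0 BD; have [_ _ /(_ A B D)] := H z0.
(* on a pair of types with opposite eigenvalues the commutation reads [2 i Gam = 0] *)
have i2 : (2 * 'i%C : C) != 0.
  by rewrite mulf_neq0 ?pnatr_eq0//; apply/eqP => -[/eqP]; rewrite oner_eq0.
case: B BD => b; case: D => // d _ /= /eqP; rewrite ?mulNr ?mulrN.
  rewrite -subr_eq0 opprK [X in _ + X]mulrC -mulrDr -mulr2n -mulr_natl.
  by rewrite mulf_eq0 (negbTE i2) orbF => /eqP.
rewrite eq_sym -subr_eq0 opprK [X in X + _]mulrC -mulrDr -mulr2n -mulr_natl.
by rewrite mulf_eq0 (negbTE i2) orbF => /eqP.
Qed.

Lemma low_inr g (F : idx n -> C) z j :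
  \sum_E F E * gC (g z) E (inr j) = \sum_l F (inl l) * g z l j.
Proof. by rewrite sum_idx /= [X in _ + X]big1 ?addr0// => l _; rewrite mulr0. Qed.

Lemma low_inl g (F : idx n -> C) z j :
  \sum_E F E * gC (g z) E (inl j) = \sum_l F (inr l) * g z j l.
Proof. by rewrite sum_idx /= [X in X + _]big1 ?add0r// => l _; rewrite mulr0. Qed.

(** Metric compatibility on a pair of opposite types, once the components of
    the connection that mix types are known to vanish. *)
Lemma compatE g Gam z A i j : hermitian_connection g Gam -> z != 0 ->
  dfr A (fun w => g w i j) z =
  \sum_l Gam z A (inl i) (inl l) * g z l j + \sum_l Gam z A (inr j) (inr l) * g z i l.
Proof.
move=> H z0; have [_ /(_ A (inl i) (inr j)) /= -> _] := H z z0.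
rewrite big_split /= low_inr; congr (_ + _).
rewrite sum_idx /= [X in X + _]big1 ?add0r// => l _; by rewrite mulr0.
Qed.

Section Uniqueness.
Variables (g : metric R n) (Gam : connection R n) (z : pt).
Hypotheses (gB : is_bismut g Gam) (z0 : z != 0).

(** Skew-symmetry of the torsion in its last two arguments, on a holomorphic pair
    and one antiholomorphic vector, trades the exchange of [k] and [i] for the terms
    that compatibility with the metric produces. *)
Lemma bismut_low_same k i j :
  \sum_l Gam z (inl k) (inl i) (inl l) * g z l j = dz i (fun w => g w k j) z.
Proof.
have [gH /(_ z z0) gT] := gB; have Gt := hermitian_connection_type _ gH z0.
rewrite -[RHS]/(dfr (inl i) _ z) (compatE (inl i) k j gH z0).
have [_] := gT (inl i) (inl k) (inr j); rewrite /torsion_low low_inr low_inl /torsion.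
under eq_bigr do rewrite mulrBl; rewrite sumrB.
under [in RHS]eq_bigr do rewrite (Gt (inr j) (inl i) (inr _)) // subr0.
by move=> /eqP; rewrite subr_eq addrC => /eqP E; rewrite E -addrA addNr addr0 //.
Qed.

(** The two skew-symmetries express [dzbar a g_bc] through a single family of
    symbols, from which the mixed symbols are recovered by difference. *)
Lemma bismut_low_mixed k i j :
  \sum_l Gam z (inr k) (inl i) (inl l) * g z l j =
  dzbar k (fun w => g w i j) z - dzbar j (fun w => g w i k) z.
Proof.
have [gH /(_ z z0) gT] := gB; have Gt := hermitian_connection_type _ gH z0.
have T1 a b c : \sum_l Gam z (inr a) (inl b) (inl l) * g z l c =
   - (\sum_l Gam z (inr a) (inr c) (inr l) * g z b l) +
   \sum_l Gam z (inr c) (inr a) (inr l) * g z b l.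
  have [_] := gT (inr a) (inl b) (inr c); rewrite /torsion_low low_inr low_inl /torsion.
  under eq_bigr do rewrite (Gt (inl b) (inr a) (inl _)) // subr0.
  by move=> ->; under eq_bigr do rewrite mulrBl; rewrite sumrB opprB addrC.
have T2 a b c : dzbar a (fun w => g w b c) z = \sum_l Gam z (inr c) (inr a) (inr l) * g z b l.
  rewrite -[LHS]/(dfr (inr a) _ z) (compatE (inr a) b c gH z0) T1.
  by rewrite addrAC addNr add0r.
by rewrite !T2 T1 addrC.
Qed.

End Uniqueness.

(** The remaining components are forced: those that mix types vanish, and the
    antiholomorphic ones are conjugate to the holomorphic ones. *)
Definition conn_of (G1 G2 : pt -> 'I_n -> 'I_n -> 'I_n -> C) : connection R n :=
  fun z A B D => match A, B, D with
  | inl k, inl i, inl l => G1 z k i l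
  | inr k, inl i, inl l => G2 z k i l
  | inr k, inr i, inr l => (G1 z k i l)^*
  | inl k, inr i, inr l => (G2 z k i l)^*
  | _, _, _ => 0
  end.

(** The conditions found above are sufficient: the symbols with one antiholomorphic
    lower index and their conjugates then satisfy each of the defining identities,
    type by type. *)
Lemma bismut_exists g G1 G2 :
  (forall i j, CkC 0 (fun w => g w i j)) ->
  (forall z, z != 0 -> forall i j, g z j i = (g z i j)^*) ->
  (forall z, z != 0 -> forall k i j,
     \sum_l G1 z k i l * g z l j = dz i (fun w => g w k j) z) ->
  (forall z, z != 0 -> forall k i j,
     \sum_l G2 z k i l * g z l j =
       dzbar k (fun w => g w i j) z - dzbar j (fun w => g w i k) z) ->
  is_bismut g (conn_of G1 G2).
Proof.
move=> gC0 gh L1 L2.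
have dconj z k i j : z != 0 -> (dz k (fun w => g w i j) z)^* = dzbar k (fun w => g w j i) z.
  move=> z0; rewrite -[RHS]/(dfr (inr k) _ z) (eq_dfr (inr k) (g := fun w => (g w i j)^*) _ z0).
    by rewrite dfr_conj.
  by move=> w w0; rewrite gh.
have dconj' z k i j : z != 0 -> (dzbar k (fun w => g w i j) z)^* = dz k (fun w => g w j i) z.
  by move=> z0; rewrite -dconj// conjCK.
have L1c z : z != 0 -> forall k i j,
    \sum_l (G1 z k i l)^* * g z j l = dzbar i (fun w => g w j k) z.
  move=> z0 k i j; rewrite -dconj// -L1// rmorph_sum; apply: eq_bigr => l _.
  by rewrite rmorphM /= -gh.
have L2c z : z != 0 -> forall k i j, \sum_l (G2 z k i l)^* * g z j l =
     dz k (fun w => g w j i) z - dz j (fun w => g w k i) z.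
  move=> z0 k i j; rewrite -dconj'// -[X in _ - X]dconj'// -rmorphB -L2// rmorph_sum.
  by apply: eq_bigr => l _; rewrite rmorphM /= -gh.
pose Gam := conn_of G1 G2.
have sum0 (F : 'I_n -> C) : \sum_l 0 * F l = 0 by apply: big1 => l _; rewrite mul0r.
have K z a i j : z != 0 -> dfr a (fun w => g w i j) z =
    \sum_l Gam z a (inl i) (inl l) * g z l j + \sum_l Gam z a (inr j) (inr l) * g z i l.
  by move=> z0; case: a => a /=; rewrite ?L1// ?L2// ?L1c// ?L2c//; ring.
split=> [z z0|z z0 A B D]; first split.
- by case=> a [] b [] d //=; rewrite ?conjCK ?conjC0.
- move=> a [] b [] d; rewrite big_split /= ?low_inr ?low_inl.
  + by rewrite dfr_cst; case: a => a /=; rewrite !sum0 addr0.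
  + exact: K.
  + by rewrite addrC; exact: K.
  + by rewrite dfr_cst; case: a => a /=; rewrite !sum0 addr0.
- by case=> a [] b [] d //=; rewrite ?mul0r ?mulr0 // mulrC.
split.
  rewrite /torsion_low -sumrN; apply: eq_bigr => E _.
  by rewrite /torsion -mulNr opprB.
have TL E a b : torsion_low g Gam z a b E =
    \sum_l Gam z a b l * gC (g z) l E - \sum_l Gam z b a l * gC (g z) l E.
  by rewrite /torsion_low -sumrB; apply: eq_bigr => l _; rewrite mulrBl.
rewrite !TL; case: A => a; case: B => b; case: D => d;
  rewrite ?low_inr ?low_inl /= ?sum0 ?L1// ?L2// ?L1c// ?L2c//; ring.
Qed.

End BismutGeneral.

(** * The Bismut curvature of a Hopf metric *)

Section HopfBismut.
Context {R : realType} {n : nat}.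
Notation C := R[i].
Notation pt := 'rV[C]_n.
Implicit Types (A B P Q : idx n) (z : pt).
Variables al y : R.
Notation a := (al%:C%C).
Notation Y := (y%:C%C).
Notation be := (al * (y - 1)).
Notation g := (@hopf_metric R n al be).
Notation r z := ((sqnorm z)^-1).

Lemma beE : be%:C%C = a * (Y - 1) :> C.
Proof. by rewrite rmorphM rmorphB rmorph1. Qed.

(** The symbols obtained from [bismut_low_same] and [bismut_low_mixed] by raising an
    index with the inverse of the Hopf metric. *)
Definition hopf_Gam z (k i l : 'I_n) : C :=
  r z * (- ((z 0 i)^* * kron k l) + (Y - 1) * (z 0 k)^* * kron i l
         + (1 - Y) * (z 0 i)^* * (z 0 k)^* * z 0 l * r z).
Definition hopf_Gambar z (k i l : 'I_n) : C :=
  r z * (kron k i * z 0 l - Y * kron i l * z 0 k - (1 - Y) * z 0 k * (z 0 i)^* * z 0 l * r z).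

Lemma kronC (i j : 'I_n) : kron i j = kron j i :> C.
Proof. by rewrite /kron eq_sym. Qed.

Lemma sum_kron (k : 'I_n) (F : 'I_n -> C) : \sum_j kron k j * F j = F k.
Proof. exact: sum_delta. Qed.

Lemma sum_kronr (k : 'I_n) (F : 'I_n -> C) : \sum_j kron j k * F j = F k.
Proof. by under eq_bigr do rewrite kronC; exact: sum_delta. Qed.

Lemma sum_zz z : z != 0 -> (\sum_l z 0 l * (z 0 l)^*) * r z = 1.
Proof. by move=> /sqnorm_neq0 r0; rewrite -/(sqnorm z) mulfV. Qed.

(** The radial direction is an eigendirection of the metric. *)
Lemma sum_z_hopf z j : z != 0 -> \sum_l z 0 l * g z l j = a * Y * z 0 j * r z.
Proof.
move=> z0; have rr := sum_zz z0.
under eq_bigr => l _.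
  rewrite hopf_metricE beE.
  rewrite (_ : _ * _ = a * r z * (kron l j * z 0 l) +
    a * (Y - 1) * r z * r z * z 0 j * (z 0 l * (z 0 l)^*)); last first.
    by move: (kron l j) (r z) => d s; ring.
  over.
rewrite big_split /= -!mulr_sumr sum_kronr.
transitivity (a * r z * z 0 j + a * (Y - 1) * r z * z 0 j *
   ((\sum_l z 0 l * (z 0 l)^*) * r z)); first by ring.
by rewrite rr; ring.
Qed.

Lemma low_comb z (c1 c2 c3 : C) k i j : z != 0 ->
  \sum_l (c1 * kron k l + c2 * kron i l + c3 * z 0 l) * g z l j =
  c1 * g z k j + c2 * g z i j + c3 * (a * Y * z 0 j * r z).
Proof.
move=> z0; rewrite -(sum_z_hopf j z0) -(sum_kron k (fun l => g z l j)).
rewrite -(sum_kron i (fun l => g z l j)) !mulr_sumr -!big_split /=.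
by apply: eq_bigr => l _; move: (kron k l) (kron i l) (g z l j) => d e f; ring.
Qed.

Lemma hopf_Gam_low z k i j : z != 0 ->
  \sum_l hopf_Gam z k i l * g z l j = dz i (fun w => g w k j) z.
Proof.
move=> z0; rewrite -[RHS]/(dfr (inl i) _ z) (is_dfr_val (is_dfr_hopf z0 (inl i) al be k j)).
transitivity (\sum_l ((- r z * (z 0 i)^*) * kron k l + (r z * (Y - 1) * (z 0 k)^*) * kron i l +
     (r z * r z * (1 - Y) * (z 0 i)^* * (z 0 k)^*) * z 0 l) * g z l j).
  apply: eq_bigr => l _; congr (_ * _); rewrite /hopf_Gam.
  by move: (kron k l) (kron i l) (r z) => d e s; ring.
rewrite low_comb// !hopf_metricE beE /=.
by rewrite -/(kron i j); move: (kron i j) (kron k j) (r z) => d e s; ring.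
Qed.

Lemma hopf_Gambar_low z k i j : z != 0 -> \sum_l hopf_Gambar z k i l * g z l j =
  dzbar k (fun w => g w i j) z - dzbar j (fun w => g w i k) z.
Proof.
move=> z0; rewrite -[dzbar k _ z]/(dfr (inr k) _ z) -[dzbar j _ z]/(dfr (inr j) _ z).
rewrite (is_dfr_val (is_dfr_hopf z0 (inr k) al be i j)).
rewrite (is_dfr_val (is_dfr_hopf z0 (inr j) al be i k)).
transitivity (\sum_l (0 * kron k l + (- r z * Y * z 0 k) * kron i l +
     (r z * kron k i - r z * r z * (1 - Y) * z 0 k * (z 0 i)^*) * z 0 l) * g z l j).
  apply: eq_bigr => l _; congr (_ * _); rewrite /hopf_Gambar.
  by move: (kron k i) (kron k l) (kron i l) (r z) => d e f s; ring.
rewrite low_comb// !hopf_metricE beE /=.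
rewrite -/(kron k i) -/(kron j i) (kronC k i) (kronC j i).
by move: (kron i k) (kron i j) (r z) => d e s; ring.
Qed.

Lemma hopf_Gam_contr z j k (F : 'I_n -> C) : \sum_l hopf_Gam z j k l * F l =
  - r z * (z 0 k)^* * F j + r z * (Y - 1) * (z 0 j)^* * F k +
  (1 - Y) * (z 0 k)^* * (z 0 j)^* * r z * r z * \sum_l z 0 l * F l.
Proof.
rewrite -{1}(sum_kron j F) -{1}(sum_kron k F) !mulr_sumr -!big_split /=.
apply: eq_bigr => l _; rewrite /hopf_Gam; move: (kron j l) (kron k l) (r z) => d e s.
by ring.
Qed.

Lemma hopf_Gambar_contr z j k (F : 'I_n -> C) : \sum_l hopf_Gambar z j k l * F l =
  r z * (kron j k - (1 - Y) * z 0 j * (z 0 k)^* * r z) * (\sum_l z 0 l * F l)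
  - r z * Y * z 0 j * F k.
Proof.
rewrite -{1}(sum_kron k F) !mulr_sumr -sumrB /=.
apply: eq_bigr => l _; rewrite /hopf_Gambar; move: (kron j k) (kron k l) (r z) => d e s.
by ring.
Qed.

Lemma sum_z_hopf_Gam z i D : z != 0 -> \sum_l z 0 l * hopf_Gam z i l D = - kron i D.
Proof.
move=> z0; have rr := sum_zz z0.
transitivity ((- kron i D * r z + (1 - Y) * (z 0 i)^* * z 0 D * r z * r z) *
     (\sum_l z 0 l * (z 0 l)^*) + (Y - 1) * (z 0 i)^* * r z *
     (\sum_l kron l D * z 0 l)).
  rewrite !mulr_sumr -!big_split /=; apply: eq_bigr => l _; rewrite /hopf_Gam.
  by move: (kron i D) (kron l D) (r z) => d e s; ring.
rewrite sum_kronr; move: rr; move: (kron i D) (r z) (\sum_l _) => d s S rr.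
by ring: rr.
Qed.

(** The contraction with the radial field makes the quadratic terms of the curvature
    collapse. *)
Lemma sum_z_hopf_Gambar z i D : z != 0 -> \sum_l z 0 l * hopf_Gambar z i l D = 0.
Proof.
move=> z0; have rr := sum_zz z0.
transitivity (- (1 - Y) * z 0 i * z 0 D * r z * r z * (\sum_l z 0 l * (z 0 l)^*)
  + r z * z 0 D * (\sum_l kron i l * z 0 l) - Y * r z * z 0 i * (\sum_l kron l D * z 0 l)).
  rewrite !mulr_sumr -big_split -sumrB /=; apply: eq_bigr => l _; rewrite /hopf_Gambar.
  by move: (kron i l) (kron l D) (r z) => d e s; ring.
rewrite sum_kronr sum_kron; move: rr; move: (r z) (\sum_l _) => s S rr.
by ring: rr.
Qed.

Section Curvature.
Variable z : pt.
Hypothesis z0 : z != 0.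
Notation r0 := (r z).
Notation ds A := (dsqnorm z A).

Lemma is_dfr_hopf_Gam A k i l : is_dfr z A (fun w => hopf_Gam w k i l)
  (- ds A * (r0 * r0) * (- ((z 0 i)^* * kron k l) + (Y - 1) * (z 0 k)^* * kron i l
         + (1 - Y) * (z 0 i)^* * (z 0 k)^* * z 0 l * r0)
   + r0 * (- (dccoord A i * kron k l) + (Y - 1) * dccoord A k * kron i l
         + (1 - Y) * (dccoord A i * (z 0 k)^* * z 0 l * r0 + (z 0 i)^* * dccoord A k * z 0 l * r0
         + (z 0 i)^* * (z 0 k)^* * dcoord A l * r0
         + (z 0 i)^* * (z 0 k)^* * z 0 l * (- ds A * (r0 * r0))))).
Proof.
have dr := is_dfr_isqnorm z0 A; have c := is_dfr_cst z A.
have u := is_dfr_ccoord z0 A; have v := is_dfr_coord z A.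
apply: is_dfr_eq (is_dfrM z0 dr (is_dfrD z0 (is_dfrD z0
   (is_dfrN z0 (is_dfrM z0 (u i) (c (kron k l))))
   (is_dfrM z0 (is_dfrM z0 (c (Y - 1)) (u k)) (c (kron i l))))
   (is_dfrM z0 (is_dfrM z0 (is_dfrM z0 (is_dfrM z0 (c (1 - Y)) (u i)) (u k)) (v l)) dr))) _.
move: (kron i l) (kron k l) (dccoord A i) (dccoord A k) (dcoord A l) (ds A) r0 => d1 d2 d3 d4 d5 d6 s.
by ring.
Qed.

Lemma is_dfr_hopf_Gambar A k i l : is_dfr z A (fun w => hopf_Gambar w k i l)
  (- ds A * (r0 * r0) * (kron k i * z 0 l - Y * kron i l * z 0 k - (1 - Y) * z 0 k * (z 0 i)^* * z 0 l * r0)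
   + r0 * (kron k i * dcoord A l - Y * kron i l * dcoord A k
      - (1 - Y) * (dcoord A k * (z 0 i)^* * z 0 l * r0 + z 0 k * dccoord A i * z 0 l * r0
         + z 0 k * (z 0 i)^* * dcoord A l * r0
         + z 0 k * (z 0 i)^* * z 0 l * (- ds A * (r0 * r0))))).
Proof.
have dr := is_dfr_isqnorm z0 A; have c := is_dfr_cst z A.
have u := is_dfr_ccoord z0 A; have v := is_dfr_coord z A.
apply: is_dfr_eq (is_dfrM z0 dr (is_dfrD z0 (is_dfrD z0
   (is_dfrM z0 (c (kron k i)) (v l))
   (is_dfrN z0 (is_dfrM z0 (c (Y * kron i l)) (v k))))
   (is_dfrN z0 (is_dfrM z0 (is_dfrM z0 (is_dfrM z0 (is_dfrM z0 (c (1 - Y)) (v k)) (u i)) (v l)) dr)))) _.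
move: (kron i l) (kron k i) (dcoord A k) (dccoord A i) (dcoord A l) (ds A) r0 => d1 d2 d3 d4 d5 d6 s.
by ring.
Qed.

Notation Gam := (conn_of hopf_Gam hopf_Gambar).

(** The projection onto the complement of the radial direction. *)
Definition perp z i j : C := kron i j - (z 0 i)^* * z 0 j * r z.

Lemma curv_hopf_lr i j k D : curv Gam z (inl i) (inr j) (inl k) (inl D) =
  r0 * (perp z k j * perp z i D + (1 - 2 * Y) * (perp z i j * perp z k D)).
Proof.
rewrite /curv sum_idx [X in _ + (_ + X)]big1 ?addr0; last first.
  by move=> l _; rewrite /= !mul0r subrr.
rewrite /= sumrB hopf_Gam_contr hopf_Gambar_contr sum_z_hopf_Gam// sum_z_hopf_Gambar//.
rewrite -[dz i _ z]/(dfr (inl i) _ z) -[dzbar j _ z]/(dfr (inr j) _ z).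
rewrite (is_dfr_val (is_dfr_hopf_Gambar (inl i) j k D)) (is_dfr_val (is_dfr_hopf_Gam (inr j) i k D)).
rewrite /hopf_Gam /hopf_Gambar /perp /= -/(kron i j) -/(kron i D) -/(kron j k) -/(kron j i) (kronC j i) (kronC k j).
move: (kron i j) (kron i D) (kron j k) (kron k D) (r z) => d1 d2 d3 d4 s.
by ring.
Qed.

Lemma curv_hopf_ll i j k D : curv Gam z (inl i) (inl j) (inl k) (inl D) = 0.
Proof.
rewrite /curv sum_idx [X in _ + (_ + X)]big1 ?addr0; last first.
  by move=> l _; rewrite /= !mul0r subrr.
rewrite /= sumrB !hopf_Gam_contr !sum_z_hopf_Gam//.
rewrite -[dz i _ z]/(dfr (inl i) _ z) -[dz j _ z]/(dfr (inl j) _ z).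
rewrite (is_dfr_val (is_dfr_hopf_Gam (inl i) j k D)) (is_dfr_val (is_dfr_hopf_Gam (inl j) i k D)).
rewrite /hopf_Gam /= -/(kron i D) -/(kron j D).
move: (kron i D) (kron j D) (kron k D) (r z) => d1 d2 d3 s.
by ring.
Qed.

Lemma curv_hopf_rr i j k D : curv Gam z (inr i) (inr j) (inl k) (inl D) = 0.
Proof.
rewrite /curv sum_idx [X in _ + (_ + X)]big1 ?addr0; last first.
  by move=> l _; rewrite /= !mul0r subrr.
rewrite /= sumrB !hopf_Gambar_contr !sum_z_hopf_Gambar//.
rewrite -[dzbar i _ z]/(dfr (inr i) _ z) -[dzbar j _ z]/(dfr (inr j) _ z).
rewrite (is_dfr_val (is_dfr_hopf_Gambar (inr i) j k D)) (is_dfr_val (is_dfr_hopf_Gambar (inr j) i k D)).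
rewrite /hopf_Gambar /= -/(kron i k) -/(kron j k).
move: (kron i k) (kron j k) (kron k D) (r z) => d1 d2 d3 s.
by ring.
Qed.

End Curvature.

End HopfBismut.

Section HopfGriffiths.
Context {R : realType} {n : nat}.
Notation C := R[i].
Notation pt := 'rV[C]_n.
Implicit Types (A B P Q : idx n) (z : pt) (Gam : connection R n).

Lemma eq_curv Gam Gam' z A B P D : z != 0 ->
  (forall w, w != 0 -> forall A B D, Gam w A B D = Gam' w A B D) ->
  curv Gam z A B P D = curv Gam' z A B P D.
Proof.
move=> z0 GG; rewrite /curv; congr (_ - _ + _).
- by apply: (eq_dfr _ _ z0) => w w0; exact: GG.
- by apply: (eq_dfr _ _ z0) => w w0; exact: GG.
- by apply: eq_bigr => E _; rewrite !GG.
Qed.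

Lemma eq_Omega (g g' : metric R n) Gam Gam' z A B P Q : z != 0 -> g z = g' z ->
  (forall w, w != 0 -> forall A B D, Gam w A B D = Gam' w A B D) ->
  Omega g Gam z A B P Q = Omega g' Gam' z A B P Q.
Proof.
by move=> z0 gg GG; apply: eq_bigr => D _; rewrite gg (eq_curv _ _ _ _ z0 GG).
Qed.

Lemma eq_is_bismut (g g' : metric R n) Gam : (forall z, z != 0 -> g z = g' z) ->
  is_bismut g Gam -> is_bismut g' Gam.
Proof.
move=> gg [H T]; split=> z z0.
  have [h1 h2 h3] := H z z0; split=> // A B D.
  rewrite -(eq_dfr A (f := fun w => gC (g w) B D) _ z0); last by move=> w /gg ->.
  by rewrite h2 gg.
move=> A B D; have := T z z0 A B D.
by rewrite /torsion_low -gg.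
Qed.

(** The property depends only on the values of the metric away from the origin. *)
Lemma eq_griffiths (g g' : metric R n) : (forall z, z != 0 -> g z = g' z) ->
  bismut_griffiths_nonneg g -> bismut_griffiths_nonneg g'.
Proof.
move=> gg [Gam gB H]; exists Gam; first exact: eq_is_bismut gB.
move=> z z0; have [H1 H2] := H z z0; split=> [A B P Q AB|xi nu xi0 nu0].
  rewrite -(H1 A B P Q AB); apply: eq_Omega => //; exact/esym/gg.
rewrite (le_trans (H2 xi nu xi0 nu0))// le_eqVlt; apply/orP; left; apply/eqP.
do 4 (apply: eq_bigr => ? _); congr (_ * _).
by apply: eq_Omega => //; exact: gg.
Qed.

Variables al y : R.
Notation a := (al%:C%C).
Notation Y := (y%:C%C).
Notation be := (al * (y - 1)).
Notation g := (@hopf_metric R n al be).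
Notation r z := ((sqnorm z)^-1).
Notation hGam := (conn_of (@hopf_Gam R n y) (@hopf_Gambar R n y)).

Lemma hopf_hermitian z i j : g z j i = (g z i j)^*.
Proof.
rewrite !hopf_metricE rmorphD !rmorphM /= fmorphV /= conj_sqnorm conjCK /kron conjC_nat.
have cR (x : R) : (x%:C%C)^* = x%:C%C :> C by rewrite conjCE /= oppr0.
by rewrite !cR eq_sym [z 0 i * _]mulrC.
Qed.

Lemma hopf_is_bismut : is_bismut g hGam.
Proof.
apply: bismut_exists => [i j|z _ i j|z z0 k i j|z z0 k i j].
- exact: CkC_hopf.
- exact: hopf_hermitian.
- exact: hopf_Gam_low.
- exact: hopf_Gambar_low.
Qed.

(** The inverse of the Hopf metric. *)
Definition hopf_dual z k l : C := a^-1 * (kron k l * sqnorm z + (Y^-1 - 1) * z 0 k * (z 0 l)^*).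

Hypotheses (al0 : al != 0) (y0 : y != 0).

Let a0 : a != 0 :> C. Proof. by rewrite (inj_eq (@complexI R)). Qed.
Let Y0 : Y != 0 :> C. Proof. by rewrite (inj_eq (@complexI R)). Qed.

Lemma sum_cz_hopf z m : z != 0 ->
  \sum_l (z 0 l)^* * g z m l = a * Y * (z 0 m)^* * r z.
Proof.
have cR (x : R) : (x%:C%C)^* = x%:C%C :> C by rewrite conjCE /= oppr0.
move=> z0; have := congr1 Num.conj (sum_z_hopf al y m z0).
rewrite rmorph_sum !rmorphM /= !cR fmorphV /= conj_sqnorm => <-.
by apply: eq_bigr => l _; rewrite rmorphM /= -hopf_hermitian.
Qed.

Lemma hopf_inv z k m : z != 0 -> \sum_l hopf_dual z k l * g z m l = kron k m.
Proof.
move=> z0; have rr : sqnorm z * r z = 1 by rewrite mulfV// sqnorm_neq0.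
transitivity (a^-1 * sqnorm z * (\sum_l kron k l * g z m l) +
   a^-1 * (Y^-1 - 1) * z 0 k * (\sum_l (z 0 l)^* * g z m l)).
  rewrite /hopf_dual; move: (sqnorm z) => s; rewrite !mulr_sumr -big_split /=.
  apply: eq_bigr => l _.
  by move: (kron k l) (g z m l) (a^-1) (Y^-1) => d e i1 i2; ring.
rewrite sum_kron sum_cz_hopf// hopf_metricE beE (kronC m k).
have s0 := sqnorm_neq0 z0; move: s0 a0 Y0; move: (sqnorm z) (kron k m) a Y => s d b c s0 b0 c0.
by field; rewrite s0 b0 c0.
Qed.

(** Invertibility in the form needed here: a vector is determined by its lowering. *)
Lemma hopf_nondeg z (F F' : 'I_n -> C) : z != 0 ->
  (forall j, \sum_l F l * g z l j = \sum_l F' l * g z l j) -> F =1 F'.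
Proof.
move=> z0 FF k; rewrite -(sum_kron k F) -(sum_kron k F').
have E (H : 'I_n -> C) : \sum_m kron k m * H m = \sum_l hopf_dual z k l * (\sum_m H m * g z m l).
  under eq_bigr do rewrite -(hopf_inv k _ z0) mulr_suml.
  rewrite exchange_big; apply: eq_bigr => l _; rewrite mulr_sumr.
  by apply: eq_bigr => m _; rewrite mulrAC mulrA.
by rewrite !E; apply: eq_bigr => l _; rewrite FF.
Qed.

(** Existentially quantified connections in the definition of non-negativity can
    thus be replaced by the explicit one. *)
Lemma hopf_bismut_unique Gam : is_bismut g Gam ->
  forall z, z != 0 -> forall A B D, Gam z A B D = hGam z A B D.
Proof.
move=> gB z z0; have [gH _] := gB.
have H A i l : Gam z A (inl i) (inl l) = hGam z A (inl i) (inl l).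
  case: A => k /=; move: l.
    by apply: (hopf_nondeg z0) => j; rewrite (bismut_low_same gB z0) hopf_Gam_low.
  by apply: (hopf_nondeg z0) => j; rewrite (bismut_low_mixed gB z0) hopf_Gambar_low.
have [Gc _ _] := gH z z0; have [hc _ _] := hopf_is_bismut.1 z z0.
move=> A [] b [] d; first exact: H.
- by rewrite (hermitian_connection_type _ gH)//; case: A.
- by rewrite (hermitian_connection_type _ gH)//; case: A.
have := Gc (bar A) (inl b) (inl d); have := hc (bar A) (inl b) (inl d).
have -> : bar (bar A) = A by case: A.
by move=> /= -> ->; rewrite H.
Qed.

Lemma perp_low z i l : z != 0 -> \sum_D perp z i D * g z D l = a * r z * perp z i l.
Proof.
move=> z0; transitivity (\sum_D kron i D * g z D l - (z 0 i)^* * r z * \sum_D z 0 D * g z D l).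
  rewrite mulr_sumr -sumrB; apply: eq_bigr => D _; rewrite /perp.
  by move: (kron i D) (g z D l) (r z) => *; ring.
rewrite sum_kron sum_z_hopf// hopf_metricE beE /perp.
by move: (kron i l) (r z) => *; ring.
Qed.

Lemma Omega_hopf z i j k l : z != 0 ->
  Omega g hGam z (inl i) (inr j) (inl k) (inr l) =
  a * (r z) ^+ 2 * (perp z k j * perp z i l + (1 - 2 * Y) * (perp z i j * perp z k l)).
Proof.
move=> z0; rewrite /Omega low_inr.
under eq_bigr do rewrite curv_hopf_lr//.
transitivity (r z * perp z k j * (\sum_D perp z i D * g z D l) +
   r z * (1 - 2 * Y) * perp z i j * (\sum_D perp z k D * g z D l)).
  move: (r z) (perp z k j) (perp z i j) => s d1 d2.
  rewrite !mulr_sumr -big_split /=; apply: eq_bigr => D _.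
  by move: (perp z i D) (perp z k D) (g z D l) => *; ring.
rewrite !perp_low//.
by move: (perp z k j) (perp z i l) (perp z i j) (perp z k l) (r z) => *; ring.
Qed.

End HopfGriffiths.

(** * The non-negativity criterion for Hopf metrics *)

Section GriffithsCriterion.
Context {R : realType} {n : nat}.
Notation C := R[i].
Notation pt := 'rV[C]_n.
Implicit Types (A B P Q : idx n) (z : pt) (Gam : connection R n).
Variables al y : R.
Notation a := (al%:C%C).
Notation Y := (y%:C%C).
Notation be := (al * (y - 1)).
Notation g := (@hopf_metric R n al be).
Notation r z := ((sqnorm z)^-1).
Notation hGam := (conn_of (@hopf_Gam R n y) (@hopf_Gambar R n y)).

Lemma CkC_hGam A B D z : z != 0 -> CkC 0 (fun w => hGam w A B D).
Proof.
move=> z0; have c0 := @CkC_cst R n 0 0.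
have h1 k i l := (is_dfr_hopf_Gam y z0 (inl k) k i l).1.
have h2 k i l := (is_dfr_hopf_Gambar y z0 (inl k) k i l).1.
case: A => A; case: B => B; case: D => D /=;
  [exact: h1|exact: c0|exact: c0|exact: CkC_conj (h2 _ _ _)|
   exact: h2|exact: c0|exact: c0|exact: CkC_conj (h1 _ _ _)].
Qed.

(** The explicit connection is real, so its curvature is determined by the
    components acting on the holomorphic frame. *)
Lemma curv_bar A B P D z : z != 0 ->
  curv hGam z (bar A) (bar B) (bar P) (bar D) = (curv hGam z A B P D)^*.
Proof.
move=> z0; have bb E : bar (bar E) = E :> idx n by case: E.
have Hb w A' B' D' : hGam w (bar A') (bar B') (bar D') = (hGam w A' B' D')^*.
  by case: A' => ?; case: B' => ?; case: D' => ? /=; rewrite ?conjCK ?conjC0.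
rewrite /curv rmorphD rmorphB; congr (_ - _ + _).
- rewrite (eq_dfr (bar A) (g := fun w => (hGam w B P D)^*) _ z0); last by move=> w _.
  by rewrite dfr_conj ?bb//; exact: CkC_hGam z0.
- rewrite (eq_dfr (bar B) (g := fun w => (hGam w A P D)^*) _ z0); last by move=> w _.
  by rewrite dfr_conj ?bb//; exact: CkC_hGam z0.
rewrite rmorph_sum [LHS](reindex_inj (inv_inj bb)); apply: eq_bigr => E _.
by rewrite !Hb rmorphB !rmorphM.
Qed.

(** The curvature preserves the types because the connection does, and its (2,0) and
    (0,2) parts vanish. *)
Lemma Omega_hopf_same A B P Q z : z != 0 -> same_type A B || same_type P Q ->
  Omega g hGam z A B P Q = 0.
Proof.
move=> z0 AB; rewrite /Omega; apply: big1 => D _.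
have mix A' B' P' D' : ~~ same_type P' D' -> curv hGam z A' B' P' D' = 0.
  have G0 w E P0 D0 : ~~ same_type P0 D0 -> hGam w E P0 D0 = 0.
    by case: P0 => ?; case: D0 => ?; case: E.
  move=> PD; rewrite /curv.
  rewrite !(@eq_dfr _ _ _ _ (fun=> 0) z _ z0); [|by move=> w _; exact: G0..].
  rewrite !dfr_cst subrr add0r; apply: big1 => E _.
  have [PE|PE] := boolP (same_type P' E); last by rewrite !(G0 _ _ P') // !mul0r subr0.
  have ED : ~~ same_type E D'.
    by case: P' PD PE => ?; case: E => ?; case: D'.
  by rewrite !(G0 _ _ E) // !mulr0 subr0.
have [PD|PD] := boolP (same_type P D); last by rewrite mix ?mul0r.
have [PQ|PQ] := boolP (same_type P Q).
  by case: P {AB} PD PQ => ?; case: D => ?; case: Q => ? //= _ _; rewrite mulr0.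
move: AB; rewrite (negbTE PQ) orbF => AB.
suff -> : curv hGam z A B P D = 0 by rewrite mul0r.
have L A' B' k d : same_type A' B' -> curv hGam z A' B' (inl k) (inl d) = 0.
  case: A' => i; case: B' => j //= _; [exact: curv_hopf_ll|exact: curv_hopf_rr].
case: P PD {PQ} => k; case: D => d //= _; first exact: L.
have := curv_bar (bar A) (bar B) (inl k) (inl d) z0.
have bb E : bar (bar E) = E :> idx n by case: E.
by rewrite /= !bb => ->; rewrite L ?conjC0//; case: A AB => ?; case: B.
Qed.

Lemma conj_perp z i j : (perp z i j)^* = perp z j i.
Proof.
rewrite /perp rmorphB !rmorphM /= fmorphV /= conj_sqnorm conjCK /kron conjC_nat.
by rewrite eq_sym [z 0 i * _]mulrC.
Qed.

(** perp is an orthogonal projection. *)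
Lemma perp_idem z i j : z != 0 -> \sum_k perp z i k * perp z k j = perp z i j.
Proof.
move=> z0; have rr := sum_zz z0.
have E : \sum_k z 0 k * perp z k j = 0.
  transitivity (\sum_k kron k j * z 0 k - z 0 j * ((\sum_k z 0 k * (z 0 k)^*) * r z)).
    rewrite mulr_suml mulr_sumr -sumrB; apply: eq_bigr => k _; rewrite /perp.
    by move: (kron k j) (r z) => *; ring.
  by rewrite sum_kronr rr mulr1 subrr.
transitivity (\sum_k kron i k * perp z k j - (z 0 i)^* * r z * (\sum_k z 0 k * perp z k j)).
  rewrite mulr_sumr -sumrB; apply: eq_bigr => k _; rewrite {1}/perp.
  by move: (kron i k) (perp z k j) (r z) => *; ring.
by rewrite E mulr0 subr0 sum_kron.
Qed.

Definition perpform z (xi : pt) : C := \sum_i \sum_j xi 0 i * (xi 0 j)^* * perp z i j.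

(** Idempotence and hermitian symmetry write the form of [perp] as a sum of squares. *)
Lemma perpform_ge0 z xi : z != 0 -> 0 <= perpform z xi.
Proof.
move=> z0; suff -> : perpform z xi = \sum_k (\sum_i xi 0 i * perp z i k) * (\sum_i xi 0 i * perp z i k)^*.
  by apply: sumr_ge0 => k _; rewrite -normCK exprn_ge0.
rewrite /perpform.
under [RHS]eq_bigr => k _.
  rewrite rmorph_sum mulr_suml.
  under eq_bigr do rewrite mulr_sumr.
  over.
rewrite /= [RHS]exchange_big; apply: eq_bigr => i _.
rewrite [RHS]exchange_big; apply: eq_bigr => j _ /=.
rewrite -[in LHS](perp_idem _ _ z0) mulr_sumr; apply: eq_bigr => k _.
by rewrite rmorphM /= conj_perp; move: (perp z i k) (perp z k j) => *; ring.
Qed.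

(** In dimension two the complement of the radial direction is a line: the
    determinant of the projection vanishes, and so do all its minors. *)
Lemma perp_rank1 z i j k l : z != 0 -> n = 2%N ->
  perp z k j * perp z i l = perp z i j * perp z k l.
Proof.
move=> z0 n2; have rr := sum_zz z0.
have [->//|ik] := eqVneq i k.
have [->|jl] := eqVneq j l; first by rewrite mulrC.
have I2 (p q s : 'I_n) : p != q -> s = p \/ s = q.
  move=> pq; have lp := ltn_ord p; have lq := ltn_ord q; have ls := ltn_ord s.
  have : (s == p) || (s == q).
    rewrite -!val_eqE /=; move: pq; rewrite -val_eqE /= => pq.
    by lia.
  by case/orP => /eqP; [left|right].
have det (p q : 'I_n) : p != q -> perp z p p * perp z q q = perp z p q * perp z q p.
  move=> pq.
  have S : sqnorm z = z 0 p * (z 0 p)^* + z 0 q * (z 0 q)^*.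
    rewrite /sqnorm (bigD1 p)//= (bigD1 q)/= 1?eq_sym// big1 ?addr0// => m /andP[mp mq].
    by case: (I2 p q m pq) => E; move: mp mq; rewrite E eqxx.
  have {rr} : (z 0 p * (z 0 p)^* + z 0 q * (z 0 q)^*) * r z = 1.
    by rewrite -S mulfV// sqnorm_neq0.
  rewrite /perp /kron !eqxx (negbTE pq) eq_sym (negbTE pq) /=.
  move: (r z) => s rr; apply/eqP; rewrite -subr_eq0; apply/eqP.
  transitivity (1 - (z 0 p * (z 0 p)^* + z 0 q * (z 0 q)^*) * s); first by ring.
  by rewrite rr subrr.
case: (I2 i k l ik) => El; case: (I2 i k j ik) => Ej; subst j l;
  rewrite ?eqxx// in jl *.
- by rewrite mulrC det// mulrC.
- by rewrite mulrC det// mulrC.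
Qed.

Lemma sum4_outer (F G : 'I_n -> 'I_n -> C) :
  (\sum_i \sum_l F i l) * (\sum_j \sum_k G j k) =
  \sum_i \sum_j \sum_k \sum_l F i l * G j k.
Proof.
rewrite mulr_suml; apply: eq_bigr => i _; rewrite mulr_sumr; apply: eq_bigr => j _.
by rewrite mulr_sumr; apply: eq_bigr => k _; rewrite mulr_suml.
Qed.

Lemma sum4_inner (F G : 'I_n -> 'I_n -> C) :
  (\sum_i \sum_j F i j) * (\sum_k \sum_l G k l) =
  \sum_i \sum_j \sum_k \sum_l F i j * G k l.
Proof.
rewrite mulr_suml; apply: eq_bigr => i _; rewrite mulr_suml; apply: eq_bigr => j _.
by rewrite mulr_sumr; apply: eq_bigr => k _; rewrite mulr_sumr.
Qed.

Definition perpmix z (xi nu : pt) : C := \sum_i \sum_l xi 0 i * (nu 0 l)^* * perp z i l.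

Lemma conj_perpmix z xi nu : (perpmix z xi nu)^* =
    \sum_j \sum_k (xi 0 j)^* * nu 0 k * perp z k j.
Proof.
rewrite /perpmix rmorph_sum; apply: eq_bigr => j _; rewrite rmorph_sum.
by apply: eq_bigr => k _; rewrite !rmorphM /= conjCK conj_perp.
Qed.

Lemma perpmix_rank1 z xi nu : z != 0 -> n = 2%N ->
  perpmix z xi nu * (perpmix z xi nu)^* = perpform z xi * perpform z nu.
Proof.
move=> z0 n2; rewrite conj_perpmix /perpmix /perpform sum4_outer sum4_inner.
do 4 (apply: eq_bigr => ? _).
rewrite (_ : forall p q s t u v : C, p * q * s * (t * u * v) = p * t * (u * q) * (v * s)).
  by rewrite perp_rank1//; move: (perp _ _ _) (perp _ _ _) => *; ring.
by move=> *; ring.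
Qed.

(** In the form [|<xi', nu'>|^2 + (1 - 2 y) |xi'|^2 |nu'|^2], where the primes denote
    transverse projections. *)
Lemma griffiths_sum z (xi nu : pt) : z != 0 ->
  \sum_i \sum_j \sum_k \sum_l xi 0 i * (xi 0 j)^* * nu 0 k * (nu 0 l)^*
     * Omega g hGam z (inl i) (inr j) (inl k) (inr l) =
  a * (r z) ^+ 2 * (perpmix z xi nu * (perpmix z xi nu)^* +
     (1 - 2 * Y) * (perpform z xi * perpform z nu)).
Proof.
move=> z0; rewrite conj_perpmix /perpmix /perpform sum4_outer sum4_inner.
do 4 (rewrite [(1 - 2 * Y) * _]mulr_sumr -big_split mulr_sumr /=; apply: eq_bigr => ? _).
rewrite Omega_hopf//.
by move: (perp _ _ _) (perp _ _ _) (perp _ _ _) (perp _ _ _) (r z) => *; ring.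
Qed.

Lemma gamma_le (y1 : R) : (2 <= n)%N -> y1 <= 1 + gamma R n ->
  y1 <= 1 /\ (n != 2%N -> y1 <= 2^-1).
Proof. by move=> n2; rewrite /gamma; case: eqP => _ H; split=> //; lra. Qed.

(** For [n = 2] the two terms are proportional, with total factor [2 - 2 y]; for
    [n >= 3] both are non-negative as soon as [y <= 1/2]. *)
Lemma griffiths_suff : (2 <= n)%N -> 0 < al -> y <= 1 + gamma R n ->
  bismut_griffiths_nonneg g.
Proof.
move=> n2 al0 yg; exists hGam; first exact: hopf_is_bismut.
move=> z z0; split=> [A B P Q|xi nu _ _]; first exact: Omega_hopf_same.
have a0 : 0 <= a by rewrite ler0c ltW.
have r0 : 0 <= r z by rewrite invr_ge0 sqnorm_ge0.
have N1 := perpform_ge0 xi z0; have N2 := perpform_ge0 nu z0.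
have [y1 y2] := gamma_le n2 yg.
have cE (x : R) : 1 - 2 * x%:C%C = (1 - 2 * x)%:C%C :> C.
  by rewrite rmorphB rmorphM rmorph1 rmorph_nat.
rewrite griffiths_sum// mulr_ge0 ?mulr_ge0 ?exprn_ge0// -normCK.
have [n2'|n2'] := eqVneq n 2%N; last first.
  rewrite addr_ge0 ?exprn_ge0 ?normr_ge0// mulr_ge0 ?mulr_ge0// cE ler0c.
  by have := y2 n2'; lra.
rewrite normCK perpmix_rank1//.
rewrite -[X in X + _]mul1r -mulrDl mulr_ge0 ?mulr_ge0// cE.
rewrite -[1](rmorph1 (real_complex R)) -rmorphD ler0c.
by lra.
Qed.

(** Testing the form at a coordinate axis, on coordinate vectors orthogonal to it. *)
Lemma griffiths_nec : (2 <= n)%N -> 0 < al -> y != 0 ->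
  bismut_griffiths_nonneg g -> y <= 1 + gamma R n.
Proof.
move=> n2 al0 y0 [Gam gB H].
have n0 : (0 < n)%N by lia.
have n1 : (1 < n)%N by lia.
(* at a point of the axis [o] the vectors [e p] and [e q] are transverse *)
pose o := Ordinal n0; pose p := Ordinal n1.
pose e (i : 'I_n) : pt := delta_mx 0 i.
have e0 i : e i != 0.
  by apply/eqP => /rowP/(_ i); rewrite !mxE !eqxx => /eqP; rewrite oner_eq0.
have GG := hopf_bismut_unique (lt0r_neq0 al0) y0 gB.
have key q : q != o -> 0 <= a * (perp (e o) q p * perp (e o) p q + (1 - 2 * Y) * (perp (e o) p p * perp (e o) q q)).
  move=> qo; have [_ /(_ (e p) (e q) (e0 p) (e0 q))] := H (e o) (e0 o).
  rewrite (bigD1 p)//= [X in _ + X]big1; last first.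
    move=> i ip; apply: big1 => j _; apply: big1 => k _; apply: big1 => l _.
    by rewrite !mxE (negbTE ip) andbF !mul0r.
  rewrite addr0 (bigD1 p)//= [X in _ + X]big1; last first.
    move=> j jp; apply: big1 => k _; apply: big1 => l _.
    by rewrite !mxE (negbTE jp) andbF conjC0 mulr0 !mul0r.
  rewrite addr0 (bigD1 q)//= [X in _ + X]big1; last first.
    move=> k kq; apply: big1 => l _.
    by rewrite !mxE (negbTE kq) andbF mulr0 !mul0r.
  rewrite addr0 (bigD1 q)//= [X in _ + X]big1; last first.
    by move=> l lq; rewrite !mxE (negbTE lq) andbF conjC0 mulr0 !mul0r.
  rewrite addr0 (eq_Omega (g' := g) (Gam' := hGam))//.
  rewrite Omega_hopf// !mxE !eqxx conjC1 !mul1r.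
  have -> : sqnorm (e o) = 1.
    rewrite /sqnorm (bigD1 o)//= big1 ?mxE ?eqxx ?addr0 ?conjC1 ?mulr1// => i io.
    by rewrite !mxE (negbTE io) andbF mul0r.
  by rewrite invr1 expr1n mulr1.
have perpe i j : i != o -> perp (e o) i j = kron i j.
  by move=> io; rewrite /perp !mxE (negbTE io) andbF conjC0 !mul0r subr0.
have po : p != o by [].
have cE (x : R) : 1 - 2 * x%:C%C = (1 - 2 * x)%:C%C :> C.
  by rewrite rmorphB rmorphM rmorph1 rmorph_nat.
rewrite /gamma; case: eqP => n2'.
  have := key p po; rewrite !perpe// /kron eqxx !mulr1 cE.
  have -> : 1 + (1 - 2 * y)%:C%C = (2 - 2 * y)%:C%C :> C.
    by rewrite -[X in X + _](rmorph1 (real_complex R)) -rmorphD; congr (_%:C%C); ring.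
  by rewrite -rmorphM ler0c pmulr_rge0//; lra.
have n3 : (2 < n)%N by lia.
(* for [n >= 3] there are two orthogonal transverse directions [e p] and [e q] *)
pose q := Ordinal n3.
have := key q isT; rewrite !perpe// /kron !eqxx /= mulr0 !mulr1 add0r cE -rmorphM ler0c.
by rewrite pmulr_rge0//; lra.
Qed.

End GriffithsCriterion.

(** * The flow in terms of the metric and its derivatives *)

Section FlowPolynomial.
Context {R : realType} {n : nat}.
Notation C := R[i].
Variables (W : 'I_n -> 'I_n -> C) (P : 'I_n -> 'I_n -> 'I_n -> C).

(** In a holomorphic frame the lowered Chern symbols are [P k i m = d_k g_im], and
    with [W] the inverse metric all the terms of the flow except its principal part
    are polynomials in [W] and [P]: [tors] is the torsion, [sq] the quadratic part of the
    curvature trace, and [q1], ..., [q4] are the torsion terms. *)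
Definition tors i k m : C := P i k m - P k i m.
Definition sq i j : C := \sum_k \sum_l W k l * \sum_D \sum_m P k i m * W D m * (P l j D)^*.
Definition q1 i j : C := \sum_k \sum_l \sum_m \sum_p
  W k l * W m p * tors i k p * (tors j l m)^*.
Definition q2 i j : C := \sum_k \sum_l \sum_m \sum_p
  W k l * W m p * tors k m j * (tors l p i)^*.
Definition q3 i j : C := \sum_k \sum_l \sum_m \sum_p
  W k l * W m p * tors i k l * (tors j p m)^*.
Definition q4 i j : C := 2^-1 * \sum_k \sum_l \sum_m \sum_p
  W k l * W m p * (tors m k l * (tors p j i)^* + tors m i j * (tors p l k)^*).
Definition lower_rhs (a b c d : R) i j : C :=
  - sq i j + a%:C%C * q1 i j + b%:C%C * q2 i j + c%:C%C * q3 i j + d%:C%C * q4 i j.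

End FlowPolynomial.

Section ChernConnection.
Context {R : realType} {n : nat}.
Notation C := R[i].
Notation pt := 'rV[C]_n.
Implicit Types (A B D : idx n) (z : pt).

Lemma CkC_det k m (M : pt -> 'M[C]_m) : (forall i j, CkC k (fun z => M z i j)) ->
  CkC k (fun z => \det (M z)).
Proof.
move=> HM; apply: CkC_sum => s; apply: CkCM; first exact: CkC_cst.
by apply: CkC_prod => i; exact: HM.
Qed.

(** The entries of the inverse are quotients of polynomials in the entries, by the
    cofactor formula. *)
Lemma CkC_invmx k (M : pt -> 'M[C]_n) : (forall z, z != 0 -> M z \in unitmx) ->
  (forall i j, CkC k (fun z => M z i j)) ->
  forall i j, CkC k (fun z => invmx (M z) i j).
Proof.
move=> Mu HM i j.
apply: (@eq_CkC _ _ _ (fun z => (\det (M z))^-1 *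
    ((-1) ^+ (j + i) * \det (row' j (col' i (M z)))))).
  by move=> z z0; rewrite /invmx Mu// !mxE.
apply: CkCM.
  by apply: CkCV (CkC_det HM) => z /Mu; rewrite unitmxE unitfE.
apply: CkCM; first exact: CkC_cst.
apply: CkC_det => p q; apply: eq_CkC (HM (lift j p) (lift i q)) => z _.
by rewrite !mxE.
Qed.

Variables (g : metric R n) (Gam : connection R n).
Hypothesis gC2 : forall i j, CkC 2 (fun z => g z i j).
Hypothesis gu : forall z, z != 0 -> g z \in unitmx.
Hypothesis gh : forall z, z != 0 -> forall i j, g z j i = (g z i j)^*.
Hypothesis gCh : is_chern g Gam.

Notation DP z := (fun k i j => dz k (fun w => g w i j) z).

Let gH := gCh.1.
Let Gt z (z0 : z != 0) A B D := @hermitian_connection_type _ _ _ _ z A B D gH z0.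

Lemma chern_mixed0 z (l i D : 'I_n) : z != 0 -> Gam z (inr l) (inl i) (inl D) = 0.
Proof.
move=> z0; have /eqP := gCh.2 z z0 i l (inl D); rewrite /torsion subr_eq0 => /eqP <-.
by rewrite (Gt z0).
Qed.

(** The torsion has no mixed part, so the compatibility with the metric has a single
    surviving term. *)
Lemma chern_low z k i j : z != 0 ->
  \sum_l Gam z (inl k) (inl i) (inl l) * g z l j = dz k (fun w => g w i j) z.
Proof.
move=> z0; rewrite -[RHS]/(dfr (inl k) _ z) (compatE (inl k) i j gH z0).
rewrite [X in _ = _ + X]big1 ?addr0// => l _.
have /eqP := gCh.2 z z0 k j (inr l); rewrite /torsion subr_eq0 => /eqP ->.
by rewrite (Gt z0)// mul0r.
Qed.

Lemma ginv_mul z k m : z != 0 -> \sum_l ginv g z k l * g z m l = (m == k)%:R.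
Proof.
move=> z0; have := mulmxV (gu z0) => /matrixP/(_ m k); rewrite !mxE => <-.
by apply: eq_bigr => l _; rewrite mulrC.
Qed.

Lemma chern_Gam z (k i D : 'I_n) : z != 0 ->
  Gam z (inl k) (inl i) (inl D) = \sum_m DP z k i m * ginv g z D m.
Proof.
move=> z0; under eq_bigr => m _.
  rewrite -(chern_low k i m z0) mulr_suml.
  under eq_bigr do rewrite -mulrA [g z _ m * _]mulrC.
  over.
rewrite exchange_big /=; under eq_bigr do rewrite -mulr_sumr ginv_mul//.
rewrite (bigD1 D)//= eqxx mulr1 big1 ?addr0// => l lD.
by rewrite (negbTE lD) mulr0.
Qed.

Lemma CkC_chern (k i D : 'I_n) : CkC 1 (fun w => Gam w (inl k) (inl i) (inl D)).
Proof.
apply: (@eq_CkC _ _ _ (fun w => \sum_m DP w k i m * ginv g w D m)).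
  by move=> w w0; rewrite chern_Gam.
apply: CkC_sum => m; apply: CkCM.
  by apply: (CkC_dfr (inl k)); exact: gC2.
by apply: CkC_invmx => // p q; exact/CkCW/gC2.
Qed.

Lemma conj_dz z k i j : z != 0 -> (dz k (fun w => g w i j) z)^* = dzbar k (fun w => g w j i) z.
Proof.
move=> z0; rewrite -[RHS]/(dfr (inr k) _ z) (eq_dfr (inr k) (g := fun w => (g w i j)^*) _ z0).
  by rewrite dfr_conj//; exact/CkCW/CkCW/gC2.
by move=> w w0; rewrite gh.
Qed.

(** Differentiating [chern_low] once more, with the symbols expressed by
    [chern_Gam]. *)
Lemma chern_Omega z k l i j : z != 0 ->
  Omega g Gam z (inl k) (inr l) (inl i) (inr j) =
  (\sum_D \sum_m DP z k i m * ginv g z D m * (DP z l j D)^*)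
   - dzbar l (fun w => dz k (fun u => g u i j) w) z.
Proof.
move=> z0; rewrite /Omega low_inr.
have E (D : 'I_n) : curv Gam z (inl k) (inr l) (inl i) (inl D) =
    - dfr (inr l) (fun w => Gam w (inl k) (inl i) (inl D)) z.
  rewrite /curv sum_idx /= !big1 ?addr0; last first.
  - by move=> q _; rewrite !chern_mixed0// mul0r mulr0 subrr.
  - move=> q _; have Z A : Gam z A (inl i) (inr q) = 0 by apply: (Gt z0).
    by rewrite !Z !mul0r subrr.
  rewrite -[dz k _ z]/(dfr (inl k) _ z) (eq_dfr (inl k) (g := fun=> 0) _ z0).
    by rewrite dfr_cst sub0r.
  by move=> w w0; rewrite chern_mixed0.
under eq_bigr do rewrite E.
have -> : dzbar l (fun w => dz k (fun u => g u i j) w) z =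
   dfr (inr l) (fun w => \sum_D Gam w (inl k) (inl i) (inl D) * g w D j) z.
  by apply: (eq_dfr (inr l) _ z0) => w w0; rewrite chern_low.
have gC0 p q : CkC 0 (fun w => g w p q) by exact/CkCW/CkCW/gC2.
have GC0 (D : 'I_n) : CkC 0 (fun w => Gam w (inl k) (inl i) (inl D)) by exact/CkCW/CkC_chern.
rewrite dfr_sum//; last by move=> D; apply: CkCM.
under [X in _ = _ - X]eq_bigr do rewrite dfrM//.
rewrite big_split /=.
have -> : \sum_D \sum_m DP z k i m * ginv g z D m * (DP z l j D)^* =
    \sum_D Gam z (inl k) (inl i) (inl D) * dzbar l (fun w => g w D j) z.
  by apply: eq_bigr => D _; rewrite -mulr_suml -chern_Gam// conj_dz.
rewrite opprD addrCA subrr addr0 -sumrN.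
by apply: eq_bigr => D _; rewrite mulNr.
Qed.

(** The principal part and the lower order terms: this form no longer mentions a
    connection. *)
Definition hcf_rhs (a b c d : R) z i j : C :=
  (\sum_k \sum_l ginv g z k l * dzbar l (fun w => dz k (fun u => g u i j) w) z)
  + lower_rhs (ginv g z) (DP z) a b c d i j.

Lemma chern_Tlow z i k m : z != 0 -> Tlow g Gam z i k m = tors (DP z) i k m.
Proof.
move=> z0; rewrite /Tlow /torsion_low low_inr /torsion /tors.
by under eq_bigr do rewrite mulrBl; rewrite sumrB !chern_low.
Qed.

Lemma chern_rhs a b c d z i j : z != 0 ->
  - Scurv g Gam z i j + a%:C%C * Q1 g Gam z i j + b%:C%C * Q2 g Gam z i j
          + c%:C%C * Q3 g Gam z i j + d%:C%C * Q4 g Gam z i j = hcf_rhs a b c d z i j.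
Proof.
move=> z0; rewrite /hcf_rhs /lower_rhs !addrA; congr (_ + _ * _ + _ * _ + _ * _ + _ * _).
- rewrite /Scurv /sq -!sumrN -big_split; apply: eq_bigr => k _.
  rewrite /= -!sumrN -big_split; apply: eq_bigr => l _.
  by rewrite chern_Omega// mulrBr opprB.
- by do 4 (apply: eq_bigr => ? _); rewrite /Tlowbar !chern_Tlow.
- by do 4 (apply: eq_bigr => ? _); rewrite /Tlowbar !chern_Tlow.
- by do 4 (apply: eq_bigr => ? _); rewrite /Tlowbar !chern_Tlow.
congr (_ * _).
by do 4 (apply: eq_bigr => ? _); rewrite /Tlowbar !chern_Tlow.
Qed.

End ChernConnection.

(** * Contractions of radial tensors *)

Section Contractions.
Context {R : realType} {n : nat}.
Notation C := R[i].
Variables (W : 'I_n -> 'I_n -> C) (u z : 'I_n -> C) (om ro tr tr2 t p1 p2 p3 : C).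
Hypotheses (Wu : forall l, \sum_k W k l * u k = om * u l)
  (Wz : forall k, \sum_l W k l * z l = om * z k)
  (uz : \sum_k z k * u k = ro) (Wtr : \sum_k W k k = tr)
  (Wtr2 : \sum_k \sum_l W k l * W l k = tr2).

Notation Wc F := (\sum_k \sum_l W k l * F k l).

(** The torsion of a Hopf metric has the shape [kron i p * x - kron k p * y], so
    contracting an index of it merely selects two entries. *)
Lemma sel2 (F : 'I_n -> C) i k x y :
  \sum_p F p * (kron i p * x - kron k p * y) = F i * x - F k * y.
Proof.
rewrite -(sum_kron i F) -(sum_kron k F) !mulr_suml -sumrB.
by apply: eq_bigr => p _; move: (kron i p) (kron k p) (F p) => *; ring.
Qed.

Lemma Wc_comb4 c1 c2 c3 c4 (F1 F2 F3 F4 : 'I_n -> 'I_n -> C) :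
  Wc (fun k l => c1 * F1 k l + c2 * F2 k l + c3 * F3 k l + c4 * F4 k l) =
  c1 * Wc F1 + c2 * Wc F2 + c3 * Wc F3 + c4 * Wc F4.
Proof.
rewrite !mulr_sumr -!big_split; apply: eq_bigr => k _ /=.
rewrite !mulr_sumr -!big_split; apply: eq_bigr => l _ /=.
by move: (W k l) (F1 k l) (F2 k l) (F3 k l) (F4 k l) => *; ring.
Qed.

Lemma Wc_z (F : 'I_n -> C) : Wc (fun k l => F k * z l) = om * \sum_k F k * z k.
Proof.
rewrite mulr_sumr; apply: eq_bigr => k _.
under eq_bigr do rewrite mulrCA.
by rewrite -mulr_sumr Wz mulrCA.
Qed.

Lemma Wc_u (F : 'I_n -> C) : Wc (fun k l => u k * F l) = om * \sum_k u k * F k.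
Proof.
rewrite exchange_big mulr_sumr; apply: eq_bigr => l _ /=.
under eq_bigr do rewrite mulrA.
by rewrite -mulr_suml Wu mulrA.
Qed.

Lemma Wc_uz : Wc (fun k l => u k * z l) = om * ro.
Proof. by rewrite Wc_z -uz; congr (_ * _); apply: eq_bigr => k _; rewrite mulrC. Qed.

Lemma Wc_kron : Wc (fun k l => kron k l) = tr.
Proof.
rewrite -Wtr; apply: eq_bigr => k _; under eq_bigr do rewrite mulrC.
exact: sum_kron.
Qed.

Lemma Wc_kron2 i j : Wc (fun k l => kron k j * kron l i) = W j i.
Proof.
under eq_bigr => k _.
  under eq_bigr do rewrite mulrC -mulrA mulrC -mulrA.
  rewrite sum_kronr.
  over.
by under eq_bigr do rewrite mulrC; rewrite sum_kronr.
Qed.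

Lemma Wc_kronl i (F : 'I_n -> C) : Wc (fun k l => kron l i * F k) = \sum_k W k i * F k.
Proof.
apply: eq_bigr => k _; under eq_bigr do rewrite mulrCA.
by rewrite sum_kronr.
Qed.

Lemma Wc_kronk j (F : 'I_n -> C) : Wc (fun k l => kron k j * F l) = \sum_l W j l * F l.
Proof.
rewrite exchange_big; apply: eq_bigr => l _ /=; under eq_bigr do rewrite mulrCA.
by rewrite sum_kronr.
Qed.

Lemma exchange_pairs (F : 'I_n -> 'I_n -> 'I_n -> 'I_n -> C) :
  \sum_k \sum_l \sum_m \sum_p F k l m p = \sum_m \sum_p \sum_k \sum_l F k l m p.
Proof.
transitivity (\sum_k \sum_m \sum_p \sum_l F k l m p).
  apply: eq_bigr => k _; rewrite exchange_big; apply: eq_bigr => m _.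
  exact: exchange_big.
by rewrite exchange_big; apply: eq_bigr => m _; rewrite exchange_big.
Qed.

Variable P : 'I_n -> 'I_n -> 'I_n -> C.
Hypothesis TE : forall i k m, tors P i k m = t * (kron i m * u k - kron k m * u i).
Hypothesis TcE : forall i k m, (tors P i k m)^* = t * (kron i m * z k - kron k m * z i).

Lemma q1_hopf i j : q1 W P i j =
  t ^+ 2 * (om * ro * W j i - 2 * om ^+ 2 * (z j * u i) + tr2 * (z j * u i)).
Proof.
have inner k l : \sum_m \sum_p W k l * W m p * tors P i k p * (tors P j l m)^* =
   W k l * (t ^+ 2 * W j i * (u k * z l) + (- (t ^+ 2 * u i)) * (W j k * z l) +
     (- (t ^+ 2 * z j)) * (u k * W l i) + (t ^+ 2 * u i * z j) * W l k).
  transitivity (W k l * t ^+ 2 * \sum_m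
     (\sum_p W m p * (kron i p * u k - kron k p * u i)) * (kron j m * z l - kron l m * z j)).
    rewrite mulr_sumr; apply: eq_bigr => m _; rewrite mulr_suml mulr_sumr.
    by apply: eq_bigr => p _; rewrite TE TcE; ring.
  under eq_bigr do rewrite sel2.
  by rewrite (sel2 (fun m => W m i * u k - W m k * u i)); ring.
rewrite /q1; under eq_bigr do under eq_bigr do rewrite inner.
rewrite (Wc_comb4 _ _ _ _ (fun k l => u k * z l) (fun k l => W j k * z l)
  (fun k l => u k * W l i) (fun k l => W l k)) Wc_uz Wc_z Wc_u Wz Wtr2.
by under eq_bigr do rewrite mulrC; rewrite Wu; ring.
Qed.

Lemma q2_hopf i j : q2 W P i j =
  2 * t ^+ 2 * (om * ro * W j i - om ^+ 2 * (z j * u i)).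
Proof.
have inner k l : \sum_m \sum_p W k l * W m p * tors P k m j * (tors P l p i)^* =
   W k l * (t ^+ 2 * om * ro * (kron k j * kron l i) + (- (t ^+ 2 * om * u i)) * (kron k j * z l) +
     (- (t ^+ 2 * om * z j)) * (kron l i * u k) + (t ^+ 2 * W j i) * (u k * z l)).
  transitivity (W k l * t ^+ 2 * \sum_m (kron k j * u m - kron m j * u k) *
     (kron l i * (\sum_p W m p * z p) - (\sum_p kron p i * W m p) * z l)).
    rewrite mulr_sumr; apply: eq_bigr => m _.
    rewrite mulr_suml [kron l i * _]mulr_sumr -sumrB 2!mulr_sumr.
    by apply: eq_bigr => p _; rewrite TE TcE; ring.
  under eq_bigr do rewrite Wz sum_kronr.
  transitivity (W k l * t ^+ 2 * (kron k j * (kron l i * om * (\sum_m z m * u m) -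
     z l * (\sum_m W m i * u m)) -
      u k * (kron l i * om * (\sum_m kron m j * z m) - z l * (\sum_m kron m j * W m i)))).
    congr (_ * _); rewrite !mulr_sumr -!sumrB !mulr_sumr -sumrB.
    by apply: eq_bigr => m _; move: (W m i) (kron m j) (kron k j) (kron l i) => *; ring.
  by rewrite uz Wu !sum_kronr; ring.
rewrite /q2; under eq_bigr do under eq_bigr do rewrite inner.
rewrite (Wc_comb4 _ _ _ _ (fun k l => kron k j * kron l i) (fun k l => kron k j * z l)
  (fun k l => kron l i * u k) (fun k l => u k * z l)) Wc_uz Wc_kron2 (Wc_kronk j z) (Wc_kronl i u).
by rewrite Wu Wz; ring.
Qed.

Lemma WcT i : Wc (fun k l => tors P i k l) = t * (om - tr) * u i.
Proof.
transitivity (Wc (fun k l => t * (kron l i * u k) + (- (t * u i)) * kron k l + 0 * 0 + 0 * 0)).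
  apply: eq_bigr => k _; apply: eq_bigr => l _; rewrite TE (kronC i l).
  by congr (_ * _); ring.
rewrite (Wc_comb4 _ _ _ _ (fun k l => kron l i * u k) (fun k l => kron k l)
  (fun k l => 0) (fun k l => 0)) (Wc_kronl i u) Wc_kron Wu.
by ring.
Qed.

Lemma WcTc j : Wc (fun m p => (tors P j p m)^*) = t * (om - tr) * z j.
Proof.
transitivity (Wc (fun k l => t * (kron k j * z l) + (- (t * z j)) * kron k l + 0 * 0 + 0 * 0)).
  apply: eq_bigr => k _; apply: eq_bigr => l _; rewrite TcE (kronC j k) (kronC l k).
  by congr (_ * _); ring.
rewrite (Wc_comb4 _ _ _ _ (fun k l => kron k j * z l) (fun k l => kron k l)
  (fun k l => 0) (fun k l => 0)) (Wc_kronk j z) Wc_kron Wz.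
by ring.
Qed.

Lemma q3_hopf i j : q3 W P i j = t ^+ 2 * (om - tr) ^+ 2 * (z j * u i).
Proof.
transitivity (Wc (fun k l => tors P i k l) * Wc (fun m p => (tors P j p m)^*)).
  rewrite mulr_suml; apply: eq_bigr => k _; rewrite mulr_suml; apply: eq_bigr => l _.
  rewrite mulr_sumr; apply: eq_bigr => m _; rewrite mulr_sumr; apply: eq_bigr => p _.
  by ring.
by rewrite WcT WcTc; ring.
Qed.

Lemma q4_hopf i j : q4 W P i j = t ^+ 2 * (om - tr) * om * (z j * u i - ro * kron i j).
Proof.
transitivity (2^-1 * (Wc (fun m p => Wc (fun k l => tors P m k l) * (tors P p j i)^*)
    + Wc (fun m p => Wc (fun k l => (tors P p l k)^*) * tors P m i j))).
  rewrite /q4 exchange_pairs -big_split; congr (_ * _); apply: eq_bigr => m _ /=.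
  rewrite -big_split; apply: eq_bigr => p _ /=.
  rewrite -mulrDr !mulr_suml -big_split mulr_sumr; apply: eq_bigr => k _ /=.
  rewrite !mulr_suml -big_split mulr_sumr; apply: eq_bigr => l _ /=.
  by ring.
have -> : Wc (fun m p => Wc (fun k l => tors P m k l) * (tors P p j i)^*) =
    t ^+ 2 * (om - tr) * om * (z j * u i - ro * kron i j).
  transitivity (Wc (fun m p => t ^+ 2 * (om - tr) * z j * (kron p i * u m) +
      (- (t ^+ 2 * (om - tr) * kron i j)) * (u m * z p) + 0 * 0 + 0 * 0)).
    apply: eq_bigr => m _; apply: eq_bigr => p _; congr (_ * _).
    by rewrite WcT TcE (kronC j i); ring.
  rewrite (Wc_comb4 _ _ _ _ (fun k l => kron l i * u k) (fun k l => u k * z l)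
    (fun k l => 0) (fun k l => 0)) (Wc_kronl i u) Wc_uz Wu.
  by ring.
have -> : Wc (fun m p => Wc (fun k l => (tors P p l k)^*) * tors P m i j) =
    t ^+ 2 * (om - tr) * om * (z j * u i - ro * kron i j).
  transitivity (Wc (fun m p => t ^+ 2 * (om - tr) * u i * (kron m j * z p) +
      (- (t ^+ 2 * (om - tr) * kron i j)) * (u m * z p) + 0 * 0 + 0 * 0)).
    apply: eq_bigr => m _; apply: eq_bigr => p _; congr (_ * _).
    by rewrite WcTc TE; ring.
  rewrite (Wc_comb4 _ _ _ _ (fun k l => kron k j * z l) (fun k l => u k * z l)
    (fun k l => 0) (fun k l => 0)) (Wc_kronk j z) Wc_uz Wz.
  by ring.
by field.
Qed.

Hypothesis PE : forall k i m, P k i m =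
  p1 * (kron i m * u k) + p2 * (u i * kron k m) + p3 * (u i * u k * z m).
Hypothesis PcE : forall k i m, (P k i m)^* =
  p1 * (kron i m * z k) + p2 * (z i * kron k m) + p3 * (z i * z k * u m).

(** The same contractions for the derivatives of the metric, whose third term is
    purely radial. *)
Lemma sq_hopf i j : sq W P i j = p1 ^+ 2 * om * ro * W j i +
  (z j * u i) * (2 * p1 * p2 * om ^+ 2 + p2 ^+ 2 * tr2 + 2 * p3 * (p1 + p2) * om ^+ 2 * ro
    + p3 ^+ 2 * om ^+ 2 * ro ^+ 2).
Proof.
have inner k l : \sum_D \sum_m P k i m * W D m * (P l j D)^* =
   (p1 ^+ 2 * W j i) * (u k * z l) + (p1 * p2 * u i) * (W j k * z l) +
   (p1 * p2 * z j) * (u k * W l i) +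
   1 * (p2 ^+ 2 * u i * z j * W l k +
        z j * u i * om * (2 * p3 * (p1 + p2) + p3 ^+ 2 * ro) * (u k * z l)).
  have Wm D : \sum_m P k i m * W D m =
      p1 * u k * W D i + p2 * u i * W D k + p3 * u i * u k * (om * z D).
    rewrite -Wz -(sum_kron i (W D)) -(sum_kron k (W D)) !mulr_sumr -!big_split /=.
    by apply: eq_bigr => m _; rewrite PE; move: (kron i m) (kron k m) (W D m) => *; ring.
  under eq_bigr do rewrite -mulr_suml Wm PcE.
  transitivity (p1 * z l * \sum_D kron j D * (p1 * u k * W D i + p2 * u i * W D k + p3 * u i * u k * (om * z D))
    + p2 * z j * \sum_D kron l D * (p1 * u k * W D i + p2 * u i * W D k + p3 * u i * u k * (om * z D))
    + p3 * z j * z l * (p1 * u k * (\sum_D W D i * u D) + p2 * u i * (\sum_D W D k * u D)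
       + p3 * u i * u k * om * (\sum_D z D * u D))).
    rewrite !mulr_sumr -!big_split mulr_sumr -!big_split /=; apply: eq_bigr => D _.
    by move: (kron j D) (kron l D) (W D i) (W D k) => *; ring.
  by rewrite !sum_kron !Wu uz; ring.
rewrite /sq; under eq_bigr do under eq_bigr do rewrite inner.
rewrite (Wc_comb4 _ _ _ _ (fun k l => u k * z l) (fun k l => W j k * z l)
  (fun k l => u k * W l i) (fun k l => p2 ^+ 2 * u i * z j * W l k +
        z j * u i * om * (2 * p3 * (p1 + p2) + p3 ^+ 2 * ro) * (u k * z l))).
have -> : Wc (fun k l => p2 ^+ 2 * u i * z j * W l k +
        z j * u i * om * (2 * p3 * (p1 + p2) + p3 ^+ 2 * ro) * (u k * z l)) =
   p2 ^+ 2 * u i * z j * tr2 + z j * u i * om * (2 * p3 * (p1 + p2) + p3 ^+ 2 * ro) * (om * ro).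
  rewrite -Wtr2 -Wc_uz !mulr_sumr -big_split /=; apply: eq_bigr => k _.
  rewrite !mulr_sumr -big_split /=; apply: eq_bigr => l _.
  by move: (W k l) (W l k) => *; ring.
rewrite Wc_uz Wc_z Wc_u Wz.
by under eq_bigr do rewrite mulrC; rewrite Wu; ring.
Qed.

End Contractions.

(** * The flow equation at a Hopf metric *)

Section HopfFlow.
Context {R : realType} {n : nat}.
Notation C := R[i].
Notation pt := 'rV[C]_n.
Variables al y : R.
Notation a := (al%:C%C).
Notation Y := (y%:C%C).
Notation be := (al * (y - 1)).
Notation g := (@hopf_metric R n al be).
Notation r z := ((sqnorm z)^-1).
Hypotheses (al0 : al != 0) (y0 : y != 0).

Let a0 : a != 0 :> C. Proof. by rewrite (inj_eq (@complexI R)). Qed.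
Let Y0 : Y != 0 :> C. Proof. by rewrite (inj_eq (@complexI R)). Qed.

Variable z : pt.
Hypothesis z0 : z != 0.
Notation ro := (sqnorm z).
Let ro0 : ro != 0. Proof. exact: sqnorm_neq0. Qed.

Lemma hopf_unit : g z \in unitmx.
Proof.
suff : g z *m (\matrix_(l, k) hopf_dual al y z k l) = 1%:M by case/mulmx1_unit.
apply/matrixP => m k; rewrite !mxE -[RHS]/(kron m k) kronC -(hopf_inv al0 y0 k m z0).
by apply: eq_bigr => l _; rewrite !mxE mulrC.
Qed.

Lemma hopf_ginv k l : ginv g z k l = hopf_dual al y z k l.
Proof.
have E : g z *m (\matrix_(l, k) hopf_dual al y z k l) = 1%:M.
  apply/matrixP => m q; rewrite !mxE -[RHS]/(kron m q) kronC -(hopf_inv al0 y0 q m z0).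
  by apply: eq_bigr => p _; rewrite !mxE mulrC.
rewrite /ginv -[invmx _]mulmx1 -E mulmxA mulVmx ?hopf_unit//.
by rewrite mul1mx mxE.
Qed.

Notation W := (ginv g z).
Notation u k := ((z 0 k)^*).
Notation om := (ro / (a * Y)).

Lemma hopf_Wu l : \sum_k W k l * u k = om * u l.
Proof.
transitivity (a^-1 * (ro * (\sum_k kron k l * u k) + (Y^-1 - 1) * u l * (\sum_k z 0 k * u k))).
  under eq_bigr do rewrite hopf_ginv /hopf_dual.
  move: ro => s; rewrite !mulr_sumr -big_split mulr_sumr /=; apply: eq_bigr => k _.
  by move: (kron k l) (a^-1) (Y^-1) => *; ring.
rewrite sum_kronr -/(sqnorm z); move: a0 Y0; move: ro a Y => s b e b0 e0.
by field; rewrite b0 e0.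
Qed.

Lemma hopf_Wz k : \sum_l W k l * z 0 l = om * z 0 k.
Proof.
transitivity (a^-1 * (ro * (\sum_l kron k l * z 0 l) + (Y^-1 - 1) * z 0 k * (\sum_l z 0 l * u l))).
  under eq_bigr do rewrite hopf_ginv /hopf_dual.
  move: ro => s; rewrite !mulr_sumr -big_split mulr_sumr /=; apply: eq_bigr => l _.
  by move: (kron k l) (a^-1) (Y^-1) => *; ring.
rewrite sum_kron -/(sqnorm z); move: a0 Y0; move: ro a Y => s b e b0 e0.
by field; rewrite b0 e0.
Qed.

Notation tr := (ro / a * (n%:R - 1 + Y^-1)).
Notation tr2 := ((ro / a) ^+ 2 * (n%:R - 1 + Y^-2)).

Lemma hopf_Wtr : \sum_k W k k = tr.
Proof.
transitivity (a^-1 * (ro * n%:R + (Y^-1 - 1) * (\sum_k z 0 k * u k))).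
  under eq_bigr do rewrite hopf_ginv /hopf_dual /kron eqxx.
  have -> : n%:R = \sum_(k < n) 1 :> C by rewrite sumr_const card_ord.
  move: ro => s; rewrite !mulr_sumr -big_split mulr_sumr /=; apply: eq_bigr => k _.
  by move: (a^-1) (Y^-1) => *; ring.
rewrite -/(sqnorm z); move: a0 Y0; move: ro a Y (n%:R) => s b e N b0 e0.
by field; rewrite b0 e0.
Qed.

Lemma hopf_Wtr2 : \sum_k \sum_l W k l * W l k = tr2.
Proof.
transitivity (a^-1 * (ro * (\sum_k W k k) + (Y^-1 - 1) * om * (\sum_k z 0 k * u k))).
  transitivity (\sum_k a^-1 * (ro * (\sum_l kron k l * W l k) + (Y^-1 - 1) * z 0 k * (\sum_l W l k * u l))).
    apply: eq_bigr => k _; under eq_bigr do rewrite {1}hopf_ginv /hopf_dual.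
    move: ro => s; rewrite !mulr_sumr -big_split mulr_sumr /=; apply: eq_bigr => l _.
    by move: (kron k l) (W l k) (a^-1) (Y^-1) => *; ring.
  under eq_bigr do rewrite sum_kron hopf_Wu.
  move: ro => s; rewrite !mulr_sumr -big_split mulr_sumr /=; apply: eq_bigr => k _.
  by move: (W k k) (a^-1) (Y^-1) ((a * Y)^-1) => *; ring.
rewrite hopf_Wtr -/(sqnorm z); move: a0 Y0; move: ro a Y (n%:R) => s b e N b0 e0.
by field; rewrite b0 e0.
Qed.

Notation DP := (fun k i j => dz k (fun w => g w i j) z).
Notation rr := (r z).
Notation p1 := (- a * (rr * rr)).
Notation p2 := (a * (Y - 1) * (rr * rr)).
Notation p3 := (- 2 * a * (Y - 1) * (rr * (rr * rr))).

Lemma hopf_DP (w : pt) k i m : w != 0 -> dz k (fun q => g q i m) w =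
  (- a * kron i m) * ((w 0 k)^* * (r w * r w)) +
  (a * (Y - 1) * kron k m) * ((w 0 i)^* * (r w * r w)) +
  (- 2 * a * (Y - 1)) * ((w 0 i)^* * (w 0 k)^* * w 0 m * (r w * (r w * r w))).
Proof.
move=> w0; rewrite -[LHS]/(dfr (inl k) _ w) (is_dfr_val (is_dfr_hopf w0 (inl k) al be i m)) beE /=.
by rewrite -/(kron k m); move: (kron i m) (kron k m) (r w) => *; ring.
Qed.

Lemma hopf_P k i m : DP k i m =
  p1 * (kron i m * u k) + p2 * (u i * kron k m) + p3 * (u i * u k * z 0 m).
Proof. by rewrite -[LHS]/(dz k (fun q => g q i m) z) hopf_DP//; move: (kron i m) (kron k m) rr => *; ring. Qed.

Lemma hopf_Pc k i m : (DP k i m)^* =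
  p1 * (kron i m * z 0 k) + p2 * (z 0 i * kron k m) + p3 * (z 0 i * z 0 k * u m).
Proof.
have cR (x : R) : (x%:C%C)^* = x%:C%C :> C by rewrite conjCE /= oppr0.
have rc : rr^* = rr by rewrite fmorphV /= conj_sqnorm.
have kc i' j' : (kron i' j' : C)^* = kron i' j' by rewrite /kron conjC_nat.
rewrite hopf_P; move: (r z) rc => s rc.
by rewrite !(rmorphD, rmorphM, rmorphN, rmorphB) /= !cR !rc !kc !conjCK ?rmorph1 ?conjC_nat.
Qed.

Notation t := (a * Y * (rr * rr)).

Lemma hopf_T i k m : tors DP i k m = t * (kron i m * u k - kron k m * u i).
Proof. by rewrite /tors !hopf_P; move: (kron k m) (kron i m) rr => *; ring. Qed.

Lemma hopf_Tc i k m : (tors DP i k m)^* = t * (kron i m * z 0 k - kron k m * z 0 i).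
Proof. by rewrite /tors rmorphB /= !hopf_Pc; move: (kron k m) (kron i m) rr => *; ring. Qed.

Lemma hopf_H l k i j : dzbar l (fun w => dz k (fun q => g q i j) w) z =
  (- a * kron i j * (rr * rr)) * kron k l + (a * (Y - 1) * (rr * rr)) * (kron k j * kron l i) +
  ((- 2 * rr * (rr * rr)) * (- a * kron i j) * (u k * z 0 l) +
   (- 2 * rr * (rr * rr)) * (a * (Y - 1) * u i) * (kron k j * z 0 l) +
   (- 2 * a * (Y - 1) * z 0 j * (rr * (rr * rr))) * (kron l i * u k) +
   (- 2 * a * (Y - 1) * z 0 j * (rr * (rr * rr)) * u i) * kron k l) +
  (6 * a * (Y - 1) * u i * z 0 j * (rr * (rr * rr) * rr)) * (u k * z 0 l).
Proof.
rewrite -[LHS]/(dfr (inr l) _ z) (eq_dfr (inr l) (fun w w0 => hopf_DP k i j w0) z0).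
have dr := is_dfr_isqnorm z0 (inr l); have c := is_dfr_cst z (inr l).
have du := is_dfr_ccoord z0 (inr l); have dv := is_dfr_coord z (inr l).
have drr := is_dfrM z0 dr dr.
rewrite (is_dfr_val (is_dfrD z0 (is_dfrD z0
  (is_dfrZ z0 (- a * kron i j) (is_dfrM z0 (du k) drr))
  (is_dfrZ z0 (a * (Y - 1) * kron k j) (is_dfrM z0 (du i) drr)))
  (is_dfrZ z0 (- 2 * a * (Y - 1)) (is_dfrM z0 (is_dfrM z0 (is_dfrM z0 (du i) (du k)) (dv j))
     (is_dfrM z0 dr drr))))) /=.
rewrite -/(kron l k) -/(kron l i) (kronC l k).
by move: (kron i j) (kron k l) (kron l i) (kron k j) rr => *; ring.
Qed.

(** The principal part of the flow, a contraction of [hopf_H] term by term. *)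
Lemma hopf_trH i j :
  \sum_k \sum_l W k l * dzbar l (fun w => dz k (fun q => g q i j) w) z =
  (- a * kron i j * (rr * rr)) * tr + (a * (Y - 1) * (rr * rr)) * W j i +
  ((- 2 * rr * (rr * rr)) * (- a * kron i j) * (om * ro) +
   (- 2 * rr * (rr * rr)) * (a * (Y - 1) * u i) * (om * z 0 j) +
   (- 2 * a * (Y - 1) * z 0 j * (rr * (rr * rr))) * (om * u i) +
   (- 2 * a * (Y - 1) * z 0 j * (rr * (rr * rr)) * u i) * tr) +
  (6 * a * (Y - 1) * u i * z 0 j * (rr * (rr * rr) * rr)) * (om * ro).
Proof.
transitivity (\sum_k \sum_l W k l * ((- a * kron i j * (rr * rr)) * kron k l +
  (a * (Y - 1) * (rr * rr)) * (kron k j * kron l i) +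
  1 * ((- 2 * rr * (rr * rr)) * (- a * kron i j) * (u k * z 0 l) +
   (- 2 * rr * (rr * rr)) * (a * (Y - 1) * u i) * (kron k j * z 0 l) +
   (- 2 * a * (Y - 1) * z 0 j * (rr * (rr * rr))) * (kron l i * u k) +
   (- 2 * a * (Y - 1) * z 0 j * (rr * (rr * rr)) * u i) * kron k l) +
  (6 * a * (Y - 1) * u i * z 0 j * (rr * (rr * rr) * rr)) * (u k * z 0 l))).
  by apply: eq_bigr => k _; apply: eq_bigr => l _; rewrite hopf_H mul1r.
have uz : \sum_k z 0 k * u k = ro by [].
rewrite (Wc_comb4 _ _ _ _ _ (fun k l => kron k l) (fun k l => kron k j * kron l i)
   (fun k l => (- 2 * rr * (rr * rr)) * (- a * kron i j) * (u k * z 0 l) +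
   (- 2 * rr * (rr * rr)) * (a * (Y - 1) * u i) * (kron k j * z 0 l) +
   (- 2 * a * (Y - 1) * z 0 j * (rr * (rr * rr))) * (kron l i * u k) +
   (- 2 * a * (Y - 1) * z 0 j * (rr * (rr * rr)) * u i) * kron k l) (fun k l => u k * z 0 l)).
rewrite (Wc_comb4 _ _ _ _ _ (fun k l => u k * z 0 l) (fun k l => kron k j * z 0 l)
   (fun k l => kron l i * u k) (fun k l => kron k l)).
rewrite (Wc_kron hopf_Wtr) Wc_kron2 (Wc_uz hopf_Wz uz).
rewrite (Wc_kronk _ j (fun l => z 0 l)) (Wc_kronl _ i (fun k => u k)) hopf_Wu hopf_Wz.
by rewrite mul1r.
Qed.

(** The right-hand side of the flow at a Hopf metric is again a combination of
    the same two tensors, with coefficients depending on y only. *)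
Lemma hopf_rhs (ca cb cc cd : R) i j : hcf_rhs g ca cb cc cd z i j =
  rr * ((- n%:R + (1 + ca + 2 * cb + (n%:R - 1) * cd) * y)%:C%C * perp z i j
   + ((n%:R - 1) * (ca - 1 + (n%:R - 1) * cc) * y ^+ 2)%:C%C * (u i * z 0 j * rr)).
Proof.
have uz : \sum_k z 0 k * u k = ro by [].
rewrite /hcf_rhs hopf_trH /lower_rhs.
rewrite (sq_hopf hopf_Wu hopf_Wz uz hopf_Wtr2 hopf_P hopf_Pc).
rewrite (q1_hopf hopf_Wu hopf_Wz uz hopf_Wtr2 hopf_T hopf_Tc).
rewrite (q2_hopf hopf_Wu hopf_Wz uz hopf_T hopf_Tc).
rewrite (q3_hopf hopf_Wu hopf_Wz hopf_Wtr hopf_T hopf_Tc).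
rewrite (q4_hopf hopf_Wu hopf_Wz uz hopf_Wtr hopf_T hopf_Tc).
rewrite hopf_ginv /hopf_dual /perp (kronC j i).
have -> : (- n%:R + (1 + ca + 2 * cb + (n%:R - 1) * cd) * y)%:C%C =
    - n%:R + (1 + ca%:C%C + 2 * cb%:C%C + (n%:R - 1) * cd%:C%C) * Y :> C.
  by rewrite !(rmorphD, rmorphN, rmorphM, rmorphB, rmorph1, rmorph_nat).
have -> : ((n%:R - 1) * (ca - 1 + (n%:R - 1) * cc) * y ^+ 2)%:C%C =
    (n%:R - 1) * (ca%:C%C - 1 + (n%:R - 1) * cc%:C%C) * Y ^+ 2 :> C.
  by rewrite !(rmorphD, rmorphN, rmorphM, rmorphB, rmorph1, rmorphXn, rmorph_nat).
move: a0 Y0 ro0; move: ro a Y (n%:R : C) (kron i j) (z 0 j) (u i) (ca%:C%C) (cb%:C%C) (cc%:C%C) (cd%:C%C).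
move=> s al' Y' N K zj ui c1 c2 c3 c4 al'0 Y'0 s0.
by field; rewrite ?s0 ?al'0 ?Y'0.
Qed.

End HopfFlow.

(** * A weighted maximum principle *)

Section WeightedMaximum.
Context {R : realType} {V : normedModType R}.
Variable A : set V.
Hypothesis Aopen : open A.

Lemma derive_bigsum (I : Type) (s : seq I) (F : I -> V -> R) p v :
  (forall i, derivable (F i) p v) ->
  derivable (fun q => \sum_(i <- s) F i q) p v /\
  'D_v (fun q => \sum_(i <- s) F i q) p = \sum_(i <- s) 'D_v (F i) p.
Proof.
move=> dF; elim: s => [|i s [IH1 IH2]].
  have -> : (fun q => \sum_(i <- [::]) F i q) = cst 0 :> (V -> R).
    by apply/funext => q; rewrite big_nil.
  by rewrite big_nil derive_cst; split=> //; exact: derivable_cst.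
have -> : (fun q => \sum_(j <- i :: s) F j q) =
    (F i + (fun q => \sum_(j <- s) F j q)) :> (V -> R).
  by apply/funext => q; rewrite big_cons.
split; first exact: derivableD (dF i) IH1.
by rewrite big_cons (deriveD (dF i) IH1) IH2.
Qed.

Lemma Ck_mul k (f g : V -> R) : Ck A k f -> Ck A k g -> Ck A k (fun q => f q * g q).
Proof. exact: CkM. Qed.

Lemma Ck_bigsum k (I : Type) (s : seq I) (F : I -> V -> R) :
  (forall i, Ck A k (F i)) -> Ck A k (fun q => \sum_(i <- s) F i q).
Proof. by move=> HF; apply: Ck_sum. Qed.

(** Leibniz rules holding at every point of the open set, so that they can be
    differentiated again. *)
Lemma D_mul (f g : V -> R) v : Ck A 0 f -> Ck A 0 g ->
  {in A, 'D_v (fun q => f q * g q) =1 (fun q => f q * 'D_v g q + g q * 'D_v f q)}.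
Proof.
move=> fC gC q /set_mem Aq.
exact: (derive_mul (Ck_derivable fC Aq) (Ck_derivable gC Aq)).
Qed.

Variables (I : finType) (w : V -> R) (h : I -> V -> R).
Hypotheses (wC : Ck A 2 w) (hC : forall i, Ck A 2 (h i)).

Definition sqsum q := \sum_i h i q * h i q.

Lemma D_sqsum v : {in A, 'D_v sqsum =1
  (fun q => \sum_i (h i q * 'D_v (h i) q + h i q * 'D_v (h i) q))}.
Proof.
move=> q Aq; have gap i : derivable (h i) q v := Ck_derivable (hC i) (set_mem Aq).
have [_ ->] := @derive_bigsum I (index_enum I) (fun i q => h i q * h i q) q v
  (fun i => derivableM (gap i) (gap i)).
by apply: eq_bigr => i _; rewrite (D_mul v (CkW (CkW (hC i))) (CkW (CkW (hC i))) Aq).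
Qed.

Lemma DD_sqsum v p : A p -> 'D_v ('D_v sqsum) p =
  \sum_i 2 * (h i p * 'D_v ('D_v (h i)) p + 'D_v (h i) p ^+ 2).
Proof.
move=> Ap; rewrite (eq_on_derive Aopen _ (@D_sqsum v) (mem_set Ap)).
have gap i : derivable (h i) p v := Ck_derivable (hC i) Ap.
have hd1 i : derivable ('D_v (h i)) p v := Ck_derivable (Ck_derive v (hC i)) Ap.
have m i := derivableM (gap i) (hd1 i).
have [_ ->] := @derive_bigsum I (index_enum I)
  (fun i q => h i q * 'D_v (h i) q + h i q * 'D_v (h i) q) p v
  (fun i => derivableD (m i) (m i)).
apply: eq_bigr => i _.
rewrite (derive_add (m i) (m i) (h := fun q => h i q * 'D_v (h i) q + h i q * 'D_v (h i) q))//.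
rewrite (derive_mul (gap i) (hd1 i) (h := h i * 'D_v (h i)))//.
by move: (h i p) ('D_v (h i) p) ('D_v ('D_v (h i)) p) => x y z; ring.
Qed.

(** If [w^2 * sum h_i^2] has a maximum at [p], then the vanishing of its first
    derivative along [v] determines the derivative of [sum h_i^2], and its second
    derivative being nonpositive gives the inequality. *)
Lemma weighted_max p v : A p -> 0 < w p ->
  (forall q, A q -> w q * w q * sqsum q <= w p * w p * sqsum p) ->
  \sum_i (h i p * 'D_v ('D_v (h i)) p + 'D_v (h i) p ^+ 2) <=
  sqsum p * (3 * ('D_v w p / w p) ^+ 2 - 'D_v ('D_v w) p / w p).
Proof.
move=> Ap wp fmax.
have SC : Ck A 2 sqsum by exact: (Ck_bigsum (index_enum I) (fun i => Ck_mul (hC i) (hC i))).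
have wwC : Ck A 2 (fun q => w q * w q) by exact: (Ck_mul wC wC).
pose f q := w q * w q * sqsum q.
have fC : Ck A 2 f by exact: (Ck_mul wwC SC).
have D1 := derive_max_direction Aopen v (CkW (CkW fC)) Ap fmax.
have D2 := derive2_max_direction Aopen v (CkW fC) Ap fmax.
have dw : derivable w p v := Ck_derivable wC Ap.
have dw1 : derivable ('D_v w) p v := Ck_derivable (Ck_derive v wC) Ap.
have dS : derivable sqsum p v := Ck_derivable SC Ap.
have dS1 : derivable ('D_v sqsum) p v := Ck_derivable (Ck_derive v SC) Ap.
pose ww1 q := w q * 'D_v w q + w q * 'D_v w q.
have E1 : {in A, 'D_v f =1 (fun q => w q * w q * 'D_v sqsum q + sqsum q * ww1 q)}.
  move=> q Aq; rewrite (D_mul v (CkW (CkW wwC)) (CkW (CkW SC)) Aq).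
  by rewrite (D_mul v (CkW (CkW wC)) (CkW (CkW wC)) Aq).
have m1 : derivable (w * w) p v := derivableM dw dw.
have m2 : derivable (w * 'D_v w) p v := derivableM dw dw1.
have m3 : derivable ww1 p v := derivableD m2 m2.
have E2 : 'D_v ('D_v f) p = w p * w p * 'D_v ('D_v sqsum) p +
    2 * ('D_v sqsum p * (2 * w p * 'D_v w p)) +
    sqsum p * (2 * ('D_v w p ^+ 2 + w p * 'D_v ('D_v w) p)).
  rewrite (eq_on_derive Aopen v E1 (mem_set Ap)).
  rewrite (derive_mulD m1 dS1 dS m3)//.
  rewrite (derive_mul dw dw (h := w * w))//.
  rewrite (derive_add m2 m2 (h := ww1))// (derive_mul dw dw1 (h := w * 'D_v w))//.
  rewrite /ww1 (_ : (w * w) p = w p * w p)//.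
  move: (w p) ('D_v w p) ('D_v ('D_v w) p) (sqsum p) ('D_v sqsum p) ('D_v ('D_v sqsum) p).
  by move=> *; ring.
move: D1; rewrite (E1 p (mem_set Ap)) /ww1 => D1.
move: D2; rewrite E2 (DD_sqsum v Ap) -mulr_sumr.
set Q := \sum_i _ => D2.
(* the vanishing of the first derivative of the weighted sum determines that of the sum *)
have S1 : 'D_v sqsum p = - 2 * 'D_v w p * sqsum p / w p.
  apply: (mulfI (lt0r_neq0 wp)); apply: (mulfI (lt0r_neq0 wp)).
  apply/eqP; rewrite -subr_eq0; apply/eqP; rewrite -D1.
  by field; exact: lt0r_neq0.
move: D2; rewrite S1.
move: ('D_v w p) ('D_v ('D_v w) p) (sqsum p) Q => w1 w2 s Q D2.
rewrite -(ler_pM2l (mulr_gt0 wp wp)) -subr_le0.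
have e : 0 < 2 :> R by [].
rewrite -(pmulr_rle0 _ e); apply: le_trans D2; rewrite le_eqVlt; apply/orP; left; apply/eqP.
by field; exact: lt0r_neq0.
Qed.

End WeightedMaximum.

(** * The maximum principle for the complex second order operator *)

Section ComplexMaximum.
Context {R : realType} {n : nat}.
Notation C := R[i].
Notation pt := 'rV[C]_n.
Notation rpt := ('rV[R]_n * 'rV[R]_n)%type.
Implicit Types (f g : pt -> C) (z w : pt) (v : rpt).

Definition nsq (c : C) : R := complex.Re c ^+ 2 + complex.Im c ^+ 2.

Lemma nsq_ge0 c : 0 <= nsq c.
Proof. by rewrite addr_ge0 ?sqr_ge0. Qed.

Lemma mul_conj_nsq c : c * c^* = (nsq c)%:C%C.
Proof. by rewrite conjCE /nsq; apply: complex_eq; rewrite ?cReM ?cImM /=; ring. Qed.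

Lemma to_real_i_punctured z : z != 0 -> punctured (to_real z).
Proof. by rewrite /punctured /= to_realK. Qed.

Lemma Re_real_deriv2 v f z : complex.Re (real_deriv v (real_deriv v f) z) =
  'D_v ('D_v (fun p => complex.Re (f (of_real p)))) (to_real z).
Proof. by rewrite /real_deriv /=; apply: derive_ext => p; rewrite of_realK. Qed.

Lemma Im_real_deriv2 v f z : complex.Im (real_deriv v (real_deriv v f) z) =
  'D_v ('D_v (fun p => complex.Im (f (of_real p)))) (to_real z).
Proof. by rewrite /real_deriv /=; apply: derive_ext => p; rewrite of_realK. Qed.

Definition rowi (V : pt) : pt := \row_k ('i%C * V 0 k).

(** With [J V = i V], the terms in [V_k V_l] and in their conjugates cancel in
    [D_V D_V + D_JV D_JV], leaving the Levi form along [V].  The two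
    orders of differentiation are related later by the hermitian symmetry of [h]. *)
Lemma real_deriv_rowi2 (V : pt) f z : CkC 2 f -> z != 0 ->
  real_deriv (to_real V) (real_deriv (to_real V) f) z +
  real_deriv (to_real (rowi V)) (real_deriv (to_real (rowi V)) f) z =
  2 * \sum_k \sum_l V 0 k * (V 0 l)^* *
    (dzbar l (dz k f) z + dz k (dzbar l f) z).
Proof.
move=> fC z0.
have D2 (U : pt) : real_deriv (to_real U) (real_deriv (to_real U) f) z =
    \sum_k \sum_l (U 0 k * U 0 l * dz k (dz l f) z + U 0 k * (U 0 l)^* * dz k (dzbar l f) z
      + ((U 0 k)^* * U 0 l * dzbar k (dz l f) z + (U 0 k)^* * (U 0 l)^* * dzbar k (dzbar l f) z)).
  have fC1 := CkCW fC.
  have dC A : CkC 1 (dfr A f) := CkC_dfr A fC.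
  have H w : w != 0 -> real_deriv (to_real U) f w =
      \sum_k (U 0 k * dz k f w + (U 0 k)^* * dzbar k f w).
    by move=> w0; exact: real_deriv_dfr.
  rewrite (eq_real_deriv _ H z0).
  have sC : CkC 1 (fun w => \sum_k (U 0 k * dz k f w + (U 0 k)^* * dzbar k f w)).
    by apply: CkC_sum => k; apply: CkCD; apply: CkCM; (try exact: CkC_cst);
      [exact: dC (inl k)|exact: dC (inr k)].
  rewrite (real_deriv_dfr U sC z0); apply: eq_bigr => k _.
  have key A : dfr A (fun w => \sum_l (U 0 l * dz l f w + (U 0 l)^* * dzbar l f w)) z =
      \sum_l (U 0 l * dfr A (dz l f) z + (U 0 l)^* * dfr A (dzbar l f) z).
    have t1 l : CkC 0 (fun w => U 0 l * dz l f w).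
      by apply: CkCM (CkCW (dC (inl l))); exact: CkC_cst.
    have t2 l : CkC 0 (fun w => (U 0 l)^* * dzbar l f w).
      by apply: CkCM (CkCW (dC (inr l))); exact: CkC_cst.
    rewrite (dfr_sum A _ _ (fun l => CkCD (t1 l) (t2 l)) z0); apply: eq_bigr => l _.
    rewrite (dfrD A (t1 l) (t2 l) z0).
    by rewrite (dfrZ A _ (CkCW (dC (inl l))) z0) (dfrZ A _ (CkCW (dC (inr l))) z0).
  rewrite -[dz k _ z]/(dfr (inl k) _ z) -[dzbar k _ z]/(dfr (inr k) _ z) !key.
  rewrite !mulr_sumr -big_split; apply: eq_bigr => l _ /=.
  move: (dz k (dz l f) z) (dz k (dzbar l f) z) (dzbar k (dz l f) z) (dzbar k (dzbar l f) z).
  by move=> *; ring.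
have ic : ('i%C : C)^* = - 'i%C by rewrite conjCE; apply: complex_eq; rewrite /= ?oppr0.
have ii : 'i%C * 'i%C = -1 :> C by rewrite -expr2 sqr_i.
pose F k l := V 0 k * (V 0 l)^* * dz k (dzbar l f) z.
pose G k l := V 0 k * (V 0 l)^* * dzbar l (dz k f) z.
transitivity (\sum_k \sum_l (2 * F k l + 2 * G l k)).
  rewrite !D2 -big_split; apply: eq_bigr => k _; rewrite -big_split; apply: eq_bigr => l _.
  rewrite /F /G /= !mxE !rmorphM /= ic.
  move: (dz k (dz l f) z) (dz k (dzbar l f) z) (dzbar k (dz l f) z) (dzbar k (dzbar l f) z).
  move=> d1 d2 d3 d4; move: ('i%C : C) ii => i0 ii.
  move: (V 0 k) (V 0 l) ((V 0 k)^*) ((V 0 l)^*) => p q p' q'.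
  transitivity ((p * q * d1 + p' * q' * d4) * (1 + i0 * i0) +
      (p * q' * d2 + p' * q * d3) * (1 - i0 * i0)); first by ring.
  by rewrite ii; ring.
transitivity (2 * (\sum_k \sum_l F k l + \sum_k \sum_l G k l)).
  rewrite [X in _ + X]exchange_big -big_split mulr_sumr; apply: eq_bigr => k _ /=.
  by rewrite -big_split mulr_sumr; apply: eq_bigr => l _ /=; ring.
congr (_ * _); rewrite -big_split; apply: eq_bigr => k _ /=.
by rewrite -big_split; apply: eq_bigr => l _ /=; rewrite mulrDr addrC.
Qed.

Lemma real_deriv_sqnorm (V : pt) z : z != 0 ->
  real_deriv (to_real V) (@sqnorm R n) z = \sum_k (V 0 k * (z 0 k)^* + (V 0 k)^* * z 0 k).
Proof.
move=> z0; rewrite (real_deriv_dfr V (CkC_sqnorm 1) z0); apply: eq_bigr => k _.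
rewrite -[dz k _ z]/(dfr (inl k) _ z) -[dzbar k _ z]/(dfr (inr k) _ z).
by rewrite !(is_dfr_val (is_dfr_sqnorm z0 _)).
Qed.

Lemma Re_sum (I : finType) (F : I -> C) : complex.Re (\sum_i F i) = \sum_i complex.Re (F i).
Proof. exact: (big_morph _ (@cReD R) (erefl : complex.Re 0 = 0)). Qed.

Definition sqn (z : pt) : R := \sum_k nsq (z 0 k).

Lemma sqn_sqnorm z : sqnorm z = (sqn z)%:C%C.
Proof.
by rewrite /sqnorm /sqn rmorph_sum; apply: eq_bigr => k _; rewrite mul_conj_nsq.
Qed.

Lemma sqn_gt0 z : z != 0 -> 0 < sqn z.
Proof. by move=> /sqnorm_gt0; rewrite sqn_sqnorm -[0]/(0%:C%C) ltcR. Qed.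

(** This is [2 |Re <V, z>| <= |V|^2 + |z|^2]. *)
Lemma real_deriv_sqn_bound (V : pt) z : z != 0 ->
  `|complex.Re (real_deriv (to_real V) (@sqnorm R n) z)| <= sqn V + sqn z.
Proof.
move=> z0; rewrite real_deriv_sqnorm// Re_sum /sqn -big_split /=.
apply: le_trans (ler_norm_sum _ _ _) _; apply: ler_sum => k _.
case: (V 0 k) => a b; case: (z 0 k) => c d; rewrite !conjCE cReD !cReM /nsq /=.
have h1 := sqr_ge0 (a - c); have h2 := sqr_ge0 (b - d).
have h3 := sqr_ge0 (a + c); have h4 := sqr_ge0 (b + d).
by rewrite ler_norml; apply/andP; split; nra.
Qed.

Lemma real_deriv2_sqn (V : pt) z : z != 0 ->
  0 <= complex.Re (real_deriv (to_real V) (real_deriv (to_real V) (@sqnorm R n)) z).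
Proof.
move=> z0; have H w : w != 0 -> real_deriv (to_real V) (@sqnorm R n) w =
    \sum_k (V 0 k * (w 0 k)^* + (V 0 k)^* * w 0 k).
  by move=> w0; exact: real_deriv_sqnorm.
rewrite (eq_real_deriv _ H z0).
have sC : CkC 1 (fun w : pt => \sum_k (V 0 k * (w 0 k)^* + (V 0 k)^* * w 0 k)).
  apply: CkC_sum => k; apply: CkCD; apply: CkCM; try exact: CkC_cst.
    exact/CkC_conj/CkC_coord.
  exact: CkC_coord.
have dA A : dfr A (fun w : pt => \sum_k (V 0 k * (w 0 k)^* + (V 0 k)^* * w 0 k)) z =
   \sum_k (V 0 k * dccoord A k + (V 0 k)^* * dcoord A k).
  have c1 k : CkC 0 (fun w : pt => V 0 k * (w 0 k)^*).
    by apply: CkCM; [exact: CkC_cst|exact/CkC_conj/CkC_coord].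
  have c2 k : CkC 0 (fun w : pt => (V 0 k)^* * w 0 k).
    by apply: CkCM; [exact: CkC_cst|exact/CkC_coord].
  rewrite (dfr_sum A _ _ (fun k => CkCD (c1 k) (c2 k)) z0); apply: eq_bigr => k _.
  by rewrite (is_dfr_val (is_dfrD z0 (is_dfrZ z0 (V 0 k) (is_dfr_ccoord z0 A k))
    (is_dfrZ z0 (V 0 k)^* (is_dfr_coord z A k)))).
rewrite (real_deriv_dfr V sC z0) Re_sum; apply: sumr_ge0 => k _.
rewrite -[dz k _ z]/(dfr (inl k) _ z) -[dzbar k _ z]/(dfr (inr k) _ z) !dA /=.
have s1 : \sum_k0 (V 0 k0 * 0 + (V 0 k0)^* * (k == k0)%:R) = (V 0 k)^*.
  under eq_bigr do rewrite mulr0 add0r mulrC; exact: sum_delta.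
have s2 : \sum_k0 (V 0 k0 * (k == k0)%:R + (V 0 k0)^* * 0) = V 0 k.
  under eq_bigr do rewrite mulr0 addr0 mulrC; exact: sum_delta.
rewrite s1 s2 [(_)^* * _]mulrC mul_conj_nsq -rmorphD /=.
by rewrite addr_ge0 ?nsq_ge0.
Qed.

End ComplexMaximum.

Section OperatorMaximum.
Context {R : realType} {n : nat}.
Notation C := R[i].
Notation pt := 'rV[C]_n.
Notation rpt := ('rV[R]_n * 'rV[R]_n)%type.
Implicit Types (w : pt) (v : rpt).
Variables (h : 'I_n -> 'I_n -> pt -> C).
Hypothesis hC : forall i j, CkC 2 (h i j).
Hypothesis hh : forall z, z != 0 -> forall i j, h j i z = (h i j z)^*.

Definition frob2 z : R := \sum_i \sum_j nsq (h i j z).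

Variable z : pt.
Hypothesis z0 : z != 0.
Hypothesis zmax : forall w, w != 0 -> sqn w * sqn w * frob2 w <= sqn z * sqn z * frob2 z.

Lemma sqn_Re w : sqn w = complex.Re (sqnorm w).
Proof. by rewrite sqn_sqnorm. Qed.

Lemma sum_pairs (F G : 'I_n -> 'I_n -> R) :
  \sum_(x : 'I_n * 'I_n + 'I_n * 'I_n)
     (match x with inl p => F p.1 p.2 | inr p => G p.1 p.2 end) =
  \sum_i \sum_j (F i j + G i j).
Proof.
rewrite big_sumType /= -(pair_bigA _ F) -(pair_bigA _ G) -big_split /=.
by apply: eq_bigr => i _; rewrite -big_split.
Qed.

Lemma Re_conj_mul (c d e : C) :
  complex.Re c * complex.Re e + complex.Re d ^+ 2 +
  (complex.Im c * complex.Im e + complex.Im d ^+ 2) = complex.Re (c^* * e) + nsq d.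
Proof. by rewrite conjCE cReM /nsq /=; ring. Qed.

Lemma frob2_ge0 w : 0 <= frob2 w.
Proof. by apply: sumr_ge0 => i _; apply: sumr_ge0 => j _; exact: nsq_ge0. Qed.

Lemma sqn_ge0 w : 0 <= sqn w.
Proof. by apply: sumr_ge0 => k _; exact: nsq_ge0. Qed.

(** Convexity of the weight lets its second derivative be dropped. *)
Lemma weight_bound (d dd s e S L : R) : 0 < s -> 0 <= e -> 0 <= S -> `|d| <= e -> 0 <= dd ->
  L <= S * (3 * (d / s) ^+ 2 - dd / s) -> L <= S * (3 * (e / s) ^+ 2).
Proof.
move=> s0 e0 S0 de dd0 H; apply: le_trans H _; apply: ler_wpM2l; first exact: S0.
apply: (@le_trans _ _ (3 * (d / s) ^+ 2)).
  by rewrite lerBlDr lerDl divr_ge0// ltW.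
apply: ler_wpM2l; first by [].
rewrite !exprMn; apply: ler_wpM2r; first exact: sqr_ge0.
by rewrite -(real_normK (num_real d)) ler_sqr ?nnegrE.
Qed.

(** The weighted maximum principle for the real and imaginary parts of the entries
    of [h], with weight [|z|^2], which is convex along lines. *)
Lemma dir_max (V : pt) : \sum_i \sum_j
   (complex.Re ((h i j z)^* * real_deriv (to_real V) (real_deriv (to_real V) (h i j)) z) +
    nsq (real_deriv (to_real V) (h i j) z)) <=
  frob2 z * (3 * ((sqn V + sqn z) / sqn z) ^+ 2).
Proof.
set v := to_real V.
pose hr (x : 'I_n * 'I_n + 'I_n * 'I_n) (p : rpt) : R := match x with
  | inl p' => complex.Re (h p'.1 p'.2 (of_real p)) | inr p' => complex.Im (h p'.1 p'.2 (of_real p)) end.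
pose w (p : rpt) : R := complex.Re (sqnorm (of_real p)).
have wC : Ck punctured 2 w by exact: (@CkC_sqnorm R n 2).1.
have hrC x : Ck punctured 2 (hr x) by case: x => -[i j]; [exact: (hC i j).1|exact: (hC i j).2].
have zp : punctured (to_real z) := to_real_i_punctured z0.
have po : open punctured := @punctured_open R n.
have wE p : w p = sqn (of_real p) by rewrite sqn_Re.
have sE p : sqsum hr p = frob2 (of_real p).
  rewrite /sqsum (eq_bigr (fun x => match x with
    | inl q => complex.Re (h q.1 q.2 (of_real p)) ^+ 2
    | inr q => complex.Im (h q.1 q.2 (of_real p)) ^+ 2 end)); last by case.
  by rewrite (sum_pairs (fun i j => complex.Re (h i j (of_real p)) ^+ 2)
    (fun i j => complex.Im (h i j (of_real p)) ^+ 2)).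
have sz0 := sqn_gt0 z0.
have wz : w (to_real z) = sqn z by rewrite wE to_realK.
have wz0 : 0 < w (to_real z) by rewrite wz.
have fmax q : punctured q -> w q * w q * sqsum hr q <= w (to_real z) * w (to_real z) * sqsum hr (to_real z).
  by move=> q0; rewrite !wE !sE !to_realK; exact: zmax.
have := weighted_max po wC hrC v zp wz0 fmax.
rewrite sE wz to_realK => H.
have dw : 'D_v w (to_real z) = complex.Re (real_deriv v (@sqnorm R n) z) by [].
have ddw : 'D_v ('D_v w) (to_real z) = complex.Re (real_deriv v (real_deriv v (@sqnorm R n)) z).
  by rewrite Re_real_deriv2.
have L : \sum_i (hr i (to_real z) * 'D_v ('D_v (hr i)) (to_real z) + 'D_v (hr i) (to_real z) ^+ 2) =
   \sum_i \sum_j (complex.Re ((h i j z)^* * real_deriv v (real_deriv v (h i j)) z) +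
    nsq (real_deriv v (h i j) z)).
  rewrite (eq_bigr (fun x => match x with
    | inl q => complex.Re (h q.1 q.2 z) * complex.Re (real_deriv v (real_deriv v (h q.1 q.2)) z) +
        complex.Re (real_deriv v (h q.1 q.2) z) ^+ 2
    | inr q => complex.Im (h q.1 q.2 z) * complex.Im (real_deriv v (real_deriv v (h q.1 q.2)) z) +
        complex.Im (real_deriv v (h q.1 q.2) z) ^+ 2 end)); last first.
    case=> q _.
      rewrite Re_real_deriv2; congr (_ * _ + _).
      by rewrite /hr to_realK.
    rewrite Im_real_deriv2; congr (_ * _ + _).
    by rewrite /hr to_realK.
  rewrite (sum_pairs
    (fun i j => complex.Re (h i j z) * complex.Re (real_deriv v (real_deriv v (h i j)) z) +
        complex.Re (real_deriv v (h i j) z) ^+ 2)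
    (fun i j => complex.Im (h i j z) * complex.Im (real_deriv v (real_deriv v (h i j)) z) +
        complex.Im (real_deriv v (h i j) z) ^+ 2)).
  by apply: eq_bigr => i _; apply: eq_bigr => j _; exact: Re_conj_mul.
rewrite -L; have e0 : 0 <= sqn V + sqn z by rewrite addr_ge0 ?sqn_ge0.
apply: (weight_bound sz0 e0 (frob2_ge0 z) _ _ H).
  by rewrite dw; exact: real_deriv_sqn_bound.
by rewrite ddw; exact: real_deriv2_sqn.
Qed.

Variables (m : nat) (V : 'I_m -> pt) (W : 'I_n -> 'I_n -> C).
Hypothesis WE : forall k l, W k l = \sum_a V a 0 k * (V a 0 l)^*.

(** The squares of the first derivatives gained at a maximum. *)
Definition frame_energy : R := \sum_a \sum_i \sum_j
  (nsq (real_deriv (to_real (V a)) (h i j) z) + nsq (real_deriv (to_real (rowi (V a))) (h i j) z)).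

Lemma sqn_rowi (U : pt) : sqn (rowi U) = sqn U.
Proof.
apply: eq_bigr => k _; rewrite mxE /nsq; case: (U 0 k) => a b.
by rewrite cReM cImM /=; ring.
Qed.

Lemma W_conj k l : (W k l)^* = W l k.
Proof.
rewrite !WE rmorph_sum; apply: eq_bigr => a _.
by rewrite rmorphM /= conjCK mulrC.
Qed.

(** The hermitian symmetry of [h] exchanges the two orders of differentiation, so
    that their sum has twice the same real part against [conj h]. *)
Lemma dzbar_dz_conj k l i j : dz l (dzbar k (h i j)) z = (dzbar l (dz k (h j i)) z)^*.
Proof.
rewrite -[dzbar l _ z]/(dfr (bar (inl l)) _ z) -[LHS]/(dfr (inl l) _ z).
have C1 : CkC 0 (dz k (h j i)) by have /CkCW := CkC_dfr (inl k) (hC j i).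
rewrite -(dfr_conj (inl l) C1 z0); apply: (eq_dfr _ _ z0) => w w0.
rewrite -[dz k _ w]/(dfr (bar (inr k)) _ w) -[LHS]/(dfr (inr k) _ w).
rewrite -(dfr_conj (inr k) (CkCW (CkCW (hC j i))) w0).
by apply: (eq_dfr _ _ w0) => q q0; rewrite hh.
Qed.

(** Writing the coefficients as [W = sum_a V_a V_a^*] turns the operator into a sum
    of second derivatives along the real directions [V_a] and [J V_a]; for each of
    them the maximum principle applies, and the squared first derivatives are kept
    on the left for later use. *)
Lemma operator_max :
  4 * complex.Re (\sum_i \sum_j (h i j z)^* * \sum_k \sum_l W k l * dzbar l (dz k (h i j)) z) +
    frame_energy <= frob2 z * \sum_a 6 * ((sqn (V a) + sqn z) / sqn z) ^+ 2.
Proof.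
have S : \sum_a (\sum_i \sum_j
   (complex.Re ((h i j z)^* * real_deriv (to_real (V a)) (real_deriv (to_real (V a)) (h i j)) z) +
    nsq (real_deriv (to_real (V a)) (h i j) z)) + \sum_i \sum_j
   (complex.Re ((h i j z)^* * real_deriv (to_real (rowi (V a))) (real_deriv (to_real (rowi (V a))) (h i j)) z) +
    nsq (real_deriv (to_real (rowi (V a))) (h i j) z))) <=
    \sum_a (frob2 z * (6 * ((sqn (V a) + sqn z) / sqn z) ^+ 2)).
  apply: ler_sum => a _; apply: le_trans (lerD (dir_max (V a)) (dir_max (rowi (V a)))) _.
  by rewrite sqn_rowi -mulrDr ler_wpM2l//;
    [exact: frob2_ge0|lra].
rewrite mulr_sumr; apply: le_trans S; rewrite le_eqVlt; apply/orP; left; apply/eqP.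
pose X i j := \sum_k \sum_l W k l * dzbar l (dz k (h i j)) z.
pose Y i j := \sum_k \sum_l W k l * dz k (dzbar l (h i j)) z.
have YX i j : Y i j = (X j i)^*.
  rewrite /Y /X rmorph_sum exchange_big; apply: eq_bigr => l _ /=.
  rewrite rmorph_sum; apply: eq_bigr => k _ /=.
  by rewrite rmorphM /= W_conj dzbar_dz_conj.
have R2 i j : \sum_a (real_deriv (to_real (V a)) (real_deriv (to_real (V a)) (h i j)) z +
    real_deriv (to_real (rowi (V a))) (real_deriv (to_real (rowi (V a))) (h i j)) z) =
    2 * (X i j + Y i j).
  under eq_bigr do rewrite (real_deriv_rowi2 _ (hC i j) z0).
  rewrite -mulr_sumr; congr (_ * _); rewrite /X /Y -big_split exchange_big.
  apply: eq_bigr => k _ /=; rewrite -big_split exchange_big; apply: eq_bigr => l _ /=.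
  by rewrite -mulr_suml -WE mulrDr.
have RX : complex.Re (\sum_i \sum_j (h i j z)^* * Y i j) =
    complex.Re (\sum_i \sum_j (h i j z)^* * X i j).
  rewrite [in LHS]exchange_big !Re_sum; apply: eq_bigr => i _; rewrite !Re_sum.
  apply: eq_bigr => j _; rewrite YX hh// conjCK.
  by rewrite !conjCE !cReM /=; ring.
have E1 : 4 * complex.Re (\sum_i \sum_j (h i j z)^* * X i j) =
   \sum_i \sum_j complex.Re ((h i j z)^* * (2 * (X i j + Y i j))).
  transitivity (2 * (complex.Re (\sum_i \sum_j (h i j z)^* * X i j) +
      complex.Re (\sum_i \sum_j (h i j z)^* * Y i j))).
    by rewrite RX; ring.
  rewrite !Re_sum -big_split mulr_sumr; apply: eq_bigr => i _ /=.
  rewrite !Re_sum -big_split mulr_sumr; apply: eq_bigr => j _ /=.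
  rewrite -cReD -mulrDr mulrCA.
  move: (_ * (X i j + Y i j)) => [p q].
  have -> : 2 = (2 : R)%:C%C :> C by rewrite rmorph_nat.
  by rewrite cReM /=; ring.
rewrite -/(X _ _) E1 /frame_energy.
under eq_bigr do under eq_bigr do rewrite -R2 mulr_sumr Re_sum.
under eq_bigr do rewrite exchange_big /=.
rewrite exchange_big -big_split; apply: eq_bigr => a _ /=.
rewrite -!big_split; apply: eq_bigr => i _ /=.
rewrite -!big_split; apply: eq_bigr => j _ /=.
rewrite mulrDr cReD.
by rewrite addrACA.
Qed.

End OperatorMaximum.

(** * Bounded functions and pairs with controlled difference *)

Section BoundedLipschitz.
Context {R : realType} {E : Type}.
Notation C := R[i].
Variables (K : set E) (d : E -> R).
Implicit Types (f g : E -> C).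

(** An equivalent of the modulus for which sums and products of real and imaginary
    parts are estimated without square roots. *)
Definition cnorm (c : C) : R := `|complex.Re c| + `|complex.Im c|.

Lemma cnorm_ge0 c : 0 <= cnorm c. Proof. by rewrite addr_ge0. Qed.
Lemma cnormD x y : cnorm (x + y) <= cnorm x + cnorm y.
Proof. by rewrite /cnorm cReD cImD addrACA lerD// ler_normD. Qed.
Lemma cnormM x y : cnorm (x * y) <= cnorm x * cnorm y.
Proof.
rewrite /cnorm cReM cImM mulrDl !mulrDr -!normrM.
apply: le_trans (lerD (ler_normB _ _) (ler_normD _ _)) _.
by rewrite le_eqVlt; apply/orP; left; apply/eqP; ring.
Qed.
Lemma cnormN x : cnorm (- x) = cnorm x.
Proof. by case: x => a b; rewrite /cnorm /= !normrN. Qed.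
Lemma cnorm_conj x : cnorm (x^*) = cnorm x.
Proof. by rewrite conjCE /cnorm /= normrN. Qed.
Lemma cnorm0 : cnorm 0 = 0. Proof. by rewrite /cnorm /= normr0 addr0. Qed.
Lemma cnorm_real (x : R) : cnorm (x%:C%C) = `|x|.
Proof. by rewrite /cnorm /= normr0 addr0. Qed.
Lemma cnorm_sum (I : Type) (s : seq I) (P : pred I) (F : I -> C) :
  cnorm (\sum_(i <- s | P i) F i) <= \sum_(i <- s | P i) cnorm (F i).
Proof.
elim/big_ind2 : _ => //; first by rewrite cnorm0.
by move=> x1 x2 y1 y2 h1 h2; apply: le_trans (cnormD _ _) (lerD h1 h2).
Qed.

Definition bdd f := exists2 M : R, 0 <= M & forall p, K p -> cnorm (f p) <= M.

Lemma bdd_cst c : bdd (fun=> c).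
Proof. by exists (cnorm c); [exact: cnorm_ge0|]. Qed.

Lemma bddD f g : bdd f -> bdd g -> bdd (fun p => f p + g p).
Proof.
move=> [M M0 fM] [N N0 gN]; exists (M + N); first by rewrite addr_ge0.
by move=> p Kp; apply: le_trans (cnormD _ _) (lerD (fM p Kp) (gN p Kp)).
Qed.

Lemma bddM f g : bdd f -> bdd g -> bdd (fun p => f p * g p).
Proof.
move=> [M M0 fM] [N N0 gN]; exists (M * N); first by rewrite mulr_ge0.
move=> p Kp; apply: le_trans (cnormM _ _) _.
by apply: ler_pM; rewrite ?cnorm_ge0 ?fM ?gN.
Qed.

Lemma bddN f : bdd f -> bdd (fun p => - f p).
Proof. by move=> [M M0 fM]; exists M => // p Kp; rewrite cnormN fM. Qed.

Lemma bdd_conj f : bdd f -> bdd (fun p => (f p)^*).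
Proof. by move=> [M M0 fM]; exists M => // p Kp; rewrite cnorm_conj fM. Qed.

Lemma eq_bdd f g : (forall p, K p -> f p = g p) -> bdd f -> bdd g.
Proof. by move=> fg [M M0 HM]; exists M => // p Kp; rewrite -fg// HM. Qed.

(** Bounded pairs of functions whose difference is controlled by [d]: a class
    closed under all polynomial operations. *)
Definition lip f g := [/\ bdd f, bdd g &
  exists2 L : R, 0 <= L & forall p, K p -> cnorm (f p - g p) <= L * d p].

Lemma lip_refl f : bdd f -> lip f f.
Proof. by move=> bf; split=> //; exists 0 => // p Kp; rewrite subrr cnorm0 mul0r. Qed.

Lemma lip_cst c : lip (fun=> c) (fun=> c).
Proof. exact/lip_refl/bdd_cst. Qed.

Lemma lipD f g f' g' : lip f f' -> lip g g' ->
  lip (fun p => f p + g p) (fun p => f' p + g' p).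
Proof.
move=> [bf bf' [L L0 HL]] [bg bg' [M M0 HM]]; split; [exact: bddD|exact: bddD|].
exists (L + M); first by rewrite addr_ge0.
move=> p Kp; rewrite opprD addrACA mulrDl.
exact: le_trans (cnormD _ _) (lerD (HL p Kp) (HM p Kp)).
Qed.

Lemma lipN f f' : lip f f' -> lip (fun p => - f p) (fun p => - f' p).
Proof.
move=> [bf bf' [L L0 HL]]; split; [exact: bddN|exact: bddN|].
by exists L => // p Kp; rewrite -opprD cnormN HL.
Qed.

Lemma lipM f g f' g' : lip f f' -> lip g g' ->
  lip (fun p => f p * g p) (fun p => f' p * g' p).
Proof.
move=> [bf bf' [L L0 HL]] [bg bg' [M M0 HM]]; split; [exact: bddM|exact: bddM|].
have [B B0 HB] := bg; have [B' B'0 HB'] := bf'.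
exists (L * B + B' * M); first by rewrite addr_ge0 ?mulr_ge0.
move=> p Kp; rewrite (_ : f p * g p - f' p * g' p = (f p - f' p) * g p + f' p * (g p - g' p)).
  apply: le_trans (cnormD _ _) _; rewrite [leRHS]mulrDl; apply: lerD; apply: le_trans (cnormM _ _) _.
    rewrite mulrAC; apply: ler_pM; rewrite ?cnorm_ge0 ?HL ?HB//.
  rewrite -mulrA; apply: ler_pM; rewrite ?cnorm_ge0 ?HM ?HB'//.
by move: (f p) (g p) (f' p) (g' p) => *; ring.
Qed.

Lemma lip_conj f f' : lip f f' -> lip (fun p => (f p)^*) (fun p => (f' p)^*).
Proof.
move=> [bf bf' [L L0 HL]]; split; [exact: bdd_conj|exact: bdd_conj|].
by exists L => // p Kp; rewrite -rmorphB /= cnorm_conj HL.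
Qed.

Lemma lip_sum (I : Type) (s : seq I) (F F' : I -> E -> C) :
  (forall i, lip (F i) (F' i)) ->
  lip (fun p => \sum_(i <- s) F i p) (fun p => \sum_(i <- s) F' i p).
Proof.
move=> HF; elim: s => [|i s IH].
  have e (G : I -> E -> C) : (fun p => \sum_(i <- [::]) G i p) = (fun=> 0).
    by apply/funext => p; rewrite big_nil.
  by rewrite !e; exact: lip_cst.
have e (G : I -> E -> C) : (fun p => \sum_(j <- i :: s) G j p) =
    (fun p => G i p + \sum_(j <- s) G j p).
  by apply/funext => p; rewrite big_cons.
by rewrite !e; apply: lipD.
Qed.

Section LowerOrderTerms.
Variable n : nat.
Variables (W W' : E -> 'I_n -> 'I_n -> C) (P P' : E -> 'I_n -> 'I_n -> 'I_n -> C).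
Hypotheses (WL : forall k l, lip (fun p => W p k l) (fun p => W' p k l))
  (PL : forall k i m, lip (fun p => P p k i m) (fun p => P' p k i m)).

Lemma lip_tors k i m : lip (fun p => tors (P p) k i m) (fun p => tors (P' p) k i m).
Proof. exact: lipD (PL _ _ _) (lipN (PL _ _ _)). Qed.

Lemma lip_lower_rhs a b c e i j : lip (fun p => lower_rhs (W p) (P p) a b c e i j)
  (fun p => lower_rhs (W' p) (P' p) a b c e i j).
Proof.
have T := lip_tors.
have WW k l m p : lip (fun q => W q k l * W q m p) (fun q => W' q k l * W' q m p).
  exact: lipM (WL _ _) (WL _ _).
have TT k l m k' l' m' : lip (fun q => tors (P q) k l m * (tors (P q) k' l' m')^*)
    (fun q => tors (P' q) k l m * (tors (P' q) k' l' m')^*).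
  exact: lipM (T _ _ _) (lip_conj (T _ _ _)).
have S4 (F F' : 'I_n -> 'I_n -> 'I_n -> 'I_n -> E -> C) :
    (forall k l m p, lip (F k l m p) (F' k l m p)) ->
    lip (fun q => \sum_k \sum_l \sum_m \sum_p F k l m p q)
        (fun q => \sum_k \sum_l \sum_m \sum_p F' k l m p q).
  move=> H; apply: lip_sum => k; apply: lip_sum => l; apply: lip_sum => m.
  by apply: lip_sum => p; exact: H.
rewrite /lower_rhs; apply: lipD; [apply: lipD; [apply: lipD; [apply: lipD|]|]|].
- apply/lipN/lip_sum => k; apply: lip_sum => l; apply: lipM (WL _ _) _.
  apply: lip_sum => D; apply: lip_sum => m.
  exact: lipM (lipM (PL _ _ _) (WL _ _)) (lip_conj (PL _ _ _)).
- apply: lipM (lip_cst _) _; apply: S4 => k l m p.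
  exact: lipM (lipM (WW _ _ _ _) (T _ _ _)) (lip_conj (T _ _ _)).
- apply: lipM (lip_cst _) _; apply: S4 => k l m p.
  exact: lipM (lipM (WW _ _ _ _) (T _ _ _)) (lip_conj (T _ _ _)).
- apply: lipM (lip_cst _) _; apply: S4 => k l m p.
  exact: lipM (lipM (WW _ _ _ _) (T _ _ _)) (lip_conj (T _ _ _)).
apply: lipM (lip_cst _) (lipM (lip_cst _) _); apply: S4 => k l m p.
exact: lipM (WW _ _ _ _) (lipD (TT _ _ _ _ _ _) (TT _ _ _ _ _ _)).
Qed.

End LowerOrderTerms.

(** From [M^-1 - M'^-1 = M^-1 (M' - M) M'^-1]. *)
Lemma lip_invmx n (M M' : E -> 'M[C]_n) :
  (forall p, K p -> M p \in unitmx) -> (forall p, K p -> M' p \in unitmx) ->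
  (forall i j, bdd (fun p => invmx (M p) i j)) -> (forall i j, bdd (fun p => invmx (M' p) i j)) ->
  (forall i j, lip (fun p => M p i j) (fun p => M' p i j)) ->
  forall i j, lip (fun p => invmx (M p) i j) (fun p => invmx (M' p) i j).
Proof.
move=> Mu Mu' bI bI' ML i j; split=> //.
have diff k l : lip (fun p => M' p k l - M p k l) (fun=> 0).
  have [b1 b2 [L L0 HL]] := ML k l; split; [exact: bddD b2 (bddN b1)|exact: bdd_cst|].
  by exists L => // p Kp; rewrite subr0 -cnormN opprB HL.
have [_ _ [L L0 HL]] : lip
    (fun p => \sum_l (\sum_k invmx (M p) i k * (M' p k l - M p k l)) * invmx (M' p) l j)
    (fun p => \sum_l (\sum_k invmx (M p) i k * 0) * invmx (M' p) l j).
  apply: lip_sum => l; apply: lipM (lip_refl (bI' _ _)); apply: lip_sum => k.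
  exact: lipM (lip_refl (bI _ _)) (diff k l).
exists L => // p Kp.
have -> : invmx (M p) i j - invmx (M' p) i j =
    \sum_l (\sum_k invmx (M p) i k * (M' p k l - M p k l)) * invmx (M' p) l j.
  have E0 : invmx (M p) - invmx (M' p) = invmx (M p) *m (M' p - M p) *m invmx (M' p).
    rewrite mulmxBr mulmxBl -mulmxA mulmxV ?Mu'// mulmx1.
    by rewrite mulVmx ?Mu// mul1mx.
  have /matrixP/(_ i j) := E0; rewrite !mxE => ->.
  apply: eq_bigr => l _; rewrite !mxE; congr (_ * _).
  by apply: eq_bigr => k _; rewrite !mxE.
have := HL p Kp; rewrite [X in _ - X]big1 ?subr0// => l _.
by rewrite big1 ?mul0r// => k _; rewrite mulr0.
Qed.

End BoundedLipschitz.

(** * Continuity in time and space, and the compact annulus *)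

Section ComplexContinuity.
Context {R : realType} {T : topologicalType}.
Notation C := R[i].
Implicit Types (f g : T -> C) (p : T).

Definition ccont f p := {for p, continuous (fun q => complex.Re (f q))} /\
  {for p, continuous (fun q => complex.Im (f q))}.

Lemma ccont_cst c p : ccont (fun=> c) p.
Proof. by split; exact: cvg_cst. Qed.

Lemma ccontD f g p : ccont f p -> ccont g p -> ccont (fun q => f q + g q) p.
Proof.
move=> [f1 f2] [g1 g2]; split.
  rewrite (_ : (fun q => _) = (fun q => complex.Re (f q) + complex.Re (g q))).
    exact: (continuousD f1 g1).
  by apply/funext => q; rewrite cReD.
rewrite (_ : (fun q => _) = (fun q => complex.Im (f q) + complex.Im (g q))).
  exact: (continuousD f2 g2).
by apply/funext => q; rewrite cImD.
Qed.

Lemma ccontM f g p : ccont f p -> ccont g p -> ccont (fun q => f q * g q) p.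
Proof.
move=> [f1 f2] [g1 g2]; split.
  rewrite (_ : (fun q => _) = (fun q => complex.Re (f q) * complex.Re (g q) -
     complex.Im (f q) * complex.Im (g q))).
    exact: (continuousB (continuousM f1 g1) (continuousM f2 g2)).
  by apply/funext => q; rewrite cReM.
rewrite (_ : (fun q => _) = (fun q => complex.Re (f q) * complex.Im (g q) +
     complex.Im (f q) * complex.Re (g q))).
  exact: (continuousD (continuousM f1 g2) (continuousM f2 g1)).
by apply/funext => q; rewrite cImM.
Qed.

Lemma ccont_conj f p : ccont f p -> ccont (fun q => (f q)^*) p.
Proof.
move=> [f1 f2]; split.
  rewrite (_ : (fun q => _) = (fun q => complex.Re (f q))); first exact: f1.
  by apply/funext => q; rewrite conjCE.
rewrite (_ : (fun q => _) = (fun q => - complex.Im (f q))).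
  exact: (continuousN f2).
by apply/funext => q; rewrite conjCE.
Qed.

Lemma ccontN f p : ccont f p -> ccont (fun q => - f q) p.
Proof.
move=> fc; rewrite (_ : (fun q => _) = (fun q => -1 * f q)).
  exact: ccontM (ccont_cst _ _) fc.
by apply/funext => q; rewrite mulN1r.
Qed.

Lemma ccont_sum (I : Type) (s : seq I) (P : pred I) (F : I -> T -> C) p :
  (forall i, ccont (F i) p) -> ccont (fun q => \sum_(i <- s | P i) F i q) p.
Proof.
move=> HF; elim: s => [|i s IH].
  rewrite (_ : (fun q => _) = (fun=> 0)); first exact: ccont_cst.
  by apply/funext => q; rewrite big_nil.
case: (boolP (P i)) => Pi.
  rewrite (_ : (fun q => _) = (fun q => F i q + \sum_(j <- s | P j) F j q)).
    exact: ccontD.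
  by apply/funext => q; rewrite big_cons Pi.
rewrite (_ : (fun q => _) = (fun q => \sum_(j <- s | P j) F j q)); first exact: IH.
by apply/funext => q; rewrite big_cons (negbTE Pi).
Qed.

Lemma ccont_prod (I : Type) (s : seq I) (P : pred I) (F : I -> T -> C) p :
  (forall i, ccont (F i) p) -> ccont (fun q => \prod_(i <- s | P i) F i q) p.
Proof.
move=> HF; elim: s => [|i s IH].
  rewrite (_ : (fun q => _) = (fun=> 1)); first exact: ccont_cst.
  by apply/funext => q; rewrite big_nil.
case: (boolP (P i)) => Pi.
  rewrite (_ : (fun q => _) = (fun q => F i q * \prod_(j <- s | P j) F j q)).
    exact: ccontM.
  by apply/funext => q; rewrite big_cons Pi.
rewrite (_ : (fun q => _) = (fun q => \prod_(j <- s | P j) F j q)); first exact: IH.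
by apply/funext => q; rewrite big_cons (negbTE Pi).
Qed.

Lemma ccont_real (h : T -> R) p : {for p, continuous h} -> ccont (fun q => (h q)%:C%C) p.
Proof. by move=> hc; split; [exact: hc|exact: cvg_cst]. Qed.

Lemma nsq_neq0 (c : C) : c != 0 -> nsq c != 0.
Proof.
apply: contraNneq => /eqP; rewrite paddr_eq0 ?sqr_ge0// !sqrf_eq0 => /andP[/eqP a /eqP b].
exact/eqP/complex_eq.
Qed.

Lemma continuous_nsq f p : ccont f p -> {for p, continuous (fun q => nsq (f q))}.
Proof.
move=> [f1 f2]; rewrite (_ : (fun q => _) = (fun q => complex.Re (f q) * complex.Re (f q)
   + complex.Im (f q) * complex.Im (f q))).
  exact: (continuousD (continuousM f1 f1) (continuousM f2 f2)).
by apply/funext => q; rewrite /nsq !expr2.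
Qed.

Lemma ccontV f p : f p != 0 -> ccont f p -> ccont (fun q => (f q)^-1) p.
Proof.
move=> fp fc.
have N := continuous_nsq fc.
rewrite (_ : (fun q => _) = (fun q => (f q)^* * ((nsq (f q))^-1)%:C%C)).
  apply: ccontM (ccont_conj fc) (ccont_real _).
  by apply: continuousV; [exact: nsq_neq0|exact: N].
apply/funext => q; have [->|fq] := eqVneq (f q) 0.
  by rewrite invr0 conjC0 mul0r.
apply: (mulfI fq); rewrite mulfV// mulrA mul_conj_nsq -rmorphM /= mulfV//.
exact: nsq_neq0.
Qed.

(** A continuous function on a compact set is bounded, for each of the two parts. *)
Lemma ccont_bdd (K : set T) f : compact K -> (forall p, K p -> ccont f p) -> bdd K f.
Proof.
move=> Kc fc; have [->|K0] := eqVneq K set0; first by exists 0.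
have cc : {within K, continuous (fun q => cnorm (f q))}.
  apply: continuous_in_subspaceT => p /set_mem Kp; have [f1 f2] := fc p Kp.
  apply: (@continuousD _ _ _ (fun q => `|complex.Re (f q)|) (fun q => `|complex.Im (f q)|)).
    exact: (continuous_comp f1 (@norm_continuous _ R _)).
  exact: (continuous_comp f2 (@norm_continuous _ R _)).
have /set0P K0' := K0.
have [c cK Hc] := compact_EVT_max K0' Kc cc.
exists (cnorm (f c)); first exact: cnorm_ge0.
by move=> p Kp; apply: Hc; exact/mem_set.
Qed.

End ComplexContinuity.

Section Annulus.
Context {R : realType} {n : nat}.
Notation C := R[i].
Notation pt := 'rV[C]_n.
Notation rpt := ('rV[R]_n * 'rV[R]_n)%type.

Lemma ccont_coord (p : R * rpt) (j : 'I_n) :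
  ccont (fun q : R * rpt => of_real q.2 0 j) p.
Proof.
split.
  rewrite (_ : (fun q : R * rpt => _) = (fun M : 'rV[R]_n => M 0 j) \o (fst \o snd)).
    apply: continuous_comp; last exact: coord_continuous.
    by apply: continuous_comp; [exact: cvg_snd|exact: cvg_fst].
  by apply/funext => q; rewrite /= mxE.
rewrite (_ : (fun q : R * rpt => _) = (fun M : 'rV[R]_n => M 0 j) \o (snd \o snd)).
  apply: continuous_comp; last exact: coord_continuous.
  by apply: continuous_comp; [exact: cvg_snd|exact: cvg_snd].
by apply/funext => q; rewrite /= mxE.
Qed.

Lemma continuous_sqn (p : R * rpt) :
  {for p, continuous (fun q : R * rpt => sqn (of_real q.2))}.
Proof.
have [h _] : ccont (fun q : R * rpt => \sum_j of_real q.2 0 j * (of_real q.2 0 j)^*) p.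
  by apply: ccont_sum => j; exact: ccontM (ccont_coord _ _) (ccont_conj (ccont_coord _ _)).
rewrite (_ : (fun q => _) = (fun q : R * rpt =>
  complex.Re (\sum_j of_real q.2 0 j * (of_real q.2 0 j)^*))) //.
by apply/funext => q; rewrite -/(sqnorm _) sqn_sqnorm.
Qed.

Definition annulus (t1 q : R) : set (R * rpt) :=
  [set p | 0 <= p.1 <= t1 /\ 1 <= sqn (of_real p.2) <= q].

(** It is a closed part of a product of segments, as [|z|^2 <= q] bounds every
    coordinate. *)
Lemma annulus_compact t1 q : 1 <= q -> compact (annulus t1 q).
Proof.
move=> q1.
pose B : set 'rV[R]_n := [set v | forall i, `[- q, q]%classic (v 0 i)].
have Bc : compact B by apply: (@rV_compact R n (fun=> `[- q, q]%classic)) => i; exact: segment_compact.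
apply: (@subclosed_compact _ _ (`[0, t1]%classic `*` (B `*` B))).
- rewrite (_ : annulus t1 q = (fst @^-1` `[0, t1]%classic) `&`
     ((fun p : R * rpt => sqn (of_real p.2)) @^-1` `[1, q]%classic)).
    have c1 : closed ((@fst R rpt) @^-1` `[0, t1]%classic).
      apply: preimage_closed; last exact: interval_closed.
      by move=> p _; exact: cvg_fst.
    have c2 : closed ((fun p : R * rpt => sqn (of_real p.2)) @^-1` `[1, q]%classic).
      apply: preimage_closed; last exact: interval_closed.
      by move=> p _; exact: continuous_sqn.
    exact: closedI.
  by apply/seteqP; split => p /=; rewrite /annulus /= !in_itv.
- have Ic : compact `[(0 : R), t1]%classic := @segment_compact R 0 t1.
  have BB := compact_setX Bc Bc; exact: (compact_setX Ic BB).
move=> [t [x y]] [/= t01 /andP[_ sq]]; split; first by rewrite /= in_itv.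
have bnd k : nsq (of_real (x, y) 0 k) <= q.
  apply: le_trans sq; rewrite /sqn (bigD1 k)//= lerDl.
  by apply: sumr_ge0 => j _; exact: nsq_ge0.
have sqb (a : R) : a ^+ 2 <= q -> `[- q, q]%classic a.
  move=> aq; rewrite /= in_itv /= -ler_norml.
  have : `|a| ^+ 2 <= q ^+ 2.
    by rewrite real_normK ?num_real//; apply: le_trans aq _; rewrite expr2 ler_peMl// (le_trans ler01).
  by rewrite ler_sqr ?nnegrE ?normr_ge0 ?(le_trans ler01).
split=> k /=; apply: sqb; apply: le_trans (bnd k); rewrite /nsq mxE /=.
  by rewrite lerDl sqr_ge0.
by rewrite lerDr sqr_ge0.
Qed.

End Annulus.

(** * Slices of a smooth family of metrics *)

Section SmoothFamily.
Context {R : realType} {n : nat}.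
Notation C := R[i].
Notation pt := 'rV[C]_n.
Notation rpt := ('rV[R]_n * 'rV[R]_n)%type.

Lemma smooth_on_derive (V : normedModType R) (A : set V) (f : V -> R) v :
  smooth_on A f -> smooth_on A ('D_v f).
Proof.
by move=> fs vs p Ap; have := fs (rcons vs v) p Ap; rewrite /= foldr_rcons.
Qed.

(** Derivatives in space of the family are derivatives of the function of time and
    space along directions with no time component. *)
Lemma derive_slice (F : R * rpt -> R) (t : R) (x v : rpt) :
  (derivable (fun y => F (t, y)) x v <-> derivable F (t, x) (0, v)) /\
  'D_v (fun y => F (t, y)) x = 'D_((0 : R), v) F (t, x).
Proof.
have E : (fun h : R => h^-1 *: (((fun y => F (t, y)) \o shift x) (h *: v) - F (t, x))) =
    (fun h : R => h^-1 *: ((F \o shift (t, x)) (h *: ((0 : R), v)) - F (t, x))).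
  apply/funext => h /=; congr (_ *: (F _ - _)).
  by congr (_, _); rewrite /= scaler0 add0r.
by rewrite /derivable /derive E.
Qed.

Lemma derive_time_slice (F : R * rpt -> R) (t : R) (x : rpt) :
  derivable F (t, x) (1, 0) -> derivable (fun s => F (s, x)) t 1.
Proof.
suff E : (fun h : R => h^-1 *: (((fun s => F (s, x)) \o shift t) (h *: 1) - F (t, x))) =
    (fun h : R => h^-1 *: ((F \o shift (t, x)) (h *: ((1 : R), (0 : rpt))) - F (t, x))).
  by rewrite /derivable E.
apply/funext => h /=; congr (_ *: (F _ - _)).
by congr (_, _); rewrite /= scaler0 add0r.
Qed.

Lemma slice_continuous (F : R * rpt -> R) (t : R) (x : rpt) :
  {for (t, x), continuous F} -> {for x, continuous (fun y => F (t, y))}.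
Proof.
move=> c; rewrite (_ : (fun y => F (t, y)) = F \o (fun y => (t, y))) //.
apply: continuous_comp; last exact: c.
have h1 : (fun _ : rpt => t) @ nbhs x --> nbhs t by exact: cvg_cst.
have h2 : (fun y : rpt => y) @ nbhs x --> nbhs x by exact: cvg_id.
exact: (cvg_pair h1 h2).
Qed.

Variables (t0 T : R).
Notation A := [set p : R * rpt | t0 < p.1 < T /\ of_real p.2 != 0].

Lemma smooth_slice (F : R * rpt -> R) (t : R) k : smooth_on A F -> t0 < t < T ->
  Ck punctured k (fun x => F (t, x)).
Proof.
move=> + tT; elim: k F => [|k IH] F Fs.
  split=> [p p0|]; last split=> // p v p0.
    have [c _] := Fs [::] (t, p) (conj tT p0).
    exact: slice_continuous.
  have [_ d] := Fs [::] (t, p) (conj tT p0).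
  by apply/(derive_slice F t p v).1/d.
split=> [p p0|]; last split=> [p v p0|v].
- have [c _] := Fs [::] (t, p) (conj tT p0).
  exact: slice_continuous.
- have [_ d] := Fs [::] (t, p) (conj tT p0).
  by apply/(derive_slice F t p v).1/d.
rewrite (_ : 'D_v _ = (fun x => 'D_((0 : R), v) F (t, x))).
  by apply: (IH ('D_((0 : R), v) F)); exact: smooth_on_derive.
by apply/funext => x; exact: (derive_slice F t x v).2.
Qed.

Variable g : R -> metric R n.
Hypothesis gs : forall i j,
  smooth_on A (fun p => complex.Re (g p.1 (of_real p.2) i j)) /\
  smooth_on A (fun p => complex.Im (g p.1 (of_real p.2) i j)).

Lemma family_CkC t k i j : t0 < t < T -> CkC k (fun z => g t z i j).
Proof.
move=> tT; have [g1 g2] := gs i j.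
by split; [exact: (smooth_slice _ g1)|exact: (smooth_slice _ g2)].
Qed.

Lemma family_ccont p i j : A p -> ccont (fun q : R * rpt => g q.1 (of_real q.2) i j) p.
Proof.
move=> Ap; have [g1 g2] := gs i j.
by split; [have [c _] := g1 [::] p Ap|have [c _] := g2 [::] p Ap]; exact: c.
Qed.

Lemma family_real_deriv_ccont p v i j : A p ->
  ccont (fun q : R * rpt => real_deriv v (fun w => g q.1 w i j) (of_real q.2)) p.
Proof.
move=> Ap; have [g1 g2] := gs i j.
have [c1 _] := g1 [:: ((0 : R), v)] p Ap; have [c2 _] := g2 [:: ((0 : R), v)] p Ap.
split.
  rewrite (_ : (fun q => _) = ('D_((0 : R), v) (fun p => complex.Re (g p.1 (of_real p.2) i j)))).
    exact: c1.
  apply/funext => -[t x]; rewrite /real_deriv /= of_realK.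
  exact: (derive_slice (fun p => complex.Re (g p.1 (of_real p.2) i j)) t x v).2.
rewrite (_ : (fun q => _) = ('D_((0 : R), v) (fun p => complex.Im (g p.1 (of_real p.2) i j)))).
  exact: c2.
apply/funext => -[t x]; rewrite /real_deriv /= of_realK.
exact: (derive_slice (fun p => complex.Im (g p.1 (of_real p.2) i j)) t x v).2.
Qed.

Lemma family_dz_ccont p k i j : A p ->
  ccont (fun q : R * rpt => dz k (fun w => g q.1 w i j) (of_real q.2)) p.
Proof.
move=> Ap; have c v := family_real_deriv_ccont v i j Ap.
rewrite /dz; apply: ccontM; last exact: ccont_cst.
exact: ccontD (c _) (ccontN (ccontM (ccont_cst _ _) (c _))).
Qed.

Lemma family_time t z i j : t0 < t < T -> z != 0 ->
  derivable (fun s => complex.Re (g s z i j)) t 1 /\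
  derivable (fun s => complex.Im (g s z i j)) t 1.
Proof.
move=> tT z0; have [g1 g2] := gs i j.
have Ap : A (t, to_real z) by split=> //=; rewrite to_realK.
have [_ d1] := g1 [::] _ Ap; have [_ d2] := g2 [::] _ Ap.
have := derive_time_slice (d1 (1, 0)); have := derive_time_slice (d2 (1, 0)).
by rewrite /= to_realK.
Qed.

End SmoothFamily.

(** * The scalar equations *)

Section ScalarFlow.
Context {R : realType}.

(** The integral is taken from [-1], so that the primitive is differentiable at [0]
    and the equations hold at the initial time as well. *)
Lemma antiderivative (f : R -> R) : continuous f ->
  exists2 F : R -> R, F 0 = 0 & forall x : R, -1 < x -> is_derive x 1 F (f x).
Proof.
move=> fc.
pose G x := (\int[lebesgue_measure]_(t in `[(-1 : R), x]) (f t))%R.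
have GD x : -1 < x -> derivable G x 1 /\ derive1 G x = f x.
  move=> x1; apply: (@continuous_FTC1_closed R f (-1) x (x + 1)) => //.
  - by rewrite ltrDl.
  - apply: continuous_compact_integrable; first exact: segment_compact.
    by apply: continuous_subspaceT.
  exact: fc.
exists (fun x => G x - G 0); first by rewrite subrr.
move=> x x1; have [d e] := GD x x1.
have H : is_derive x 1 G (f x) by rewrite -e derive1E; exact: derivableP.
rewrite -[f x]subr0; exact: is_deriveB.
Qed.

(** The scale [al] and the inverse anisotropy [v] of the Hopf metrics, in a time
    [tau] with derivative [f]: in that time [v] solves a linear equation, and
    [ln al] is obtained from [ln v]. *)
Lemma hopf_ode (N B E al0 v0 m : R) (f : R -> R) :
  continuous f -> (forall t, 0 <= f t) -> 0 < N -> 0 < E -> 0 < al0 -> 0 < m ->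
  m <= E / N -> m <= v0 ->
  exists al v : R -> R, [/\ al 0 = al0, v 0 = v0 & forall t, 0 <= t ->
    [/\ 0 < al t, m <= v t,
      is_derive t 1 al (f t * al t * (- N + B / v t)) &
      is_derive t 1 v (f t * (E - N * v t))]].
Proof.
move=> fc f0 N0 E0 al00 m0 mE mv.
have v00 : 0 < v0 by exact: lt_le_trans mv.
have [tau tau0 dtau] := antiderivative fc.
(* the solution of the linear equation in the time [tau] *)
pose v t := E / N + (v0 - E / N) * expR (- N * tau t).
(* [ln al] has derivative [- N + B / v] in [tau]; since [ln v] has derivative
   [E / v - N], the primitive is a combination of [ln v] and [tau] *)
pose al t := al0 * expR (- N * tau t + B / E * (ln (v t) - ln v0 + N * tau t)).
have vE : v 0 = v0 by rewrite /v tau0 mulr0 expR0 mulr1 addrC subrK.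
exists al, v; split; [|exact: vE|].
  by rewrite /al vE tau0 !mulr0 subrr !(addr0, add0r, mulr0) expR0 mulr1.
move=> t t0; have t1 : -1 < t by apply: lt_le_trans t0.
have dt := dtau t t1.
have tpos : 0 <= tau t.
  move: t0; rewrite le_eqVlt => /orP[/eqP <-|t0]; first by rewrite tau0.
  have dx (x : R) : x \in `]0, t[ -> is_derive x 1 tau (f x).
    by rewrite in_itv /= => /andP[x0 _]; apply: dtau; apply: lt_trans x0.
  have cx : {within `[0, t], continuous tau}.
    apply: derivable_within_continuous => x; rewrite in_itv /= => /andP[x0 _].
    by have [] := dtau x (lt_le_trans (ltrN10 R) x0).
  have [c _] := MVT t0 dx cx.
  by rewrite tau0 !subr0 => ->; rewrite mulr_ge0// ltW.
have e1 : expR (- N * tau t) <= 1.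
  by rewrite expR_le1 mulNr oppr_le0 mulr_ge0// ltW.
have e0 : 0 < expR (- N * tau t) by exact: expR_gt0.
have mvt : m <= v t.
  rewrite /v; move: (expR _) e0 e1 => e e0 e1.
  have : 0 <= (1 - e) * (E / N - m) by rewrite mulr_ge0// subr_ge0.
  have : 0 <= e * (v0 - m) by rewrite mulr_ge0// ?subr_ge0// ltW.
  by move: (E / N) => q; nra.
have vt0 : 0 < v t by exact: lt_le_trans mvt.
have dNtau : is_derive t 1 (fun s => - N * tau s) (- N * f t).
  by apply: (is_derive_eq (is_deriveZ (- N) dt)).
have dexp : is_derive t 1 (fun s => expR (- N * tau s)) (expR (- N * tau t) * (- N * f t)).
  exact: (is_derive1_comp (is_derive_expR _) dNtau).
have dv : is_derive t 1 v (f t * (E - N * v t)).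
  apply: (is_derive_eq (is_deriveD (is_derive_cst (E / N) t 1)
    (is_deriveZ (v0 - E / N) dexp))).
  rewrite add0r /v /GRing.scale /=; move: (expR _) => e.
  by field; exact: lt0r_neq0.
split; [by rewrite mulr_gt0// expR_gt0|exact: mvt| |exact: dv].
have dlnv : is_derive t 1 (fun s => ln (v s)) ((v t)^-1 * (f t * (E - N * v t))).
  exact: (is_derive1_comp (is_derive1_ln vt0) dv).
have dNt : is_derive t 1 (fun s => N * tau s) (N * f t).
  by apply: (is_derive_eq (is_deriveZ N dt)).
have din : is_derive t 1 (fun s => - N * tau s + B / E * (ln (v s) - ln v0 + N * tau s))
    (- N * f t + B / E * ((v t)^-1 * (f t * (E - N * v t)) - 0 + N * f t)).
  apply: is_deriveD; apply: is_deriveZ; apply: is_deriveD; apply: is_deriveB.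
have dal : is_derive t 1 al (al0 *: (expR (- N * tau t + B / E * (ln (v t) - ln v0 + N * tau t)) *
    (- N * f t + B / E * ((v t)^-1 * (f t * (E - N * v t)) - 0 + N * f t)))).
  apply: is_deriveZ; exact: (is_derive1_comp (is_derive_expR _) din).
apply: (is_derive_eq dal); rewrite /al /GRing.scale /=.
move: (expR _) => e; move: (v t) vt0 => w w0.
by field; rewrite !lt0r_neq0.
Qed.

End ScalarFlow.

(** * A frame adapted to a positive definite matrix *)

Section AdaptedFrame.
Context {R : realType} {n : nat}.
Notation C := R[i].
Notation pt := 'rV[C]_n.
Variable G : 'M[C]_n.
Hypothesis Gh : forall i j, G j i = (G i j)^*.
Hypothesis Gp : forall v : pt, v != 0 -> 0 < \sum_i \sum_j v 0 i * (v 0 j)^* * G i j.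

(** A vector in the kernel would have zero square length. *)
Lemma posdef_unit : G \in unitmx.
Proof.
rewrite -row_free_unit -kermx_eq0; apply/negPn/negP => /rowV0Pn[v /sub_kermxP vG v0].
have := Gp v0; rewrite exchange_big /= big1 ?ltxx// => j _.
have /rowP/(_ j) := vG; rewrite !mxE => E.
transitivity ((v 0 j)^* * \sum_i v 0 i * G i j); last by rewrite E mulr0.
by rewrite mulr_sumr; apply: eq_bigr => i _; rewrite mulrCA mulrA.
Qed.

Let S := spectralmx G.
Let d a : C := spectral_diag G 0 a.

Let SS a b : \sum_i S a i * (S b i)^* = (a == b)%:R.
Proof.
have /unitarymxP/matrixP/(_ a b) := spectral_unitarymx G.
by rewrite !mxE => <-; apply: eq_bigr => i _; rewrite !mxE.
Qed.

Let SS' i j : \sum_a (S a i)^* * S a j = (i == j)%:R.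
Proof.
have Su := spectral_unitarymx G.
have := mulVmx (spectral_unit G); rewrite (invmx_unitary Su) => /matrixP/(_ i j).
by rewrite !mxE => <-; apply: eq_bigr => a _; rewrite !mxE.
Qed.

Let GE i j : G i j = \sum_a (S a i)^* * d a * S a j.
Proof.
have Gn : G \is normalmx.
  have E : map_mx Num.conj G^T = G by apply/matrixP => p q; rewrite !mxE -Gh.
  by apply/normalmxP; rewrite E.
have /orthomx_spectralP E := Gn.
rewrite {1}E (invmx_unitary (spectral_unitarymx G)) !mxE; apply: eq_bigr => a _.
rewrite !mxE; congr (_ * _); rewrite (bigD1 a)//= !mxE eqxx mulr1n big1 ?addr0// => b ba.
by rewrite !mxE (negbTE ba) mulr0n mulr0.
Qed.

Let d_gt0 b : 0 < d b.
Proof.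
have v0 : row b S != 0.
  apply/eqP => /rowP E; have := SS b b; rewrite eqxx big1.
    by move/eqP; rewrite eq_sym oner_eq0.
  by move=> i _; have := E i; rewrite !mxE => ->; rewrite mul0r.
have := Gp v0; set q := \sum_i _; suff -> : q = d b by [].
transitivity (\sum_a (\sum_i S b i * (S a i)^*) * d a * (\sum_j S a j * (S b j)^*)).
  rewrite /q; under eq_bigr do under eq_bigr do rewrite !mxE GE mulr_sumr.
  under eq_bigr do rewrite exchange_big /=.
  rewrite exchange_big /=; apply: eq_bigr => a _; rewrite -mulrA mulr_suml.
  apply: eq_bigr => i _; rewrite mulrA mulr_sumr; apply: eq_bigr => j _.
  by move: (S b i) (S a j) ((S a i)^*) ((S b j)^*) (d a) => *; ring.
under eq_bigr do rewrite !SS.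
rewrite (bigD1 b)//= eqxx mul1r mulr1 big1 ?addr0// => a ab.
by rewrite (negbTE ab) mulr0.
Qed.

Let invG l k : invmx G l k = \sum_a (S a l)^* * (d a)^-1 * S a k.
Proof.
pose M : 'M[C]_n := \matrix_(l, k) \sum_a (S a l)^* * (d a)^-1 * S a k.
suff GM : G *m M = 1%:M.
  have -> : invmx G = M by rewrite -[invmx G]mulmx1 -GM mulmxA mulVmx ?posdef_unit// mul1mx.
  by rewrite mxE.
apply/matrixP => i j; rewrite !mxE -SS'.
transitivity (\sum_p \sum_a \sum_b (S a i)^* * d a * (S a p * (S b p)^*) * (d b)^-1 * S b j).
  apply: eq_bigr => p _; rewrite GE mxE mulr_suml; apply: eq_bigr => a _.
  rewrite mulr_sumr; apply: eq_bigr => b _.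
  by move: ((d b)^-1) (d a) (S a p) ((S b p)^*) ((S a i)^*) (S b j) => *; ring.
rewrite exchange_big /=; apply: eq_bigr => a _; rewrite exchange_big /=.
transitivity (\sum_b (a == b)%:R * ((S a i)^* * d a * (d b)^-1 * S b j)).
  apply: eq_bigr => b _; rewrite -SS mulr_suml; apply: eq_bigr => p _.
  by move: ((d b)^-1) (d a) (S a p) ((S b p)^*) ((S a i)^*) (S b j) => *; ring.
rewrite (bigD1 a)//= eqxx mul1r big1 ?addr0.
  by rewrite mulfK// gt_eqF ?d_gt0.
by move=> b ba; rewrite eq_sym (negbTE ba) mul0r.
Qed.

(** A frame in which the inverse of a positive definite hermitian matrix is the
    identity, together with its dual frame. *)
Lemma adapted_frame : exists (V : 'I_n -> pt) (U : 'I_n -> 'I_n -> C),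
  [/\ forall k l, invmx G l k = \sum_a V a 0 k * (V a 0 l)^*,
      forall k l, \sum_a U k a * V a 0 l = (k == l)%:R &
      forall k a, nsq (U k a) <= complex.Re (G k k)].
Proof.
have dR a : d a = (complex.Re (d a))%:C%C.
  by have := d_gt0 a; rewrite ltcE => /andP[/eqP /= h _]; apply: complex_eq.
have r0 a : 0 < complex.Re (d a).
  by have := d_gt0 a; rewrite {1}dR -[0]/(0%:C%C) ltcR.
pose s a := Num.sqrt (complex.Re (d a)).
have s0 a : 0 < s a by rewrite sqrtr_gt0.
have ss a : (s a)%:C%C * (s a)%:C%C = d a :> C.
  by rewrite -rmorphM -expr2 sqr_sqrtr ?ltW// -dR.
have sC a : (s a)%:C%C != 0 :> C by rewrite (inj_eq (@complexI R)) gt_eqF.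
have cR (x : R) : (x%:C%C)^* = x%:C%C :> C by rewrite conjCE /= oppr0.
exists (fun a => \row_k (S a k * ((s a)%:C%C)^-1)), (fun k a => (S a k)^* * (s a)%:C%C).
split=> [k l|k l|k a].
- rewrite invG; apply: eq_bigr => a _; rewrite !mxE rmorphM /= fmorphV /= cR -ss invfM.
  by move: (((s a)%:C%C)^-1 : C) (S a k) ((S a l)^*) => *; ring.
- rewrite -SS'; apply: eq_bigr => a _; by rewrite !mxE mulrACA mulfV ?mulr1.
have E b : (S b k)^* * d b * S b k = (nsq ((S b k)^* * (s b)%:C%C))%:C%C.
  rewrite -mul_conj_nsq rmorphM /= conjCK cR -ss.
  by move: ((s b)%:C%C : C) (S b k) ((S b k)^*) => *; ring.
rewrite GE (eq_bigr _ (fun b _ => E b)) Re_sum /= (bigD1 a)//= lerDl.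
by apply: sumr_ge0 => b _; exact: nsq_ge0.
Qed.

End AdaptedFrame.

(** * The difference between a solution and the Hopf metrics *)

(** One constant for finitely many estimates: the sum of the individual ones. *)
Lemma fin_uniform (R : realType) (I : finType) (E : Type) (K : set E) (F : I -> E -> R) (d : E -> R) :
  (forall p, K p -> 0 <= d p) ->
  (forall i, exists2 L : R, 0 <= L & forall p, K p -> F i p <= L * d p) ->
  exists2 L : R, 0 <= L & forall i p, K p -> F i p <= L * d p.
Proof.
move=> d0 H.
have /choice[L HL] : forall i, exists L : R, 0 <= L /\ forall p, K p -> F i p <= L * d p.
  by move=> i; have [L L0 HL] := H i; exists L.
exists (\sum_i L i); first by apply: sumr_ge0 => i _; exact: (HL i).1.
move=> i p Kp; apply: le_trans ((HL i).2 p Kp) _; rewrite ler_wpM2r ?d0//.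
by rewrite (bigD1 i)//= lerDl; apply: sumr_ge0 => j _; exact: (HL j).1.
Qed.

Section Elementary.
Context {R : realType}.
Notation C := R[i].

Lemma cnorm_nsq (c : C) (s : R) : 0 <= s -> nsq c <= s ^+ 2 -> cnorm c <= 2 * s.
Proof.
move=> s0; case: c => a b; rewrite /nsq /cnorm /= => h.
have hx (x : R) : x ^+ 2 <= s ^+ 2 -> `|x| <= s.
  by move=> xs; rewrite -ler_sqr ?nnegrE// real_normK ?num_real.
have h1 : `|a| <= s by apply: hx; apply: le_trans h; rewrite lerDl sqr_ge0.
have h2 : `|b| <= s by apply: hx; apply: le_trans h; rewrite lerDr sqr_ge0.
by lra.
Qed.

(** From [|x| <= 1 + x^2], for quantities that only need some bound. *)
Lemma cnorm_nsq2 (c : C) (M : R) : nsq c <= M -> cnorm c <= 2 + M.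
Proof.
case: c => a b; rewrite /nsq /cnorm /= => h.
have hx (x : R) : `|x| <= 1 + x ^+ 2.
  by have := sqr_ge0 (1 - `|x|); rewrite -(real_normK (num_real x)); move: `|x| (normr_ge0 x) => *; nra.
by have := hx a; have := hx b; lra.
Qed.

Lemma Re_le_cn (c : C) : complex.Re c <= cnorm c.
Proof. by rewrite /cnorm (le_trans (ler_norm _))// lerDl. Qed.

(** The first derivatives, of size [e], enter the lower order terms linearly, and
    the second order terms provide [- e^2]: completing the square removes them. *)
Lemma absorb (A B D s e x w : R) : 0 <= B ->
  4 * x + e ^+ 2 <= s ^+ 2 * D -> w <= A * s ^+ 2 + B * s * e ->
  2 * (x + w) <= (D / 2 + 2 * A + 2 * B ^+ 2) * s ^+ 2.
Proof.
move=> B0 h1 h2; have h3 := sqr_ge0 (e - 2 * B * s).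
by nra.
Qed.

Lemma cnorm_i (c : C) : cnorm ('i%C * c) = cnorm c.
Proof.
by case: c => a b; rewrite /cnorm cReM cImM /= !mul0r !mul1r sub0r add0r normrN addrC.
Qed.

Lemma cnorm_half (x d1 d2 : C) (e : R) :
  2 * x = d1 - 'i%C * d2 -> cnorm d1 <= 2 * e -> cnorm d2 <= 2 * e -> cnorm x <= 2 * e.
Proof.
move=> E h1 h2; have : cnorm (2 * x) <= 2 * e + 2 * e.
  by rewrite E; apply: le_trans (cnormD _ _) _; rewrite cnormN cnorm_i lerD.
case: x {E} => u1 u2; rewrite /cnorm cReM cImM /= !(mul0r, add0r, addr0, subr0) !normrM.
have -> : `|1 + 1| = 2 :> R by rewrite ger0_norm.
by lra.
Qed.

Lemma le_sum2 n m (F : 'I_n -> 'I_m -> R) : (forall i j, 0 <= F i j) ->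
  forall i j, F i j <= \sum_i \sum_j F i j.
Proof.
move=> F0 i j; rewrite (bigD1 i)//= (bigD1 j)//= -addrA lerDl.
by apply: addr_ge0; apply: sumr_ge0 => k _; [exact: F0|exact: sumr_ge0].
Qed.

Lemma le_sum3 n m l (F : 'I_n -> 'I_m -> 'I_l -> R) : (forall a i j, 0 <= F a i j) ->
  forall a i j, F a i j <= \sum_a \sum_i \sum_j F a i j.
Proof.
move=> F0 a i j; apply: le_trans (le_sum2 (F0 a) i j) _; rewrite (bigD1 a)//= lerDl.
by apply: sumr_ge0 => b _; apply: sumr_ge0 => i' _; exact: sumr_ge0.
Qed.

Lemma le_sum_nsq n m l (D1 D2 : 'I_n -> 'I_m -> 'I_l -> C) a i j :
  nsq (D1 a i j) <= \sum_a \sum_i \sum_j (nsq (D1 a i j) + nsq (D2 a i j)) /\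
  nsq (D2 a i j) <= \sum_a \sum_i \sum_j (nsq (D1 a i j) + nsq (D2 a i j)).
Proof.
have F0 a' i' j' : 0 <= nsq (D1 a' i' j') + nsq (D2 a' i' j') := addr_ge0 (nsq_ge0 _) (nsq_ge0 _).
have FQ := le_sum3 F0 a i j.
by split; apply: le_trans FQ; rewrite ?lerDl ?lerDr nsq_ge0.
Qed.

Lemma frame_energy_term n (h : 'I_n -> 'I_n -> 'rV[C]_n -> C) m (V : 'I_m -> 'rV[C]_n) z a i j :
  nsq (real_deriv (to_real (V a)) (h i j) z) <= frame_energy h z V /\
  nsq (real_deriv (to_real (rowi (V a))) (h i j) z) <= frame_energy h z V.
Proof.
exact: (@le_sum_nsq m n n (fun a i j => real_deriv (to_real (V a)) (h i j) z)
  (fun a i j => real_deriv (to_real (rowi (V a))) (h i j) z)).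
Qed.

End Elementary.

Section CompareWithHopf.
Context {R : realType} {n : nat}.
Notation C := R[i].
Notation pt := 'rV[C]_n.
Notation rpt := ('rV[R]_n * 'rV[R]_n)%type.
Variables (t0 t1 T q : R) (g : R -> metric R n) (al y : R -> R) (e0 : pt) (p0 : 'I_n).
Variables (ca cb cc cd : R).
Hypotheses (t00 : t0 < 0) (t1T : t1 < T) (q1 : 1 <= q).
Hypothesis gs : forall i j,
  let A := [set p : R * rpt | t0 < p.1 < T /\ of_real p.2 != 0] in
  smooth_on A (fun p => complex.Re (g p.1 (of_real p.2) i j)) /\
  smooth_on A (fun p => complex.Im (g p.1 (of_real p.2) i j)).
Hypothesis gh : forall t, 0 <= t <= t1 -> forall z, z != 0 -> forall i j, g t z j i = (g t z i j)^*.
Hypothesis gp : forall t, 0 <= t <= t1 -> forall z, z != 0 -> forall v : pt, v != 0 ->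
  0 < \sum_i \sum_j v 0 i * (v 0 j)^* * g t z i j.
Hypothesis al_gt0 : forall t, 0 <= t <= t1 -> 0 < al t.
Hypothesis y_gt0 : forall t, 0 <= t <= t1 -> 0 < y t.
Hypothesis alc : forall t, 0 <= t <= t1 -> {for t, continuous al}.
Hypothesis yc : forall t, 0 <= t <= t1 -> {for t, continuous y}.
Hypotheses (e0_sqn : sqn e0 = 1) (e0_p0 : e0 0 p0 = 0).

Notation K := (@annulus R n t1 q).
Notation G t := (@hopf_metric R n (al t) (al t * (y t - 1))).
Notation zz p := (of_real p.2 : pt).

Lemma K_time p : K p -> 0 <= p.1 <= t1. Proof. by case. Qed.
Lemma K_timeT p : K p -> t0 < p.1 < T.
Proof. by case=> /andP[a b] _; rewrite (lt_le_trans t00 a) (le_lt_trans b t1T). Qed.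
Lemma K_neq0 p : K p -> zz p != 0.
Proof.
case=> _ /andP[h _]; apply/eqP => E; move: h; rewrite E /sqn big1 ?ler10//.
by move=> k _; rewrite mxE /nsq /= expr0n addr0.
Qed.

Lemma bdd_ccont (f : R * rpt -> C) : (forall p, K p -> ccont f p) -> bdd K f.
Proof. by move=> fc; apply: ccont_bdd; [exact: annulus_compact|exact: fc]. Qed.

Lemma g_unit p : K p -> g p.1 (zz p) \in unitmx.
Proof. by move=> Kp; apply: posdef_unit => v v0; apply: (gp (K_time Kp) (K_neq0 Kp)). Qed.

Lemma bdd_g i j : bdd K (fun p => g p.1 (zz p) i j).
Proof.
apply: bdd_ccont => p Kp; apply: (family_ccont gs).
by split; [exact: K_timeT|exact: K_neq0].
Qed.

Lemma bdd_dz_g k i j : bdd K (fun p => dz k (fun w => g p.1 w i j) (zz p)).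
Proof.
apply: bdd_ccont => p Kp; apply: (family_dz_ccont gs).
by split; [exact: K_timeT|exact: K_neq0].
Qed.

Lemma ccont_det m (M : R * rpt -> 'M[C]_m) p : (forall i j, ccont (fun q => M q i j) p) ->
  ccont (fun q => \det (M q)) p.
Proof.
move=> HM; apply: ccont_sum => s; apply: ccontM; first exact: ccont_cst.
by apply: ccont_prod => i; exact: HM.
Qed.

(** The inverse is continuous, by the cofactor formula, at points where the metric is
    invertible. *)
Lemma bdd_ginv i j : bdd K (fun p => invmx (g p.1 (zz p)) i j).
Proof.
apply: (@eq_bdd _ _ _ (fun p => (\det (g p.1 (zz p)))^-1 *
    ((-1) ^+ (j + i) * \det (row' j (col' i (g p.1 (zz p))))))).
  by move=> p Kp; rewrite /invmx g_unit// !mxE.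
have gc p i' j' : K p -> ccont (fun q => g q.1 (zz q) i' j') p.
  move=> Kp; apply: (family_ccont gs).
  by split; [exact: K_timeT|exact: K_neq0].
apply: bdd_ccont => p Kp; apply: ccontM.
  apply: ccontV; first by have := g_unit Kp; rewrite unitmxE unitfE.
  by apply: ccont_det => i' j'; exact: gc.
apply: ccontM; first exact: ccont_cst.
apply: ccont_det => i' j'.
rewrite (_ : (fun q => _) = (fun q => g q.1 (zz q) (lift j i') (lift i j'))); first exact: gc.
by apply/funext => q'; rewrite !mxE.
Qed.

Lemma continuous_fst_comp (f : R -> R) (p : R * rpt) :
  {for p.1, continuous f} -> {for p, continuous (fun q => f q.1)}.
Proof.
move=> fc; rewrite (_ : (fun q => f q.1) = f \o fst)//.
apply: continuous_comp; last exact: fc.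
exact: cvg_fst.
Qed.

Lemma bdd_al : bdd K (fun p => (al p.1)%:C%C).
Proof.
apply: bdd_ccont => p Kp; apply: ccont_real; apply: continuous_fst_comp.
exact: alc (K_time Kp).
Qed.
Lemma bdd_y : bdd K (fun p => (y p.1)%:C%C).
Proof.
apply: bdd_ccont => p Kp; apply: ccont_real; apply: continuous_fst_comp.
exact: yc (K_time Kp).
Qed.
Lemma bdd_alV : bdd K (fun p => ((al p.1)%:C%C)^-1).
Proof.
apply: bdd_ccont => p Kp; apply: ccontV.
  by rewrite (inj_eq (@complexI R)) gt_eqF// al_gt0// (K_time Kp).
by apply: ccont_real; apply: continuous_fst_comp; exact: alc (K_time Kp).
Qed.
Lemma bdd_yV : bdd K (fun p => ((y p.1)%:C%C)^-1).
Proof.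
apply: bdd_ccont => p Kp; apply: ccontV.
  by rewrite (inj_eq (@complexI R)) gt_eqF// y_gt0// (K_time Kp).
by apply: ccont_real; apply: continuous_fst_comp; exact: yc (K_time Kp).
Qed.
Lemma bdd_coord j : bdd K (fun p => zz p 0 j).
Proof. by apply: bdd_ccont => p Kp; exact: ccont_coord. Qed.
Lemma ccont_sqnorm (p : R * rpt) : ccont (fun p => sqnorm (zz p)) p.
Proof. by apply: ccont_sum => j; exact: ccontM (ccont_coord _ _) (ccont_conj (ccont_coord _ _)). Qed.
Lemma bdd_sqnorm : bdd K (fun p => sqnorm (zz p)).
Proof. by apply: bdd_ccont => p Kp; exact: ccont_sqnorm. Qed.
Lemma bdd_isqnorm : bdd K (fun p => (sqnorm (zz p))^-1).
Proof.
apply: bdd_ccont => p Kp; apply: ccontV (ccont_sqnorm p).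
exact/sqnorm_neq0/K_neq0.
Qed.

Let bc := @bdd_cst R _ K.
Let bal1 : bdd K (fun p => (al p.1)%:C%C * ((y p.1)%:C%C - 1)).
Proof. exact: bddM bdd_al (bddD bdd_y (bddN (bc 1))). Qed.
Let br := bdd_isqnorm.
Let bx := bdd_coord.
Let bu j : bdd K (fun p => (zz p 0 j)^*). Proof. exact: bdd_conj (bx j). Qed.
Let brr : bdd K (fun p => (sqnorm (zz p))^-1 * (sqnorm (zz p))^-1). Proof. exact: bddM br br. Qed.

Lemma bdd_hopf i j : bdd K (fun p => G p.1 (zz p) i j).
Proof.
apply: eq_bdd (bddD (bddM bdd_al (bddM (bc (kron i j)) br)) (bddM bal1 (bddM (bddM (bu i) (bx j)) brr))).
by move=> p Kp; rewrite hopf_metricE beE.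
Qed.

Lemma bdd_dz_hopf k i j : bdd K (fun p => dz k (fun w => G p.1 w i j) (zz p)).
Proof.
apply: eq_bdd (bddD (bddD (bddM (bddM (bddN bdd_al) (bc (kron i j))) (bddM (bu k) brr))
   (bddM (bddM bal1 (bc (kron k j))) (bddM (bu i) brr)))
   (bddM (bddM (bc (- 2)) bal1) (bddM (bddM (bddM (bu i) (bu k)) (bx j)) (bddM br brr)))).
move=> p Kp; rewrite (hopf_DP _ _ _ _ _ (K_neq0 Kp)).
move: ((al p.1)%:C%C : C) ((y p.1)%:C%C : C) ((sqnorm (zz p))^-1) (zz p 0 j).
by move: ((zz p 0 i)^*) ((zz p 0 k)^*) (kron i j) (kron k j) => *; ring.
Qed.

Lemma bdd_hopf_H l k i j :
  bdd K (fun p => dzbar l (fun w => dz k (fun v => G p.1 v i j) w) (zz p)).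
Proof.
have b1 : bdd K (fun p => - (al p.1)%:C%C * kron i j) := bddM (bddN bdd_al) (bc (kron i j)).
have b2 : bdd K (fun p => (- 2) * (sqnorm (zz p))^-1 * ((sqnorm (zz p))^-1 * (sqnorm (zz p))^-1)).
  exact: bddM (bddM (bc (-2)) br) brr.
have brrr := bddM br brr.
have b3 : bdd K (fun p => (- 2) * ((al p.1)%:C%C * ((y p.1)%:C%C - 1)) * zz p 0 j *
   ((sqnorm (zz p))^-1 * ((sqnorm (zz p))^-1 * (sqnorm (zz p))^-1))).
  exact: bddM (bddM (bddM (bc (-2)) bal1) (bx j)) brrr.
apply: eq_bdd (bddD (bddD (bddD (bddM (bddM b1 brr) (bc (kron k l)))
    (bddM (bddM bal1 brr) (bc (kron k j * kron l i))))
  (bddD (bddD (bddD (bddM (bddM b2 b1) (bddM (bu k) (bx l)))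
     (bddM (bddM b2 (bddM bal1 (bu i))) (bddM (bc (kron k j)) (bx l))))
     (bddM b3 (bddM (bc (kron l i)) (bu k))))
     (bddM (bddM b3 (bu i)) (bc (kron k l)))))
  (bddM (bddM (bddM (bddM (bddM (bc 6) bal1) (bu i)) (bx j)) (bddM brrr br)) (bddM (bu k) (bx l)))).
move=> p Kp; rewrite (hopf_H _ _ (K_neq0 Kp)).
move: ((al p.1)%:C%C : C) ((y p.1)%:C%C : C) ((sqnorm (zz p))^-1) (zz p 0 j) (zz p 0 l).
by move: ((zz p 0 i)^*) ((zz p 0 k)^*) (kron i j) (kron k l) (kron k j) (kron l i) => *; ring.
Qed.

Lemma hopf_nz p : K p -> al p.1 != 0 /\ y p.1 != 0.
Proof. by move=> Kp; rewrite !gt_eqF ?al_gt0 ?y_gt0 ?(K_time Kp). Qed.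

Lemma bdd_hopf_inv i j : bdd K (fun p => invmx (G p.1 (zz p)) i j).
Proof.
apply: eq_bdd (bddM bdd_alV (bddD (bddM (bc (kron j i)) bdd_sqnorm)
   (bddM (bddM (bddD bdd_yV (bddN (bc 1))) (bx j)) (bu i)))).
move=> p Kp; have [a0 b0] := hopf_nz Kp.
by rewrite -[RHS]/(ginv (G p.1) (zz p) j i) (hopf_ginv a0 b0 (K_neq0 Kp)).
Qed.

Definition gap (t : R) i j (z : pt) : C := g t z i j - G t z i j.

(** The size of the difference at a point, including its first derivatives there and
    its value at the base point [e0], through which the rate of the comparison
    metrics depends on [g]. *)
Definition gap_size (p : R * rpt) : R :=
  \sum_i \sum_j cnorm (gap p.1 i j (zz p)) +
  \sum_k \sum_i \sum_j cnorm (dz k (gap p.1 i j) (zz p)) +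
  \sum_i \sum_j cnorm (gap p.1 i j e0).

Lemma gap_size_parts p : [/\ 0 <= gap_size p, forall i j, cnorm (gap p.1 i j (zz p)) <= gap_size p,
  forall k i j, cnorm (dz k (gap p.1 i j) (zz p)) <= gap_size p &
  forall i j, cnorm (gap p.1 i j e0) <= gap_size p].
Proof.
have s2 (F : 'I_n -> 'I_n -> R) : (forall i j, 0 <= F i j) ->
    0 <= \sum_i \sum_j F i j /\ forall i j, F i j <= \sum_i \sum_j F i j.
  move=> F0; have S0 i : 0 <= \sum_j F i j by apply: sumr_ge0.
  split=> [|i j]; first by apply: sumr_ge0.
  rewrite (bigD1 i)//= (bigD1 j)//= -addrA lerDl.
  by apply: addr_ge0; apply: sumr_ge0 => k _; [exact: F0|exact: S0].
have [a0 a1] := s2 (fun i j => cnorm (gap p.1 i j (zz p))) (fun i j => cnorm_ge0 _).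
have [c0 c1] := s2 (fun i j => cnorm (gap p.1 i j e0)) (fun i j => cnorm_ge0 _).
have b k := s2 (fun i j => cnorm (dz k (gap p.1 i j) (zz p))) (fun i j => cnorm_ge0 _).
have b0 : 0 <= \sum_k \sum_i \sum_j cnorm (dz k (gap p.1 i j) (zz p)).
  by apply: sumr_ge0 => k _; exact: (b k).1.
have b1 k i j : cnorm (dz k (gap p.1 i j) (zz p)) <=
    \sum_k \sum_i \sum_j cnorm (dz k (gap p.1 i j) (zz p)).
  apply: le_trans ((b k).2 i j) _; rewrite [leRHS](bigD1 k)//= lerDl.
  by apply: sumr_ge0 => k' _; exact: (b k').1.
rewrite /gap_size; move: (\sum_k \sum_i \sum_j _) b0 b1 => B b0 b1.
move: (\sum_i \sum_j cnorm (gap p.1 i j (zz p))) a0 a1 => A a0 a1.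
move: (\sum_i \sum_j cnorm (gap p.1 i j e0)) c0 c1 => D c0 c1.
split=> [|i j|k i j|i j].
- by rewrite !addr_ge0.
- by apply: le_trans (a1 i j) _; rewrite -addrA lerDl addr_ge0.
- by apply: le_trans (b1 k i j) _; rewrite addrAC lerDr addr_ge0.
by apply: le_trans (c1 i j) _; rewrite lerDr addr_ge0.
Qed.

Notation lipK := (lip K gap_size).

Let d_ge0 p : K p -> 0 <= gap_size p. Proof. by have [] := gap_size_parts p. Qed.

Lemma g_CkC p k i j : K p -> CkC k (fun w => g p.1 w i j).
Proof. by move=> Kp; exact: (family_CkC gs _ _ _ (K_timeT Kp)). Qed.

Lemma lip_g i j : lipK (fun p => g p.1 (zz p) i j) (fun p => G p.1 (zz p) i j).
Proof.
split; [exact: bdd_g|exact: bdd_hopf|exists 1 => // p Kp].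
by rewrite mul1r; have [_ h _ _] := gap_size_parts p; exact: h.
Qed.

Lemma dz_gap p A i j : K p -> dfr A (gap p.1 i j) (zz p) =
  dfr A (fun w => g p.1 w i j) (zz p) - dfr A (fun w => G p.1 w i j) (zz p).
Proof.
move=> Kp; exact: (dfrB A (g_CkC 0 i j Kp) (CkC_hopf 0 _ _ i j) (K_neq0 Kp)).
Qed.

Lemma lip_dz k i j : lipK (fun p => dz k (fun w => g p.1 w i j) (zz p))
  (fun p => dz k (fun w => G p.1 w i j) (zz p)).
Proof.
split; [exact: bdd_dz_g|exact: bdd_dz_hopf|exists 1 => // p Kp].
rewrite mul1r; have [_ _ h _] := gap_size_parts p; apply: le_trans (h k i j).
by rewrite -[dz k (gap _ _ _) _]/(dfr (inl k) _ _) dz_gap.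
Qed.

Lemma lip_ginv k l : lipK (fun p => ginv (g p.1) (zz p) k l) (fun p => ginv (G p.1) (zz p) k l).
Proof.
have H := lip_invmx (M := fun p => g p.1 (zz p)) (M' := fun p => G p.1 (zz p)) (K := K) (d := gap_size).
apply: H.
- exact: g_unit.
- by move=> p Kp; have [a0 b0] := hopf_nz Kp; exact: (hopf_unit a0 b0 (K_neq0 Kp)).
- exact: bdd_ginv.
- exact: bdd_hopf_inv.
- exact: lip_g.
Qed.

Hypothesis p0_diag : forall t, 0 <= t <= t1 -> 0 < complex.Re (g t e0 p0 p0).

(** The ratio of the scale of the Hopf metric to the one read off [g] at the
    point [e0]. *)
Definition scale_ratio t : R := al t / complex.Re (g t e0 p0 p0).

Lemma e0_neq0 : e0 != 0.
Proof.
apply/eqP => E; move: e0_sqn; rewrite E /sqn big1; last first.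
  by move=> k _; rewrite mxE /nsq /= expr0n addr0.
by move/eqP; rewrite eq_sym oner_eq0.
Qed.

(** The base point lies on a coordinate axis other than the one of [p0], so the
    radial part of the metric does not contribute to this entry. *)
Lemma hopf_e0 t : G t e0 p0 p0 = (al t)%:C%C.
Proof.
rewrite hopf_metricE e0_p0 conjC0 !mul0r mulr0 addr0 sqn_sqnorm e0_sqn /kron eqxx.
by rewrite mul1r rmorph1 invr1 mulr1.
Qed.

Lemma bdd_aV : bdd K (fun p => ((complex.Re (g p.1 e0 p0 p0))^-1)%:C%C).
Proof.
apply: bdd_ccont => p Kp; apply: ccont_real.
have Ap : t0 < p.1 < T /\ of_real (to_real e0) != 0.
  by split; [exact: K_timeT|rewrite to_realK e0_neq0].
apply: continuousV; first by rewrite gt_eqF// p0_diag// (K_time Kp).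
have [c _] := family_ccont gs p0 p0 (p := (p.1, to_real e0)) Ap.
rewrite (_ : (fun q => complex.Re (g q.1 e0 p0 p0)) =
  (fun q => complex.Re (g q.1 (zz q) p0 p0)) \o (fun q : R * rpt => (q.1, to_real e0))); last first.
  by apply/funext => q' /=; rewrite to_realK.
apply: continuous_comp; last exact: c.
have h1 : (fun q : R * rpt => q.1) @ nbhs p --> nbhs p.1 by exact: cvg_fst.
have h2 : (fun q : R * rpt => to_real e0) @ nbhs p --> nbhs (to_real e0) by exact: cvg_cst.
exact: (cvg_pair h1 h2).
Qed.

(** The numerator and the denominator are the same entry of the two metrics at [e0],
    so the ratio differs from [1] by a multiple of the difference there. *)
Lemma lip_ratio : lipK (fun=> 1) (fun p => (scale_ratio p.1)%:C%C).
Proof.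
have [M M0 HM] := bdd_aV.
split; first exact: bdd_cst.
  apply: eq_bdd (bddM bdd_al bdd_aV) => p Kp.
  by rewrite /scale_ratio rmorphM.
exists M => // p Kp.
have a0 : 0 < complex.Re (g p.1 e0 p0 p0) by rewrite p0_diag// (K_time Kp).
have -> : 1 - (scale_ratio p.1)%:C%C = ((complex.Re (g p.1 e0 p0 p0))^-1)%:C%C *
    (complex.Re (gap p.1 p0 p0 e0))%:C%C :> C.
  rewrite -rmorphM -[1](rmorph1 (real_complex R)) -rmorphB; congr (_%:C%C).
  rewrite /scale_ratio /gap hopf_e0 cReD /=; field; exact: lt0r_neq0.
apply: le_trans (cnormM _ _) _; apply: ler_pM; rewrite ?cnorm_ge0 ?HM//.
have [_ _ _ h] := gap_size_parts p; apply: le_trans (h p0 p0).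
by rewrite cnorm_real /cnorm lerDl.
Qed.

(** The terms of the equation satisfied by [gap] that do not come from the
    principal part of the flow. *)
Definition gap_err (p : R * rpt) i j : C :=
  hcf_rhs (g p.1) ca cb cc cd (zz p) i j
  - (scale_ratio p.1)%:C%C * hcf_rhs (G p.1) ca cb cc cd (zz p) i j
  - \sum_k \sum_l ginv (g p.1) (zz p) k l * dzbar l (dz k (gap p.1 i j)) (zz p).

Lemma dzbar_dz_gap p l k i j : K p -> dzbar l (dz k (gap p.1 i j)) (zz p) =
  dzbar l (fun w => dz k (fun v => g p.1 v i j) w) (zz p) -
  dzbar l (fun w => dz k (fun v => G p.1 v i j) w) (zz p).
Proof.
move=> Kp.
have C1 := CkC_dfr (inl k) (g_CkC 1 i j Kp).
have C2 := CkC_dfr (inl k) (@CkC_hopf R n 1 (al p.1) (al p.1 * (y p.1 - 1)) i j).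
rewrite -[RHS](dfrB (inr l) C1 C2 (K_neq0 Kp)).
apply: (eq_dfr (inr l) _ (K_neq0 Kp)) => w w0.
exact: (dfrB (inl k) (g_CkC 0 i j Kp) (CkC_hopf 0 _ _ i j) w0).
Qed.

(** The lower order terms are polynomials in quantities that are bounded on the
    compact annulus and whose values for the two metrics differ by at most a multiple
    of [gap_size]; the principal parts contribute the difference of the inverse
    metrics times bounded second derivatives of the Hopf metric. *)
Lemma gap_err_bound : exists2 L : R, 0 <= L &
  forall i j p, K p -> cnorm (gap_err p i j) <= L * gap_size p.
Proof.
have [|L L0 HL] := @fin_uniform R ('I_n * 'I_n)%type _ K
   (fun x p => cnorm (gap_err p x.1 x.2)) gap_size d_ge0; last first.
  by exists L => // i j p Kp; exact: (HL (i, j) p Kp).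
move=> [i j] /=.
have Hrefl k l := lip_refl gap_size (bdd_hopf_H l k i j).
have S : lipK
  (fun p => \sum_k \sum_l ginv (g p.1) (zz p) k l * dzbar l (fun w => dz k (fun v => G p.1 v i j) w) (zz p))
  (fun p => \sum_k \sum_l ginv (G p.1) (zz p) k l * dzbar l (fun w => dz k (fun v => G p.1 v i j) w) (zz p)).
  apply: lip_sum => k; apply: lip_sum => l.
  exact: lipM (lip_ginv k l) (Hrefl k l).
have LL := lip_lower_rhs lip_ginv lip_dz ca cb cc cd i j.
have [_ _ [L L0 HL]] := lipM lip_ratio (lipD S LL).
exists L; first exact: L0.
move=> p Kp; have := HL p Kp.
have HX : \sum_k \sum_l ginv (g p.1) (zz p) k l * dzbar l (dz k (gap p.1 i j)) (zz p) =
  \sum_k \sum_l ginv (g p.1) (zz p) k l * dzbar l (fun w => dz k (fun v => g p.1 v i j) w) (zz p) -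
  \sum_k \sum_l ginv (g p.1) (zz p) k l * dzbar l (fun w => dz k (fun v => G p.1 v i j) w) (zz p).
  rewrite -sumrB; apply: eq_bigr => k _; rewrite -sumrB; apply: eq_bigr => l _.
  by rewrite (dzbar_dz_gap l k i j Kp) mulrBr.
have gen (A1 B1 Y X A' : C) : X = A1 - A' -> 1 * (A' + B1) - Y = A1 + B1 - Y - X.
  by move=> ->; ring.
by rewrite (gen _ _ _ _ _ HX).
Qed.

(** The antiholomorphic parts cancel between the derivatives along [V] and [J V]. *)
Lemma real_deriv_rowi (V : pt) (f : pt -> C) (z : pt) : CkC 1 f -> z != 0 ->
  2 * \sum_k V 0 k * dz k f z =
  real_deriv (to_real V) f z - 'i%C * real_deriv (to_real (rowi V)) f z.
Proof.
move=> fC z0; rewrite !real_deriv_dfr// mulr_sumr mulr_sumr -sumrB; apply: eq_bigr => k _.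
have ic : ('i%C : C)^* = - 'i%C by rewrite conjCE; apply: complex_eq; rewrite /= ?oppr0.
have ii : 'i%C * 'i%C = -1 :> C by rewrite -expr2 sqr_i.
rewrite !mxE rmorphM /= ic; move: (dz k f z) (dzbar k f z) ('i%C : C) ii => a b i0 ii.
move: (V 0 k) ((V 0 k)^*) => v v'.
transitivity (v * a * (1 - i0 * i0) + v' * b * (1 + i0 * i0)).
  by rewrite ii; ring.
by ring.
Qed.

Lemma sum2_const (c : R) : \sum_(i < n) \sum_(j < n) c = n%:R ^+ 2 * c.
Proof. by rewrite !sumr_const !card_ord -mulrnA -[LHS]mulr_natl natrM expr2. Qed.

Lemma sum_const (c : R) : \sum_(i < n) c = n%:R * c.
Proof. by rewrite sumr_const card_ord -[LHS]mulr_natl. Qed.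

(** At a spatial maximum of the weighted norm of [gap], all lower order terms are
    absorbed by the second derivatives, up to a multiple of the norm itself. *)
Lemma spatial_bound : exists2 B : R, 0 <= B & forall p, K p ->
  (forall w, w != 0 -> sqn w * sqn w * frob2 (gap p.1) w <= sqn (zz p) * sqn (zz p) * frob2 (gap p.1) (zz p)) ->
  2 * complex.Re (\sum_i \sum_j (gap p.1 i j (zz p))^* *
    (\sum_k \sum_l ginv (g p.1) (zz p) k l * dzbar l (dz k (gap p.1 i j)) (zz p) + gap_err p i j))
  <= B * frob2 (gap p.1) (zz p).
Proof.
have [L L0 HL] := gap_err_bound.
have [MI MI0 HMI] : exists2 M : R, 0 <= M & forall k p, K p -> cnorm (ginv (g p.1) (zz p) k k) <= M * 1.
  apply: (@fin_uniform _ _ _ K (fun k p => cnorm (ginv (g p.1) (zz p) k k)) (fun=> 1)) => // k.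
  by have [M M0 H] := bdd_ginv k k; exists M => // p Kp; rewrite mulr1 H.
have [MG MG0 HMG] : exists2 M : R, 0 <= M & forall k p, K p -> cnorm (g p.1 (zz p) k k) <= M * 1.
  apply: (@fin_uniform _ _ _ K (fun k p => cnorm (g p.1 (zz p) k k)) (fun=> 1)) => // k.
  by have [M M0 H] := bdd_g k k; exists M => // p Kp; rewrite mulr1 H.
pose N : R := n%:R.
have N0 : 0 <= N := ler0n _ _.
pose D := N * (6 * (N * MI + 1) ^+ 2).
pose MU := 2 + MG.
pose a1 := N ^+ 2 * 2 + N ^+ 2 * (2 * q).
pose a2 := N * (N ^+ 2 * (N * (MU * 2))).
have MU0 : 0 <= MU by rewrite addr_ge0.
have q0 : 0 <= q by rewrite (le_trans ler01).
have NN2 : 0 <= N ^+ 2 := sqr_ge0 _.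
have a10 : 0 <= a1 by apply: addr_ge0; apply: mulr_ge0 => //; apply: mulr_ge0.
have a20 : 0 <= a2 by do 4?[apply: mulr_ge0 => //].
have D0 : 0 <= D by apply: mulr_ge0 => //; apply: mulr_ge0 => //; exact: sqr_ge0.
pose A' := N ^+ 2 * (2 * L * a1); pose B' := N ^+ 2 * (2 * L * a2).
have A0 : 0 <= A' by do 3?[apply: mulr_ge0 => //].
have B0 : 0 <= B' by do 3?[apply: mulr_ge0 => //].
(* the constant produced by [absorb] *)
exists (D / 2 + 2 * A' + 2 * B' ^+ 2); first by do 2?[apply: addr_ge0]; rewrite ?divr_ge0//; apply: mulr_ge0 => //; exact: sqr_ge0.
move=> p Kp zmax; set z := zz p in zmax *; have z0 : z != 0 := K_neq0 Kp.
set t := p.1 in zmax *.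
have tt := K_time Kp.
have hC i j : CkC 2 (gap t i j).
  apply: (CkCB (g_CkC 2 i j Kp)); exact: CkC_hopf.
have hh w : w != 0 -> forall i j, gap t j i w = (gap t i j w)^*.
  by move=> w0 i j; rewrite /gap (gh tt w0 i j) (hopf_hermitian (al t) (y t) w i j) rmorphB.
have [V [U [VE UV UB]]] := adapted_frame (gh tt z0) (gp tt z0).
have WE k l : ginv (g t) z k l = \sum_a V a 0 k * (V a 0 l)^* by rewrite -VE.
have OM := operator_max hC hh z0 zmax WE.
set x := complex.Re (\sum_i \sum_j (gap t i j z)^* * \sum_k \sum_l ginv (g t) z k l * dzbar l (dz k (gap t i j)) z) in OM.
set Q := frame_energy _ _ _ in OM.
have Q0 : 0 <= Q.
  by apply: sumr_ge0 => a _; apply: sumr_ge0 => i _; apply: sumr_ge0 => j _; rewrite addr_ge0 ?nsq_ge0.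
have NN0 : 0 <= frob2 (gap t) z := frob2_ge0 _ _.
(* [s] measures the difference and [e] its first derivatives along the frame *)
pose s := Num.sqrt (frob2 (gap t) z); pose e := Num.sqrt Q.
have s0 : 0 <= s := sqrtr_ge0 _.
have e0' : 0 <= e := sqrtr_ge0 _.
have ss : s ^+ 2 = frob2 (gap t) z by rewrite sqr_sqrtr.
have ee : e ^+ 2 = Q by rewrite sqr_sqrtr.
have [sz1 szq] : 1 <= sqn z /\ sqn z <= q by have [_ /andP[]] := Kp.
have VB a : sqn (V a) <= N * MI.
  rewrite /sqn /N -sum_const; apply: ler_sum => k _.
  apply: (@le_trans _ _ (complex.Re (ginv (g t) z k k))); last first.
    by apply: le_trans (Re_le_cn _) _; rewrite -[MI]mulr1; exact: HMI.
  rewrite WE Re_sum (bigD1 a)//= mul_conj_nsq /= lerDl.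
  by apply: sumr_ge0 => b _; rewrite mul_conj_nsq; exact: nsq_ge0.
have DB : \sum_a 6 * ((sqn (V a) + sqn z) / sqn z) ^+ 2 <= D.
  rewrite /D {1}/N -sum_const; apply: ler_sum => a _.
  have sz0 : 0 < sqn z by exact: lt_le_trans sz1.
  have Va0 := sqn_ge0 (V a); have zz0 := ltW sz0.
  have x0 : 0 <= (sqn (V a) + sqn z) / sqn z by apply: divr_ge0 => //; exact: addr_ge0.
  have y0' : 0 <= N * MI + 1 by apply: addr_ge0 => //; exact: mulr_ge0.
  rewrite ler_pM2l// ler_sqr ?nnegrE//.
  rewrite mulrDl divff ?(gt_eqF sz0)// lerD2r; apply: le_trans (VB a).
  by rewrite ler_pdivrMr// ler_peMr ?sqn_ge0.
have OM' : 4 * x + e ^+ 2 <= s ^+ 2 * D.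
  by rewrite ee ss; apply: le_trans OM _; exact: ler_wpM2l.
have hB i j : cnorm (gap t i j z) <= 2 * s.
  apply: cnorm_nsq => //; rewrite ss; exact: (le_sum2 (fun i j => nsq_ge0 (gap t i j z))).
(* the maximum is compared with the base point, where the weight is [1] *)
have hE i j : cnorm (gap t i j e0) <= 2 * (q * s).
  apply: cnorm_nsq; first exact: mulr_ge0.
  apply: (@le_trans _ _ (frob2 (gap t) e0)).
    exact: (le_sum2 (fun i j => nsq_ge0 (gap t i j e0))).
  have := zmax e0 e0_neq0; rewrite e0_sqn !mul1r => H; apply: le_trans H _.
  rewrite exprMn ss ler_wpM2r// expr2; apply: ler_pM => //; exact: sqn_ge0.
have dB a i j : cnorm (real_deriv (to_real (V a)) (gap t i j) z) <= 2 * e /\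
    cnorm (real_deriv (to_real (rowi (V a))) (gap t i j) z) <= 2 * e.
  have [H1 H2] := frame_energy_term (gap t) V z a i j.
  by split; apply: cnorm_nsq e0' _; rewrite ee; [exact: H1|exact: H2].
(* every holomorphic derivative is recovered from those along the frame, with the
   dual frame as coefficients *)
have gB k i j : cnorm (dz k (gap t i j) z) <= N * (MU * 2) * e.
  pose X a := \sum_l V a 0 l * dz l (gap t i j) z.
  have XB a : cnorm (X a) <= 2 * e.
    have [d1 d2] := dB a i j.
    exact: (cnorm_half (real_deriv_rowi (V a) (CkCW (hC i j)) z0) d1 d2).
  have -> : dz k (gap t i j) z = \sum_a U k a * X a.
    rewrite -(sum_delta k (fun l => dz l (gap t i j) z)).
    under [RHS]eq_bigr do rewrite mulr_sumr; rewrite exchange_big; apply: eq_bigr => l _ /=.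
    by rewrite -UV mulr_suml; apply: eq_bigr => a _; rewrite mulrA.
  apply: le_trans (cnorm_sum _ _ _) _.
  rewrite /N -mulrA -sum_const; apply: ler_sum => a _.
  apply: le_trans (cnormM _ _) _; rewrite -mulrA; apply: ler_pM; rewrite ?cnorm_ge0 ?XB//.
  apply: cnorm_nsq2; apply: le_trans (UB k a) _; apply: le_trans (Re_le_cn _) _.
  by rewrite -[MG]mulr1; exact: HMG.
have deltaB : gap_size p <= a1 * s + a2 * e.
  rewrite /gap_size -/z -/t.
  have b1 : \sum_i \sum_j cnorm (gap t i j z) <= N ^+ 2 * (2 * s).
    by rewrite -sum2_const; apply: ler_sum => i _; apply: ler_sum => j _.
  have b3 : \sum_i \sum_j cnorm (gap t i j e0) <= N ^+ 2 * (2 * (q * s)).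
    by rewrite -sum2_const; apply: ler_sum => i _; apply: ler_sum => j _.
  have b2 : \sum_k \sum_i \sum_j cnorm (dz k (gap t i j) z) <= N * (N ^+ 2 * (N * (MU * 2) * e)).
    rewrite {1}/N -sum_const; apply: ler_sum => k _.
    by rewrite -sum2_const; apply: ler_sum => i _; apply: ler_sum => j _.
  apply: le_trans (lerD (lerD b1 b2) b3) _; rewrite /a1 /a2 le_eqVlt.
  by apply/orP; left; apply/eqP; ring.
set w := complex.Re (\sum_i \sum_j (gap t i j z)^* * gap_err p i j).
have wB : w <= A' * s ^+ 2 + B' * s * e.
  apply: (@le_trans _ _ (N ^+ 2 * (2 * s * (L * (a1 * s + a2 * e))))).
    rewrite /w Re_sum -sum2_const; apply: ler_sum => i _; rewrite Re_sum; apply: ler_sum => j _.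
    apply: le_trans (Re_le_cn _) _; apply: le_trans (cnormM _ _) _; rewrite cnorm_conj.
    apply: ler_pM; rewrite ?cnorm_ge0 ?hB//; apply: le_trans (HL i j p Kp) _.
    exact: ler_wpM2l.
  by rewrite /A' /B' le_eqVlt; apply/orP; left; apply/eqP; ring.
have -> : complex.Re (\sum_i \sum_j (gap t i j z)^* *
    (\sum_k \sum_l ginv (g t) z k l * dzbar l (dz k (gap t i j)) z + gap_err p i j)) = x + w.
  rewrite /x /w -cReD -big_split; congr (complex.Re _); apply: eq_bigr => i _.
  by rewrite -big_split; apply: eq_bigr => j _; rewrite mulrDr.
rewrite -ss; exact: absorb B0 OM' wB.
Qed.

End CompareWithHopf.

(** * Derivatives in time and fundamental domains *)

Section TimeTools.
Context {R : realType}.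
Notation C := R[i].

(** The difference quotients with negative increments are non-negative. *)
Lemma derive_ge0_left_max (f : R -> R) (t D : R) : 0 < t -> is_derive t 1 f D ->
  (forall s, 0 <= s <= t -> f s <= f t) -> 0 <= D.
Proof.
move=> t0 df fmax; rewrite leNgt; apply/negP => D0.
have dq : (fun h : R => h^-1 *: ((f \o shift t) (h *: 1) - f t)) @ 0^' --> D.
  rewrite -(@derive_val _ _ _ _ _ _ _ df); exact: (@ex_derive _ _ _ _ _ _ _ df).
have [e /= e0 He] : \forall h \near 0^', h^-1 *: ((f \o shift t) (h *: 1) - f t) < 0.
  exact: (cvgr_lt _ dq).
pose h := - Num.min (e / 2) t.
have m0 : 0 < Num.min (e / 2) t by rewrite lt_min divr_gt0.
have h0 : h < 0 by rewrite oppr_lt0.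
have hin : ball 0 e h.
  by rewrite /ball /= sub0r normrN ltr0_norm// opprK gt_min ltr_pdivrMr// ltr_pMr// ltr1n.
have := He h hin (ltr0_neq0 h0).
rewrite [h *: _]mulr1 ltNge => /negP; apply.
rewrite -[_ *: _]/(_ * _) mulr_le0 ?invr_le0 ?(ltW h0)// subr_le0; apply: fmax.
have ht : - h <= t by rewrite opprK ge_min lexx orbT.
by clear hin; move: h h0 ht => h' h1 ht /=; lra.
Qed.

Lemma is_derive_sum2 n m (t : R) (F : 'I_n -> 'I_m -> R -> R) (D : 'I_n -> 'I_m -> R) :
  (forall i j, is_derive t 1 (F i j) (D i j)) ->
  is_derive t 1 (fun s => \sum_i \sum_j F i j s) (\sum_i \sum_j D i j).
Proof.
move=> H; rewrite (_ : (fun s => _) = \sum_i \sum_j F i j).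
  by apply: is_derive_sum => i; apply: is_derive_sum => j; exact: H.
by apply/funext => s; rewrite !fct_sumE; apply: eq_bigr => i _; rewrite fct_sumE.
Qed.

Lemma is_derive_nsq (t : R) (f : R -> C) (D : C) :
  is_derive t 1 (fun s => complex.Re (f s)) (complex.Re D) ->
  is_derive t 1 (fun s => complex.Im (f s)) (complex.Im D) ->
  is_derive t 1 (fun s => nsq (f s)) (2 * complex.Re ((f t)^* * D)).
Proof.
move=> d1 d2; rewrite (_ : (fun s => _) =
  (fun s => complex.Re (f s)) * (fun s => complex.Re (f s)) +
  (fun s => complex.Im (f s)) * (fun s => complex.Im (f s))); last first.
  by apply/funext => s; rewrite /nsq !expr2.
apply: (is_derive_eq (is_deriveD (is_deriveM d1 d1) (is_deriveM d2 d2))).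
rewrite conjCE cReM /= /GRing.scale /=; case: (f t) D {d1 d2} => a b [c d] /=.
by ring.
Qed.

Lemma nsqM (a b : C) : nsq (a * b) = nsq a * nsq b.
Proof. by case: a b => a1 a2 [b1 b2]; rewrite /nsq cReM cImM /=; ring. Qed.

Lemma nsq_eq0 (c : C) : nsq c = 0 -> c = 0.
Proof. by move=> c0; apply/eqP/negPn/negP => /nsq_neq0; rewrite c0 eqxx. Qed.

Lemma nsq_conj (c : C) : nsq c^* = nsq c.
Proof. by case: c => a b; rewrite /nsq conjCE /= sqrrN. Qed.

(** By Bernoulli's inequality. *)
Lemma expr_unbounded (k x : R) : 1 < k -> exists m, x <= k ^+ m.
Proof.
move=> k1; have k0 : 0 < k - 1 by rewrite subr_gt0.
pose m := Num.bound `|x / (k - 1)|; exists m.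
have H : 1 + m%:R * (k - 1) <= k ^+ m.
  elim: m => [|m IH]; first by rewrite mul0r addr0 expr0.
  rewrite exprS -natr1; apply: (@le_trans _ _ (k * (1 + m%:R * (k - 1)))).
    have : 0 <= (m%:R : R) * (k - 1) ^+ 2 by rewrite mulr_ge0 ?sqr_ge0.
    by move: (m%:R : R) => u; clear; nra.
  by rewrite ler_pM2l// (lt_trans ltr01).
apply: le_trans H; have : x / (k - 1) < m%:R.
  by apply: le_lt_trans (ler_norm _) _; exact: archi_boundP.
by rewrite ltr_pdivrMr// => /ltW h; rewrite (le_trans h)// lerDr.
Qed.

(** Repeated application of [D] or of [D'] moves any point into the annulus; an
    induction on a power of [k] that exceeds the distance to cover replaces
    logarithms. *)
Lemma fundamental_annulus (X : Type) (s : X -> R) (E : X -> X -> Prop) (k : R) (D D' : X -> X) :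
  1 < k -> (forall x, E x x) -> (forall x y z, E x y -> E y z -> E x z) ->
  (forall x, 0 < s x -> s (D x) = k * s x /\ E x (D x)) ->
  (forall x, 0 < s x -> s (D' x) = k^-1 * s x /\ E x (D' x)) ->
  forall x, 0 < s x -> exists2 y, E x y & 1 <= s y <= k.
Proof.
move=> k1 Er Et HD HD' x sx.
have k0 : 0 < k by exact: lt_trans k1.
have [s1|s1] := leP 1 (s x).
  have [m] := expr_unbounded (s x) k1.
  elim: m x s1 sx => [|m IH] x s1 sx xm.
    by exists x => //; rewrite s1 (le_trans xm)// ltW.
  have [sk|sk] := leP (s x) k; first by exists x => //; rewrite s1.
  have [e1 e2] := HD' x sx.
  have d1 : 1 <= s (D' x) by rewrite e1 mulrC ler_pdivlMr// mul1r ltW.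
  have [||z Dz zK] := IH (D' x) d1; first exact: lt_le_trans d1.
    by rewrite e1 mulrC ler_pdivrMr// -exprSr.
  by exists z => //; exact: Et Dz.
have [m xm] := expr_unbounded (s x)^-1 k1.
have {xm} : 1 <= s x * k ^+ m by rewrite -(divff (lt0r_neq0 sx)) ler_pM2l.
move: (ltW s1); elim: m x sx {s1} => [|m IH] x sx s1 xm.
  by exists x => //; rewrite expr0 mulr1 in xm; rewrite xm (le_trans s1)// ltW.
have [e1 e2] := HD x sx.
have [sk|/ltW sk] := leP 1 (s (D x)).
  by exists (D x) => //; rewrite sk e1 ger_pMr.
have [||z Dz zK] := IH (D x) _ sk; first by rewrite e1 mulr_gt0.
  by move: xm; rewrite e1 exprS mulrA [s x * k]mulrC.
by exists z => //; exact: Et Dz.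
Qed.

End TimeTools.

(** * Solutions starting at a Hopf metric *)

Section Uniqueness.
Context {R : realType} {n : nat}.
Notation C := R[i].
Notation pt := 'rV[C]_n.
Notation rpt := ('rV[R]_n * 'rV[R]_n)%type.
Variables (t0 t1 T : R) (g : R -> metric R n) (al y : R -> R) (e0 : pt) (p0 : 'I_n).
Variables (ca cb cc cd : R) (lam : pt) (ell : R).
Hypotheses (t00 : t0 < 0) (t10 : 0 <= t1) (t1T : t1 < T).
Hypothesis gs : forall i j,
  let A := [set p : R * rpt | t0 < p.1 < T /\ of_real p.2 != 0] in
  smooth_on A (fun p => complex.Re (g p.1 (of_real p.2) i j)) /\
  smooth_on A (fun p => complex.Im (g p.1 (of_real p.2) i j)).
Hypothesis gh : forall t, 0 <= t <= t1 -> forall z, z != 0 -> forall i j, g t z j i = (g t z i j)^*.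
Hypothesis gp : forall t, 0 <= t <= t1 -> forall z, z != 0 -> forall v : pt, v != 0 ->
  0 < \sum_i \sum_j v 0 i * (v 0 j)^* * g t z i j.
Hypothesis al_gt0 : forall t, 0 <= t <= t1 -> 0 < al t.
Hypothesis y_gt0 : forall t, 0 <= t <= t1 -> 0 < y t.
Hypothesis alc : forall t, 0 <= t <= t1 -> {for t, continuous al}.
Hypothesis yc : forall t, 0 <= t <= t1 -> {for t, continuous y}.
Hypotheses (e0_sqn : sqn e0 = 1) (e0_p0 : e0 0 p0 = 0).
Hypothesis p0_diag : forall t, 0 <= t <= t1 -> 0 < complex.Re (g t e0 p0 p0).
Hypotheses (ell0 : 0 < ell) (ell1 : ell != 1) (lam_ell : forall i, nsq (lam 0 i) = ell).
Hypothesis gdeck : forall t, 0 <= t <= t1 -> forall z, z != 0 -> forall i j,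
  g t z i j = lam 0 i * (lam 0 j)^* * g t (deck lam z) i j.
Hypothesis gflow : forall t, 0 < t <= t1 -> forall z, z != 0 -> forall i j,
  time_deriv (fun s => g s z i j) t = hcf_rhs (g t) ca cb cc cd z i j.

Notation G t := (@hopf_metric R n (al t) (al t * (y t - 1))).
Notation zz p := (of_real p.2 : pt).
Notation hh := (@gap R n g al y).
Notation rho := (scale_ratio g al e0 p0).
Notation N := (n%:R : R).
Notation B := (1 + ca + 2 * cb + (N - 1) * cd).
Notation A := ((N - 1) * (ca - 1 + (N - 1) * cc)).
Hypothesis al_ode : forall t, 0 < t <= t1 -> is_derive t 1 al (rho t * (- N + B * y t)).
Hypothesis aly_ode : forall t, 0 < t <= t1 ->
  is_derive t 1 (fun s => al s * y s) (rho t * (A * y t ^+ 2)).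
Hypothesis init : forall z, z != 0 -> g 0 z = G 0 z.

Lemma cReB (u v : C) : complex.Re (u - v) = complex.Re u - complex.Re v.
Proof. by case: u v => ? ? []. Qed.
Lemma cImB (u v : C) : complex.Im (u - v) = complex.Im u - complex.Im v.
Proof. by case: u v => ? ? []. Qed.

(** In terms of the projections, the coefficients of the metric are [al] and
    [al * y], the quantities that the scalar equations govern. *)
Lemma hopf_split s z i j : G s z i j = (al s)%:C%C * (perp z i j * (sqnorm z)^-1) +
  (al s * y s)%:C%C * ((z 0 i)^* * z 0 j * ((sqnorm z)^-1 * (sqnorm z)^-1)).
Proof.
have E : (al s * y s)%:C%C = (al s)%:C%C * (y s)%:C%C :> C := rmorphM _ _ _.
rewrite hopf_metricE beE /perp E.
move: ((al s)%:C%C : C) ((y s)%:C%C : C) ((sqnorm z)^-1) (kron i j) (z 0 j) ((z 0 i)^*) => *; ring.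
Qed.

Lemma is_derive_real_mul (f : R -> R) (f' : R) (c : C) (t : R) : is_derive t 1 f f' ->
  is_derive t 1 (fun s => complex.Re ((f s)%:C%C * c)) (complex.Re (f'%:C%C * c)) /\
  is_derive t 1 (fun s => complex.Im ((f s)%:C%C * c)) (complex.Im (f'%:C%C * c)).
Proof.
move=> df; case: c => a b; split.
  rewrite (_ : (fun s => _) = a *: f).
    by apply: (is_derive_eq (is_deriveZ a df)); rewrite cReM /= mul0r subr0 mulrC.
  by apply/funext => s; rewrite cReM /= mul0r subr0 mulrC.
rewrite (_ : (fun s => _) = b *: f).
  by apply: (is_derive_eq (is_deriveZ b df)); rewrite cImM /= mul0r addr0 mulrC.
by apply/funext => s; rewrite cImM /= mul0r addr0 mulrC.
Qed.

(** Since [hopf_rhs] has the same two tensors as the metric, the scalar equations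
    express that the Hopf metrics follow the flow at the rate [scale_ratio]. *)
Lemma hopf_time (t : R) z i j : 0 < t <= t1 -> z != 0 ->
  let D := (rho t)%:C%C * hcf_rhs (G t) ca cb cc cd z i j in
  is_derive t 1 (fun s => complex.Re (G s z i j)) (complex.Re D) /\
  is_derive t 1 (fun s => complex.Im (G s z i j)) (complex.Im D).
Proof.
move=> tt z0 D; have /andP[t_gt0 tt1] := tt.
have tt' : 0 <= t <= t1 by rewrite ltW.
have a0 : al t != 0 by rewrite gt_eqF// al_gt0.
have b0 : y t != 0 by rewrite gt_eqF// y_gt0.
pose P := perp z i j * (sqnorm z)^-1.
pose E := (z 0 i)^* * z 0 j * ((sqnorm z)^-1 * (sqnorm z)^-1).
have DE : D = (rho t * (- N + B * y t))%:C%C * P + (rho t * (A * y t ^+ 2))%:C%C * E.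
  have M u v : (u * v)%:C%C = u%:C%C * v%:C%C :> C := rmorphM _ _ _.
  rewrite /D (hopf_rhs a0 b0 z0) (M (rho t) (- N + _)) (M (rho t) (A * _)) /P /E.
  move: ((- N + B * y t)%:C%C : C) ((A * y t ^+ 2)%:C%C : C) ((rho t)%:C%C : C).
  move: ((sqnorm z)^-1) (perp z i j) (z 0 j) ((z 0 i)^*) => *; ring.
have [r1 i1] := is_derive_real_mul P (al_ode tt).
have [r2 i2] := is_derive_real_mul E (aly_ode tt).
rewrite DE; split.
  rewrite (_ : (fun s => _) = (fun s => complex.Re ((al s)%:C%C * P)) +
    (fun s => complex.Re ((al s * y s)%:C%C * E))); last first.
    by apply/funext => s; rewrite hopf_split cReD.
  by rewrite cReD; exact: is_deriveD.
rewrite (_ : (fun s => _) = (fun s => complex.Im ((al s)%:C%C * P)) +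
    (fun s => complex.Im ((al s * y s)%:C%C * E))); last first.
  by apply/funext => s; rewrite hopf_split cImD.
by rewrite cImD; exact: is_deriveD.
Qed.

Lemma gap_time (t : R) z i j : 0 < t <= t1 -> z != 0 ->
  let D := hcf_rhs (g t) ca cb cc cd z i j - (rho t)%:C%C * hcf_rhs (G t) ca cb cc cd z i j in
  is_derive t 1 (fun s => complex.Re (hh s i j z)) (complex.Re D) /\
  is_derive t 1 (fun s => complex.Im (hh s i j z)) (complex.Im D).
Proof.
move=> tt z0 D; have /andP[t_gt0 tt1] := tt.
have [h1 h2] := hopf_time i j tt z0.
have tT : t0 < t < T by rewrite (lt_trans t00)// (le_lt_trans tt1).
have [f1 f2] := family_time gs i j tT z0.
have E := gflow tt z0 i j.
have E1 : 'D_1 (fun s => complex.Re (g s z i j)) t = complex.Re (hcf_rhs (g t) ca cb cc cd z i j).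
  by rewrite -E /time_deriv /= derive1E.
have E2 : 'D_1 (fun s => complex.Im (g s z i j)) t = complex.Im (hcf_rhs (g t) ca cb cc cd z i j).
  by rewrite -E /time_deriv /= derive1E.
have d1 := derivableP f1; rewrite E1 in d1.
have d2 := derivableP f2; rewrite E2 in d2.
rewrite /D; move: (hcf_rhs (g t) _ _ _ _ z i j) d1 d2 => X d1 d2.
move: (_ * hcf_rhs (G t) _ _ _ _ z i j) h1 h2 => Y h1 h2; split.
  rewrite (_ : (fun s => _) = (fun s => complex.Re (g s z i j)) - (fun s => complex.Re (G s z i j))).
    by rewrite cReB; exact: is_deriveB.
  by apply/funext => s; rewrite cReB.
rewrite (_ : (fun s => _) = (fun s => complex.Im (g s z i j)) - (fun s => complex.Im (G s z i j))).
  by rewrite cImB; exact: is_deriveB.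
by apply/funext => s; rewrite cImB.
Qed.

(** The squared norm of an invariant tensor with two lower indices scales by the
    power [-2] of the factor of [|z|^2]; the weight compensates for this. *)
Definition weighted_gap t z : R := sqn z * sqn z * frob2 (hh t) z.

Lemma sqn_deck z : sqn (deck lam z) = ell * sqn z.
Proof.
by rewrite /sqn mulr_sumr; apply: eq_bigr => k _; rewrite mxE nsqM lam_ell.
Qed.

(** All the factors [lam] have the same modulus, and the metric has degree [-2] in
    [z]. *)
Lemma hopf_deck t z i j : z != 0 ->
  G t z i j = lam 0 i * (lam 0 j)^* * G t (deck lam z) i j.
Proof.
move=> z0; have sz : (sqn z)%:C%C != 0 :> C by rewrite -sqn_sqnorm sqnorm_neq0.
have lz : ell%:C%C != 0 :> C by rewrite (inj_eq (@complexI R)) gt_eqF.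
have Ll k : lam 0 k * (lam 0 k)^* = ell%:C%C by rewrite mul_conj_nsq lam_ell.
have M : (ell * sqn z)%:C%C = ell%:C%C * (sqn z)%:C%C :> C := rmorphM _ _ _.
rewrite !hopf_metricE sqn_sqnorm (sqn_sqnorm (deck _ _)) sqn_deck M !mxE.
have Mc : (lam 0 i * z 0 i)^* = (lam 0 i)^* * (z 0 i)^* := rmorphM _ _ _.
rewrite /kron Mc.
have Kl : lam 0 i * (lam 0 j)^* * (i == j)%:R = ell%:C%C * (i == j)%:R.
  by have [->|_] := eqVneq i j; rewrite ?mulr0// Ll.
have := Ll i; have := Ll j; move: Kl lz sz ((al t)%:C%C : C) ((al t * (y t - 1))%:C%C : C).
move: (lam 0 i) ((lam 0 i)^*) (lam 0 j) ((lam 0 j)^*) (ell%:C%C : C) ((sqn z)%:C%C : C) (z 0 j) ((z 0 i)^*).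
move: ((i == j)%:R : C) => K li li' lj lj' l s zj zi' Kl lz sz a b Ej Ei.
transitivity (a * ((li * lj' * K) / (l * s)) + b * ((li * li') * (lj * lj') * (zi' * zj) / (l * s * (l * s)))).
  by rewrite Kl Ei Ej; field; rewrite lz sz.
by field; rewrite lz sz.
Qed.

Lemma weighted_gap_deck t z : 0 <= t <= t1 -> z != 0 -> weighted_gap t (deck lam z) = weighted_gap t z.
Proof.
move=> tt z0; have E i j : nsq (hh t i j z) = ell * ell * nsq (hh t i j (deck lam z)).
  rewrite /gap (gdeck tt z0 i j) (hopf_deck t i j z0) -mulrBr !nsqM nsq_conj !lam_ell.
  by [].
rewrite /weighted_gap sqn_deck /frob2; under [in RHS]eq_bigr do under eq_bigr do rewrite E.
under [in RHS]eq_bigr do rewrite -mulr_sumr; rewrite -mulr_sumr.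
by move: (\sum_i _) (sqn z) => u v; ring.
Qed.

Definition modulus : R := Num.max ell ell^-1.

Lemma modulus_gt1 : 1 < modulus.
Proof.
rewrite /modulus lt_max; have [//|l1|E] := ltgtP 1 ell; last by move: ell1; rewrite -E eqxx.
by rewrite invf_gt1// l1.
Qed.

Lemma modulusE : (modulus = ell /\ modulus^-1 = ell^-1) \/ (modulus = ell^-1 /\ modulus^-1 = ell).
Proof.
by rewrite /modulus; have [_|_] := leP ell ell^-1; [right|left]; rewrite ?invrK.
Qed.

Definition undeck (z : pt) : pt := deck (\row_k (lam 0 k)^-1) z.

Lemma deckK z : deck lam (undeck z) = z.
Proof.
apply/rowP => k; rewrite !mxE mulrA divff ?mul1r//.
by apply/eqP => E; have := lam_ell k; rewrite E /nsq /= expr0n addr0 => /eqP; rewrite lt_eqF.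
Qed.

Lemma sqn_neq0 (z : pt) : (0 < sqn z) = (z != 0).
Proof.
apply/idP/idP; last exact: sqn_gt0.
by apply: contraTneq => ->; rewrite /sqn big1 ?ltxx// => k _; rewrite mxE /nsq /= expr0n addr0.
Qed.

(** The maximum over the compact annulus is therefore a maximum over the whole
    punctured space, as the second derivative test requires. *)
Lemma reduce_to_annulus z : z != 0 -> exists2 w, 1 <= sqn w <= modulus &
  forall t, 0 <= t <= t1 -> weighted_gap t w = weighted_gap t z.
Proof.
rewrite -sqn_neq0 => sz.
pose E z w := forall t, 0 <= t <= t1 -> weighted_gap t w = weighted_gap t z.
have H1 x : 0 < sqn x -> sqn (deck lam x) = ell * sqn x /\ E x (deck lam x).
  by rewrite sqn_neq0 => x0; split=> [|t tt]; [exact: sqn_deck|exact: weighted_gap_deck].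
have H2 x : 0 < sqn x -> sqn (undeck x) = ell^-1 * sqn x /\ E x (undeck x).
  rewrite sqn_neq0 => x0.
  have S : sqn (undeck x) = ell^-1 * sqn x.
    by rewrite -{2}(deckK x) sqn_deck mulKf// gt_eqF.
  split=> // t tt; rewrite -{2}(deckK x) weighted_gap_deck//.
  by rewrite -sqn_neq0 S mulr_gt0 ?invr_gt0// sqn_neq0.
have Er x : E x x by [].
have Et x v w : E x v -> E v w -> E x w by move=> e1 e2 t tt; rewrite e2// e1.
have [w Ew Kw] : exists2 w, E z w & 1 <= sqn w <= modulus.
  case: modulusE => -[M1 M2].
    by apply: (fundamental_annulus (D := deck lam) (D' := undeck) modulus_gt1 Er Et) => //;
      rewrite ?M1 ?M2.
  by apply: (fundamental_annulus (D := undeck) (D' := deck lam) modulus_gt1 Er Et) => //;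
     rewrite ?M2 ?M1.
by exists w.
Qed.

Lemma weighted_gap_ge0 t z : 0 <= weighted_gap t z.
Proof. by rewrite !mulr_ge0// ?sqn_ge0// frob2_ge0. Qed.

Lemma continuous_frob2 p : annulus t1 modulus p ->
  {for p, continuous (fun q => weighted_gap q.1 (zz q))}.
Proof.
move=> Kp; have t1T' := t1T.
have gc i j : ccont (fun q => g q.1 (zz q) i j) p.
  apply: (family_ccont gs); split; first exact: (K_timeT t00 t1T' Kp).
  exact: (K_neq0 Kp).
have tp := K_time Kp.
have Gc i j : ccont (fun q => G q.1 (zz q) i j) p.
  rewrite (_ : (fun q => _) = (fun q : R * rpt => (al q.1)%:C%C * (kron i j * (sqnorm (zz q))^-1) +
    ((al q.1)%:C%C * ((y q.1)%:C%C - 1)) * ((zz q 0 i)^* * zz q 0 j *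
       ((sqnorm (zz q))^-1 * (sqnorm (zz q))^-1)))); last first.
    by apply/funext => q; rewrite hopf_metricE beE.
  have c1 : ccont (fun q : R * rpt => (al q.1)%:C%C) p.
    by apply: ccont_real; apply: continuous_fst_comp; exact: alc.
  have c2 : ccont (fun q : R * rpt => (y q.1)%:C%C) p.
    by apply: ccont_real; apply: continuous_fst_comp; exact: yc.
  have c3 : ccont (fun q : R * rpt => (sqnorm (zz q))^-1) p.
    by apply: ccontV (ccont_sqnorm p); exact/sqnorm_neq0/(K_neq0 Kp).
  have c4 k := ccont_coord p k.
  exact: (ccontD (ccontM c1 (ccontM (ccont_cst _ _) c3))
    (ccontM (ccontM c1 (ccontD c2 (ccont_cst _ _)))
       (ccontM (ccontM (ccont_conj (c4 i)) (c4 j)) (ccontM c3 c3)))).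
have hc i j : {for p, continuous (fun q => nsq (hh q.1 i j (zz q)))}.
  by apply: continuous_nsq; exact: ccontD (gc i j) (ccontN (Gc i j)).
have Nc : ccont (fun q => (\sum_i \sum_j (nsq (hh q.1 i j (zz q)))%:C%C)) p.
  by apply: ccont_sum => i; apply: ccont_sum => j; exact: ccont_real.
have sc := @continuous_sqn R n p.
rewrite (_ : (fun q => _) = (fun q => sqn (zz q) * sqn (zz q) *
   complex.Re (\sum_i \sum_j (nsq (hh q.1 i j (zz q)))%:C%C : C))); last first.
  by apply/funext => q; rewrite /weighted_gap /frob2 Re_sum; congr (_ * _); apply: eq_bigr => i _; rewrite Re_sum.
exact: continuousM (continuousM sc sc) Nc.1.
Qed.

(** Otherwise the damped weighted norm has a positive maximum over the annulus and the
    time interval.  There its time derivative is non-negative, so the norm grows at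
    least at the rate of the damping, against [spatial_bound]. *)
Lemma weighted_gap_eq0 t z : 0 <= t <= t1 -> z != 0 -> weighted_gap t z = 0.
Proof.
move=> tt z0; have q1 : 1 <= modulus := ltW modulus_gt1.
have [Bd Bd0 HB] := spatial_bound ca cb cc cd t00 t1T q1 gs gh gp al_gt0 y_gt0 alc yc e0_sqn e0_p0 p0_diag.
(* the damping exceeds by one the constant of [spatial_bound] *)
pose U (p : R * rpt) := expR (- (Bd + 1) * p.1) * weighted_gap p.1 (zz p).
have inK s (w : pt) : 0 <= s <= t1 -> 1 <= sqn w <= modulus -> @annulus R n t1 modulus (s, to_real w).
  by move=> ss ww; split=> //=; rewrite to_realK.
have K0 : @annulus R n t1 modulus !=set0.
  by exists (0, to_real e0); apply: inK; rewrite ?lexx ?e0_sqn ?lexx.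
have Uc : {within @annulus R n t1 modulus, continuous U}.
  apply: continuous_in_subspaceT => p; rewrite inE => Kp.
  have c0 : {for p.1, continuous (fun s : R => - (Bd + 1) * s)}.
    exact: (continuousM (@cvg_cst _ _ _ _ _) (@cvg_id _ _)).
  have c1 : {for p.1, continuous (fun s : R => expR (- (Bd + 1) * s))}.
    exact: (continuous_comp c0 (@continuous_expR R _)).
  exact: (continuousM (continuous_fst_comp c1) (continuous_frob2 Kp)).
have [p pK pmax] := compact_EVT_max K0 (@annulus_compact R n t1 modulus q1) Uc.
have {pK} Kp : annulus t1 modulus p by move: pK; rewrite inE.
have {}pmax s (w : pt) : 0 <= s <= t1 -> w != 0 -> expR (- (Bd + 1) * s) * weighted_gap s w <= U p.
  move=> ss w0; have [w' ww Ew] := reduce_to_annulus w0.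
  rewrite -Ew//; have := pmax (s, to_real w'); rewrite /U /= to_realK; apply.
  by rewrite inE; exact: inK.
have Ep s : 0 < expR (- (Bd + 1) * s) by exact: expR_gt0.
suff U0 : U p <= 0.
  have := le_trans (pmax t z tt z0) U0; rewrite pmulr_rle0// => P0.
  by apply/eqP; rewrite eq_le P0 weighted_gap_ge0.
rewrite leNgt; apply/negP => Upos.
have pt := K_time Kp; have pz0 := K_neq0 Kp.
(* at time [0] the two metrics coincide, so the maximum is at a positive time *)
have t_gt0 : 0 < p.1.
  rewrite lt_neqAle eq_sym; have /andP[-> _] := pt; rewrite andbT; apply/eqP => E.
  move: Upos; rewrite /U E /weighted_gap /frob2 !big1 ?mulr0 ?ltxx// => i _; rewrite big1// => j _.
  by rewrite /gap init// subrr /nsq /= expr0n addr0.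
have ptt : 0 < p.1 <= t1 by rewrite t_gt0; have /andP[_ ->] := pt.
set zp := zz p in pz0 *.
have s0 : 0 < sqn zp by rewrite sqn_neq0.
have zmax (w : 'rV[C]_n) : w != 0 -> sqn w * sqn w * frob2 (hh p.1) w <= sqn zp * sqn zp * frob2 (hh p.1) zp.
  by move=> w0; have := pmax p.1 w pt w0; rewrite /U ler_pM2l.
have := HB p Kp zmax.
set D := 2 * complex.Re _ => DB.
have dN : is_derive p.1 1 (fun s => frob2 (hh s) zp) D.
  rewrite (_ : D = \sum_i \sum_j 2 * complex.Re ((hh p.1 i j zp)^* *
     (hcf_rhs (g p.1) ca cb cc cd zp i j - (rho p.1)%:C%C * hcf_rhs (G p.1) ca cb cc cd zp i j))).
    apply: is_derive_sum2 => i j.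
    have [d1 d2] := gap_time i j ptt pz0.
    exact: is_derive_nsq d1 d2.
  rewrite /D Re_sum mulr_sumr; apply: eq_bigr => i _; rewrite Re_sum mulr_sumr; apply: eq_bigr => j _.
  by rewrite /gap_err addrC subrK.
have dE : is_derive p.1 1 (fun s => expR (- (Bd + 1) * s)) (expR (- (Bd + 1) * p.1) * - (Bd + 1)).
  have d1 : is_derive p.1 1 (fun s : R => - (Bd + 1) * s) (- (Bd + 1)).
    by apply: (is_derive_eq (is_deriveZ (- (Bd + 1)) (is_derive_id p.1 1))); rewrite [_ *: _]mulr1.
  exact: (is_derive1_comp (is_derive_expR _) d1).
have Emax s : 0 <= s <= p.1 -> expR (- (Bd + 1) * s) * frob2 (hh s) zp <=
    expR (- (Bd + 1) * p.1) * frob2 (hh p.1) zp.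
  move=> /andP[s_ge0 sp]; have ss : 0 <= s <= t1.
    by rewrite s_ge0 (le_trans sp)//; have /andP[] := pt.
  have := pmax s zp ss pz0; rewrite /U /weighted_gap -/zp !(mulrCA (expR _)).
  by rewrite ler_pM2l// mulr_gt0.
have := derive_ge0_left_max t_gt0 (is_deriveM dE dN) Emax.
have -> : expR (- (Bd + 1) * p.1) *: D + frob2 (hh p.1) zp *: (expR (- (Bd + 1) * p.1) * - (Bd + 1)) =
   expR (- (Bd + 1) * p.1) * (D - (Bd + 1) * frob2 (hh p.1) zp).
  rewrite /GRing.scale /=; move: (expR _) D {DB dN} (frob2 _ _) => *; ring.
rewrite (pmulr_rge0 _ (Ep _)).
have Npos : 0 < frob2 (hh p.1) zp.
  by move: Upos; rewrite /U pmulr_rgt0// /weighted_gap pmulr_rgt0// mulr_gt0.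
move: DB Npos; rewrite -/zp; clearbody D; move: D (frob2 _ _) {dN} => D N0; lra.
Qed.

(** A vanishing weighted norm forces every entry of the difference to vanish. *)
Lemma flow_is_hopf t z : 0 <= t <= t1 -> z != 0 -> g t z = G t z.
Proof.
move=> tt z0; have := weighted_gap_eq0 tt z0.
have s0 : 0 < sqn z by rewrite sqn_neq0.
move/eqP; rewrite mulf_eq0 (gt_eqF (mulr_gt0 s0 s0)) /= => /eqP N0.
apply/matrixP => i j; apply/eqP; rewrite -subr_eq0; apply/eqP/nsq_eq0/eqP.
rewrite eq_le nsq_ge0 andbT -[leRHS]N0.
exact: (le_sum2 (fun i j => nsq_ge0 (hh t i j z))).
Qed.

End Uniqueness.

(** * Preservation of the non-negativity *)

Section HopfFlowPreserved.
Context {R : realType}.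
Notation C := R[i].

(** Truncation of the time to a segment, written with absolute values so that its
    continuity is immediate. *)
Definition clip (t x : R) : R := (`|x| + x - (`|x - t| + (x - t))) / 2.

Lemma clip_range t x : 0 <= t -> 0 <= clip t x <= t.
Proof.
move=> t0; rewrite /clip; case: (lerP 0 x) => x0; case: (lerP 0 (x - t)) => xt;
  rewrite ?(ger0_norm x0) ?(ltr0_norm x0) ?(ger0_norm xt) ?(ltr0_norm xt); apply/andP; split; lra.
Qed.

Lemma clip_id t x : 0 <= x <= t -> clip t x = x.
Proof.
by move=> /andP[x0 xt]; rewrite /clip ger0_norm// ler0_norm ?subr_le0//; lra.
Qed.

Lemma continuous_clip t : continuous (clip t).
Proof.
move=> x; rewrite /clip.
have c1 : {for x, continuous (fun x : R => `|x|)} by exact: norm_continuous.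
have c2 : {for x, continuous (fun x : R => x - t)}.
  exact: (continuousB (@cvg_id _ _) (@cvg_cst _ _ _ _ _)).
have c3 : {for x, continuous (fun x : R => `|x - t|)}.
  exact: (continuous_comp c2 (@norm_continuous _ _ _)).
have c4 : {for x, continuous (fun x : R => `|x| + x)} by exact: (continuousD c1 (@cvg_id _ _)).
have c5 : {for x, continuous (fun x : R => `|x - t| + (x - t))} by exact: (continuousD c3 c2).
exact: (continuousM (continuousB c4 c5) (@cvg_cst _ _ _ _ _)).
Qed.

Lemma is_derive_continuous (f : R -> R) (t d : R) : is_derive t 1 f d -> {for t, continuous f}.
Proof.
by move=> df; apply/differentiable_continuous/derivable1_diffP; exact: (@ex_derive _ _ _ _ _ _ _ df).
Qed.

(** The common squared modulus of the factors of the deck transformation is not zero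
    because they are not all zero. *)
Lemma deck_factor n (lam : 'rV[C]_n.+1) : lam != 0 ->
  (forall i j, `|lam 0 i| = `|lam 0 j|) -> (forall i, `|lam 0 i| != 1) ->
  exists ell : R, [/\ 0 < ell, ell != 1 & forall i, nsq (lam 0 i) = ell].
Proof.
move=> l0 ll l1; have E i : (nsq (lam 0 i))%:C%C = `|lam 0 i| ^+ 2 by rewrite normCK mul_conj_nsq.
have H i : nsq (lam 0 i) = nsq (lam 0 0).
  by apply: (@complexI R); rewrite !E (ll i 0).
exists (nsq (lam 0 0)); split=> [||//].
  rewrite lt_neqAle nsq_ge0 andbT eq_sym; apply: contraNneq l0 => Z.
  by apply/eqP/rowP => i; rewrite mxE; apply: nsq_eq0; rewrite H.
apply: contra (l1 0) => /eqP Z; have := E 0; rewrite Z => /esym/eqP.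
have -> : 1%:C%C = 1 :> C by [].
by rewrite sqrp_eq1.
Qed.

Lemma sqn_delta n (k : 'I_n) : sqn (delta_mx 0 k : 'rV[C]_n) = 1.
Proof.
rewrite /sqn (bigD1 k)//= big1 ?addr0 => [|j jk]; rewrite mxE eqxx /= ?eqxx ?(negbTE jk).
  by rewrite /nsq /= expr0n expr1n addr0.
by rewrite /nsq /= expr0n addr0.
Qed.

Lemma delta_diag n (M : 'M[C]_n) (k : 'I_n) :
  \sum_i \sum_j (delta_mx 0 k : 'rV[C]_n) 0 i * ((delta_mx 0 k : 'rV[C]_n) 0 j)^* * M i j = M k k.
Proof.
rewrite (bigD1 k)//= [X in _ + X]big1 ?addr0; last first.
  by move=> i ik; rewrite big1// => j _; rewrite mxE eqxx (negbTE ik) !mul0r.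
rewrite (bigD1 k)//= big1 ?addr0; last first.
  by move=> j jk; rewrite !mxE !eqxx (negbTE jk) conjC0 mulr0 mul0r.
by rewrite !mxE !eqxx conjC1 !mul1r.
Qed.

(** As long as the flow exists, it consists of the metrics [hopf_metric] given by the
    scalar equations, so that its anisotropy stays bounded by [1 + gamma]. *)
Lemma flow_griffiths n (lam : 'rV[C]_n) (hn : (2 <= n)%N) (alpha0 y0 a b c d T t ell : R) (g : R -> metric R n) :
  0 < ell -> ell != 1 -> (forall i, nsq (lam 0 i) = ell) ->
  0 < alpha0 -> 0 < y0 -> y0 <= 1 + gamma R n ->
  (n%:R - 2) * a - 2 * b + (n%:R - 1) ^+ 2 * c - (n%:R - 1) * d
             <= n%:R * (gamma R n / (gamma R n + 1)) ->
  HCF_solution lam a b c d T g ->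
  (forall z : 'rV[C]_n, z != 0 -> g 0 z = hopf_metric alpha0 (alpha0 * (y0 - 1)) z) ->
  0 <= t < T -> bismut_griffiths_nonneg (g t).
Proof.
move=> ell0 ell1 lam_ell al00 y00 y0g habcd [[t0 t00 gs] flow] init /andP[t_ge0 tT].
have tT0 s : 0 <= s <= t -> 0 <= s < T by move=> /andP[-> st]; exact: le_lt_trans tT.
have tTt s : 0 <= s <= t -> t0 < s < T.
  by move=> /tT0/andP[s0 ->]; rewrite (lt_le_trans t00 s0).
have gh s : 0 <= s <= t -> forall z, z != 0 -> forall i j, g s z j i = (g s z i j)^*.
  by move=> /tT0/flow[/(_ _ _)H _] z z0; have [] := H z z0.
have gp s : 0 <= s <= t -> forall z, z != 0 -> forall v : 'rV[C]_n, v != 0 ->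
    0 < \sum_i \sum_j v 0 i * (v 0 j)^* * g s z i j.
  by move=> /tT0/flow[/(_ _ _)H _] z z0; have [] := H z z0.
have gdeck s : 0 <= s <= t -> forall z, z != 0 -> forall i j,
    g s z i j = lam 0 i * (lam 0 j)^* * g s (deck lam z) i j.
  by move=> /tT0/flow[/(_ _ _)H _] z z0; have [] := H z z0.
have gflow s : 0 < s <= t -> forall z, z != 0 -> forall i j,
    time_deriv (fun s => g s z i j) s = hcf_rhs (g s) a b c d z i j.
  move=> /andP[s0 st] z z0 i j; have ss : 0 <= s <= t by rewrite ltW.
  have [_ [Gam GC GE]] := flow s (tT0 s ss).
  rewrite GE//; apply: chern_rhs => //.
  - by move=> p q; apply: (family_CkC gs); exact: tTt.
  - by move=> w w0; apply: posdef_unit => v v0; exact: gp.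
  exact: gh.
pose e0 : 'rV[C]_n := delta_mx 0 (Ordinal (ltnW hn)); pose p0 : 'I_n := Ordinal hn.
have e0_sqn : sqn e0 = 1 by exact: sqn_delta.
have e0_p0 : e0 0 p0 = 0 by rewrite mxE.
have e00 : e0 != 0 by exact: e0_neq0.
have p0_diag s : 0 <= s <= t -> 0 < complex.Re (g s e0 p0 p0).
  move=> ss; have v0 : (delta_mx 0 p0 : 'rV[C]_n) != 0 by apply: e0_neq0; exact: sqn_delta.
  by have := gp s ss e0 e00 _ v0; rewrite delta_diag ltcE => /andP[].
(* the rate, frozen outside the time interval so as to be continuous on the line *)
pose f s := (complex.Re (g (clip t s) e0 p0 p0))^-1.
have cr s := clip_range s t_ge0.
have fc : continuous f.
  move=> s; apply: continuousV; first by rewrite gt_eqF// p0_diag.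
  have [d1 _] := family_time gs p0 p0 (tTt _ (cr s)) e00.
  have c1 := is_derive_continuous (derivableP d1).
  exact: (continuous_comp (@continuous_clip t s) c1).
have f0 s : 0 <= f s by rewrite invr_ge0 ltW// p0_diag.
set K := _ - _ in habcd.
have N0 : 0 < n%:R :> R by rewrite ltr0n ltnW.
have g1 : 0 < 1 + gamma R n.
  by rewrite /gamma; case: ifP => _; lra.
(* the lower bound for the inverse anisotropy that amounts to the criterion *)
pose m := (1 + gamma R n)^-1.
have m0 : 0 < m by rewrite invr_gt0.
have mE : m <= (n%:R - K) / n%:R.
  rewrite mulrBl divff ?gt_eqF//.
  have : K / n%:R <= gamma R n / (gamma R n + 1) by rewrite ler_pdivrMr// mulrC.
  have -> : gamma R n / (gamma R n + 1) = 1 - m by rewrite /m; field; rewrite gt_eqF.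
  by move: (K / n%:R) => u; lra.
have E0 : 0 < n%:R - K.
  by have := lt_le_trans m0 mE; rewrite pmulr_lgt0// invr_gt0.
have mv : m <= y0^-1 by rewrite /m lef_pV2.
have [al [v [al0 v0 ode]]] := hopf_ode (1 + a + 2 * b + (n%:R - 1) * d) fc f0 N0 E0 al00 m0 mE mv.
pose y s := (v s)^-1.
have vpos s : 0 <= s <= t -> 0 < v s.
  by move=> /andP[/ode[_ h _ _] _]; exact: lt_le_trans h.
have rE s : 0 <= s <= t -> scale_ratio g al e0 p0 s = f s * al s.
  by move=> ss; rewrite /scale_ratio /f clip_id// mulrC.
have gG : forall z, z != 0 -> g t z = hopf_metric (al t) (al t * (y t - 1)) z.
  move=> z z0; have tt : 0 <= t <= t by rewrite t_ge0 lexx.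
  apply: (flow_is_hopf (lam := lam) t00 t_ge0 tT gs gh gp _ _ _ _ e0_sqn e0_p0 p0_diag ell0 ell1 lam_ell
    gdeck gflow _ _ _ tt z0).
  - by move=> s /andP[/ode[]].
  - by move=> s ss; rewrite invr_gt0 vpos.
  - by move=> s /andP[/ode[_ _ d1 _] _]; exact: is_derive_continuous d1.
  - move=> s ss; have /andP[/ode[_ _ _ d1] _] := ss.
    by apply: continuousV; [rewrite gt_eqF// vpos|exact: is_derive_continuous d1].
  - move=> s /andP[s0 st]; have ss : 0 <= s <= t by rewrite ltW.
    by rewrite rE//; have [_ _ d1 _] := ode s (ltW s0).
  - move=> s /andP[s0 st]; have ss : 0 <= s <= t by rewrite ltW.
    rewrite rE//; have [_ _ d1 d2] := ode s (ltW s0).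
    have vs := lt0r_neq0 (vpos s ss).
    apply: (is_derive_eq (is_deriveM d1 (is_deriveV vs d2))).
    rewrite /y /K /GRing.scale /=; move: (f s) (al s) (v s) vs => f1 a1 v1 vs.
    by field.
  by move=> w w0; rewrite init// al0 /y v0 invrK.
apply: (eq_griffiths (g := hopf_metric (al t) (al t * (y t - 1)))).
  by move=> z z0; rewrite gG.
have [a1 v1 _ _] := ode t t_ge0.
apply: griffiths_suff => //.
by rewrite /y -[leRHS]invrK lef_pV2// posrE ?vpos ?t_ge0 ?lexx.
Qed.

End HopfFlowPreserved.

Theorem theorem5 (R : realType) (n : nat) (hn : (2 <= n)%N)
    (lam : 'rV[R[i]]_n) (hlam0 : lam != 0)
    (hlam : forall i j : 'I_n, `|lam 0 i| = `|lam 0 j|)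
    (hlam1 : forall i : 'I_n, `|lam 0 i| != 1)
    (alpha0 beta0 : R) (halpha : 0 < alpha0) (hbeta : - alpha0 < beta0)
    (a b c d : R)
    (habcd : (n%:R - 2) * a - 2 * b + (n%:R - 1) ^+ 2 * c - (n%:R - 1) * d
             <= n%:R * (gamma R n / (gamma R n + 1)))
    (h0 : bismut_griffiths_nonneg (@hopf_metric R n alpha0 beta0)) :
  forall (T : R) (g : R -> metric R n),
    0 < T ->
    HCF_solution lam a b c d T g ->
    (forall z : 'rV[R[i]]_n, z != 0 -> g 0 z = hopf_metric alpha0 beta0 z) ->
    forall t : R, 0 <= t < T -> bismut_griffiths_nonneg (g t).
Proof.
move=> T g _ flow init t tT.
have [ell [ell0 ell1 lam_ell]] : exists ell : R, [/\ 0 < ell, ell != 1 & forall i, nsq (lam 0 i) = ell].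
  by case: n hn lam hlam0 hlam hlam1 {habcd h0 g flow init} => // n _ lam; exact: deck_factor.
pose y0 := (alpha0 + beta0) / alpha0.
have a0 := lt0r_neq0 halpha.
have y0_gt0 : 0 < y0 by rewrite divr_gt0//; lra.
have bE : beta0 = alpha0 * (y0 - 1) by rewrite /y0; field.
rewrite bE in init h0.
have yg := griffiths_nec hn halpha (lt0r_neq0 y0_gt0) h0.
exact: (flow_griffiths hn ell0 ell1 lam_ell halpha y0_gt0 yg habcd flow init tT).
Qed.
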